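(* (1) For surfaces $\Sigma$ in a conformal manifold of dimension $d=3$, the ASC obstruction density is given by $$\mathcal B=-\frac13\Big(\bar\nabla_a\bar\nabla_b+H\,\mathring{\mathrm{II}}_{ab}+\mathrm P_{ab}^\top\Big)\mathring{\mathrm{II}}^{ab}.$$ (2) For hypersurfaces in conformally flat four-manifolds ($d=4$), the ASC obstruction density is expressed, using a flat scale, by $$\mathcal B=\frac16\Big((\bar\nabla_c\mathring{\mathrm{II}}_{ab})^2+2\,\mathring{\mathrm{II}}^{ab}\bar\Delta\mathring{\mathrm{II}}_{ab}+\frac32(\bar\nabla^b\mathring{\mathrm{II}}_{ab})\bar\nabla^c\mathring{\mathrm{II}}^a{}_c-2\bar{\mathrm J}\,\mathring{\mathrm{II}}_{ab}\mathring{\mathrm{II}}^{ab}+(\mathring{\mathrm{II}}_{ab}\mathring{\mathrm{II}}^{ab})^2\Big).$$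
   Context: $(M,\boldsymbol c)$ is a smooth oriented $d$-manifold with a conformal class of Riemannian metrics, $\Sigma$ a smoothly embedded codimension-1 submanifold. $\mathcal E[w]$ is the bundle of conformal densities of weight $w$ (oriented $\frac w{2d}$-th root of $(\Lambda^dTM)^2$; a section is represented by functions $f_g$, $g\in\boldsymbol c$, with $f_{\Omega^2g}=\Omega^wf_g$); $\boldsymbol g$ is the conformal metric. For $\sigma\in\Gamma(\mathcal E[1])$ let $I_\sigma^2:=\boldsymbol g^{ab}(\nabla_a\sigma)(\nabla_b\sigma)-\frac2d\sigma(\Delta\sigma+\mathrm J\sigma)$ with $\nabla,\Delta=\boldsymbol g^{ab}\nabla_a\nabla_b,\mathrm J=\mathrm{Sc}/(2(d-1))$ those of any $g\in\boldsymbol c$. The ASC obstruction density is $\mathcal B=B_{\bar\sigma}|_\Sigma$ (a weight $-d$ density on $\Sigma$), where $\bar\sigma\in\Gamma(\mathcal E[1])$ is a smooth defining density for $\Sigma$ (zero locus $\Sigma$, $\nabla\bar\sigma\ne0$ on $\Sigma$) with $I^2_{\bar\sigma}=1+\bar\sigma^dB_{\bar\sigma}$, $B_{\bar\sigma}$ smooth; it depends only on the conformal embedding and the orientation of $\Sigma$. The formulas are in a scale $g\in\boldsymbol c$ (in (2), a flat metric $g\in\boldsymbol c$), with: $\hat n$ the unit conormal to $\Sigma$, with orientation that of $\nabla\bar\sigma|_\Sigma$; $\mathrm{II}_{ab}=\nabla_a^\top\hat n_b|_\Sigma$, where $\nabla^\top_a=(\delta_a^b-\hat n_a\hat n^b)\nabla_b$;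 $H=\frac1{d-1}\mathrm{II}^a{}_a$; $\mathring{\mathrm{II}}_{ab}=\mathrm{II}_{ab}-H\bar g_{ab}$ with $\bar g$ the induced metric; $\bar\nabla,\bar\Delta$ the Levi-Civita connection and Laplacian ($\bar\Delta=\bar g^{ab}\bar\nabla_a\bar\nabla_b$) of $\bar g$; $\bar{\mathrm J}=\overline{\mathrm{Sc}}/(2(d-2))$ with $\overline{\mathrm{Sc}}$ the scalar curvature of $\bar g$; $\mathrm P_{ab}$ the Schouten tensor of $g$ ($\mathrm{Ric}_{ab}=(d-2)\mathrm P_{ab}+\mathrm Jg_{ab}$, $\mathrm J=\mathrm P^a{}_a$) and $\mathrm P^\top_{ab}$ its projection to $\Sigma$. $(\bar\nabla_c\mathring{\mathrm{II}}_{ab})^2$ is the squared norm. In (1), $\bar\nabla_a\bar\nabla_b$ acts on $\mathring{\mathrm{II}}^{ab}$. *)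

(* Defs.v *)
From HB Require Import structures.
From mathcomp Require Import all_boot all_order all_algebra.
From mathcomp Require Import all_classical all_reals all_analysis.

Set Implicit Arguments.
Unset Strict Implicit.
Unset Printing Implicit Defensive.

Import Order.TTheory GRing.Theory Num.Theory.
Import numFieldNormedType.Exports.

Local Open Scope classical_set_scope.
Local Open Scope ring_scope.

Section coordinate_calculus.
Variables (R : realType) (n : nat).
Implicit Types (x : 'rV[R]_n) (f : 'rV[R]_n -> R) (a b c d e : 'I_n).
Implicit Types (g : 'rV[R]_n -> 'M[R]_n).

Definition partial a f : 'rV[R]_n -> R := fun x => 'D_(delta_mx 0 a) f x.

(* C^oo on U (always used with U open): the iterated partial derivatives of
   every order are differentiable, hence continuous, at every point of U *)
Definition smooth_on (U : set 'rV[R]_n) f :=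
  forall (s : seq 'I_n) x, U x -> differentiable (foldr partial f s) x.

Definition grad f x : 'rV[R]_n := \row_a partial a f x.

Definition ginv g a b x : R := invmx (g x) a b.

(* christoffel g c a b = Gamma^c_{ab} *)
Definition christoffel g c a b x : R :=
  2^-1 * \sum_e ginv g c e x *
    (partial a (fun y => g y e b) x + partial b (fun y => g y e a) x
     - partial e (fun y => g y a b) x).

(* riemann g a b c d = R_{ab}^c_d, where
   (nabla_a nabla_b - nabla_b nabla_a) v^c = R_{ab}^c_d v^d *)
Definition riemann g a b c d x : R :=
  partial a (christoffel g c b d) x - partial b (christoffel g c a d) x
  + \sum_e (christoffel g c a e x * christoffel g e b d x
            - christoffel g c b e x * christoffel g e a d x).

Definition ricci g a b x : R := \sum_c riemann g c a c b x.

Definition scalar_curv g x : R := \sum_a \sum_b ginv g a b x * ricci g a b x.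

(* J = Sc / (2 (n - 1)) and Ric = (n - 2) P + J g, n being the dimension of
   the space on which g is a metric: with n = d - 1 the first one is the J of
   the induced metric of a hypersurface of a d-manifold *)
Definition schoutenJ g x : R := scalar_curv g x / (2 * (n%:R - 1)).

Definition schouten g a b x : R :=
  (ricci g a b x - schoutenJ g x * g x a b) / (n%:R - 2).

Definition laplacian g f x : R :=
  \sum_a \sum_b ginv g a b x *
    (partial a (partial b f) x - \sum_c christoffel g c a b x * partial c f x).

(* the representative of I_sigma^2 in the scale g *)
Definition Isquare g f x : R :=
  (grad f x *m invmx (g x) *m (grad f x)^T) 0 0
  - 2 / n%:R * f x * (laplacian g f x + schoutenJ g x * f x).

Definition tensor2 := 'I_n -> 'I_n -> 'rV[R]_n -> R.
Definition tensor3 := 'I_n -> 'I_n -> 'I_n -> 'rV[R]_n -> R.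
Definition tensor4 := 'I_n -> 'I_n -> 'I_n -> 'I_n -> 'rV[R]_n -> R.

(* covariant derivatives of covariant tensors, the new index coming first *)
Definition nabla2 g (T : tensor2) : tensor3 := fun c a b x =>
  partial c (T a b) x
  - \sum_e (christoffel g e c a x * T e b x + christoffel g e c b x * T a e x).

Definition nabla3 g (T : tensor3) : tensor4 := fun d c a b x =>
  partial d (T c a b) x
  - \sum_e (christoffel g e d c x * T e a b x + christoffel g e d a x * T c e b x
            + christoffel g e d b x * T c a e x).

Definition trace2 g (T : tensor2) x : R := \sum_a \sum_b ginv g a b x * T a b x.

(* S_{ab} T^{ab} *)
Definition inner2 g (S T : tensor2) x : R :=
  \sum_a \sum_b \sum_c \sum_d ginv g a c x * ginv g b d x * S a b x * T c d x.

(* S_{cab} T^{cab} *)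
Definition inner3 g (S T : tensor3) x : R :=
  \sum_a \sum_b \sum_c \sum_d \sum_e \sum_h
    ginv g a d x * ginv g b e x * ginv g c h x * S a b c x * T d e h x.

(* nabla_a nabla_b T^{ab} *)
Definition divdiv2 g (T : tensor2) x : R :=
  \sum_a \sum_b \sum_c \sum_d
    ginv g a c x * ginv g b d x * nabla3 g (nabla2 g T) a b c d x.

(* (Delta T)_{ab} *)
Definition laplacian2 g (T : tensor2) : tensor2 := fun a b x =>
  \sum_c \sum_d ginv g c d x * nabla3 g (nabla2 g T) c d a b x.

(* nabla^b T_{ab} *)
Definition div2 g (T : tensor2) a x : R :=
  \sum_b \sum_c ginv g b c x * nabla2 g T c a b x.

(* u_a v^a *)
Definition inner1 g (u v : 'I_n -> 'rV[R]_n -> R) x : R :=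
  \sum_a \sum_b ginv g a b x * u a x * v b x.

End coordinate_calculus.

(* Hypersurface geometry in coordinates: F is a parametrization of the
   hypersurface by an open subset of R^m, read in a chart of the ambient
   space, g the components of the ambient metric in that chart, and nu those
   of the unit conormal along F. Tensors on the hypersurface are given by their
   components in the coordinates of R^m. *)
Section hypersurface.
Variables (R : realType) (m : nat).
Variables (g : 'rV[R]_m.+1 -> 'M[R]_m.+1) (F nu : 'rV[R]_m -> 'rV[R]_m.+1).
Implicit Types (u : 'rV[R]_m) (i j : 'I_m).

Definition induced_metric u : 'M[R]_m :=
  jacobian F u *m g (F u) *m (jacobian F u)^T.

(* (d_i F^a) nabla_a nu_b, which only involves nu along the hypersurface *)
Definition nabla_conormal i (b : 'I_m.+1) u : R :=
  partial i (fun v => nu v 0 b) u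
  - \sum_a \sum_c
      christoffel g c a b (F u) * jacobian F u i a * nu u 0 c.

(* nabla^T_a nu_b has no normal part, so that it is determined by its
   components in tangential directions *)
Definition second_ff : tensor2 R m := fun i j u =>
  \sum_b nabla_conormal i b u * jacobian F u j b.

Definition mean_curv u : R := m%:R^-1 * trace2 induced_metric second_ff u.

Definition tracefree_ff : tensor2 R m := fun i j u =>
  second_ff i j u - mean_curv u * induced_metric u i j.

Definition schouten_top : tensor2 R m := fun i j u =>
  \sum_a \sum_b jacobian F u i a * jacobian F u j b * schouten g a b (F u).

End hypersurface.

(* A smooth oriented d-manifold, given by an oriented smooth atlas; chart_point
   is the inverse of the chart map. *)
Record oriented_manifold (R : realType) (d : nat) := OrientedManifold {
  carrier :> topologicalType ;
  chart : Type ;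
  chart_dom : chart -> set carrier ;
  chart_map : chart -> carrier -> 'rV[R]_d ;
  chart_point : chart -> 'rV[R]_d -> carrier ;
  manifold_hausdorff : hausdorff_space carrier ;
  manifold_second_countable : @second_countable carrier ;
  chart_cover : forall p, exists k, chart_dom k p ;
  chart_dom_open : forall k, open (chart_dom k) ;
  chart_image_open : forall k, open (chart_map k @` chart_dom k) ;
  chart_mapK : forall k p, chart_dom k p -> chart_point k (chart_map k p) = p ;
  chart_map_continuous :
    forall k p, chart_dom k p -> {for p, continuous (chart_map k)} ;
  chart_point_continuous :
    forall k x, (chart_map k @` chart_dom k) x ->
      {for x, continuous (chart_point k)} ;
  transition_smooth :
    forall k l a, smooth_on (chart_map k @` (chart_dom k `&` chart_dom l))
      (fun x => chart_map l (chart_point k x) 0 a) ;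
  transition_oriented :
    forall k l p, chart_dom k p -> chart_dom l p ->
      0 < \det (jacobian (chart_map l \o chart_point k) (chart_map k p))
}.

Section conformal_manifold.
Variables (R : realType) (d : nat) (M : oriented_manifold R d).
Implicit Types (k l : chart M) (p : M) (f : M -> R).

Definition chart_image k : set 'rV[R]_d := chart_map k @` chart_dom k.

Definition in_chart (T : Type) (f : M -> T) k : 'rV[R]_d -> T :=
  f \o chart_point k.

Definition smooth_fun f := forall k, smooth_on (chart_image k) (in_chart f k).

(* g k p is the matrix of components at p of a covariant 2-tensor in the chart
   k; it is meaningful for p in the domain of k only *)
Definition metric_components := chart M -> M -> 'M[R]_d.
Implicit Types (g h : metric_components) (c : set metric_components).

Definition riemannian_metric g :=
  [/\ forall k a b,
        smooth_on (chart_image k) (fun x => in_chart (g k) k x a b),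
      forall k p, chart_dom k p -> (g k p)^T = g k p,
      forall k p, chart_dom k p -> forall v : 'rV[R]_d, v != 0 ->
        0 < (v *m g k p *m v^T) 0 0 &
      forall k l p, chart_dom k p -> chart_dom l p ->
        let J := jacobian (chart_map l \o chart_point k) (chart_map k p) in
        g k p = J *m g l p *m J^T].

(* h = Omega^2 g *)
Definition conformal_rescaling (Omega : M -> R) g h :=
  [/\ smooth_fun Omega, forall p, 0 < Omega p &
      forall k p, chart_dom k p -> h k p = Omega p ^+ 2 *: g k p].

Definition conformal_class c :=
  exists2 g, riemannian_metric g &
    forall h, c h <->
      riemannian_metric h /\ exists Omega, conformal_rescaling Omega g h.

(* sections of E[w]: f g is the representative in the scale g *)
Definition density c (w : R) (f : metric_components -> M -> R) :=
  (forall g, c g -> smooth_fun (f g)) /\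
  (forall g h Omega, c g -> c h -> conformal_rescaling Omega g h ->
     forall p, f h p = Omega p `^ w * f g p).

Definition flat_metric g :=
  forall k x, chart_image k x ->
    forall a b e i, riemann (in_chart (g k) k) a b e i x = 0.

Definition defining_density c (S : set M) (sigma : metric_components -> M -> R) :=
  density c 1 sigma /\
  forall g, c g ->
    (forall p, S p <-> sigma g p = 0) /\
    (forall k p, S p -> chart_dom k p ->
       grad (in_chart (sigma g) k) (chart_map k p) != 0).

(* beta is the ASC (almost scalar constant) obstruction density of S, with the orientation given by the
   defining density sigma; only the values of beta on S matter *)
Definition obstruction_density c (S : set M)
    (sigma beta : metric_components -> M -> R) :=
  defining_density c S sigma /\
  exists B : metric_components -> M -> R,
    [/\ density c (- d%:R) B,
        forall g, c g -> forall k p, chart_dom k p ->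
          Isquare (in_chart (g k) k) (in_chart (sigma g) k) (chart_map k p)
          = 1 + sigma g p ^+ d * B g p &
        forall g, c g -> forall p, S p -> beta g p = B g p].

End conformal_manifold.

Section embedded_hypersurface.
Variables (R : realType) (m : nat) (M : oriented_manifold R m.+1).
Implicit Types (S : set M) (V : set 'rV[R]_m) (X : 'rV[R]_m -> M).

(* X : V -> S is the inverse of a chart of the hypersurface S: a smooth
   immersion which is a homeomorphism onto a relatively open subset of S *)
Definition local_param S V X :=
  [/\ open V,
      exists W, [/\ open W, X @` V = S `&` W &
        exists Y : M -> 'rV[R]_m,
          {within S `&` W, continuous Y} /\ forall u, V u -> Y (X u) = u],
      forall u, V u -> {for u, continuous X},
      forall k a, smooth_on (V `&` X @^-1` chart_dom k)
        (fun u => chart_map k (X u) 0 a) &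
      forall k u, V u -> chart_dom k (X u) ->
        row_free (jacobian (chart_map k \o X) u)].

Definition embedded_hypersurface S :=
  forall p, S p -> exists V X, local_param S V X /\ (X @` V) p.

(* nu u : components in the chart k of the unit conormal at X u having the
   orientation of the differential of s, s being the representative of a
   defining density in the scale g *)
Definition unit_conormal (g : metric_components M) (s : M -> R) V X k
    (nu : 'rV[R]_m -> 'rV[R]_m.+1) :=
  forall u, V u -> chart_dom k (X u) ->
    [/\ nu u *m (jacobian (chart_map k \o X) u)^T = 0,
        (nu u *m invmx (g k (X u)) *m (nu u)^T) 0 0 = 1 &
        0 < (nu u *m invmx (g k (X u))
             *m (grad (in_chart s k) (chart_map k (X u)))^T) 0 0].

End embedded_hypersurface.

(* Main.v *)
(* Put rho = -(Delta s + J s)/d and E = nabla^2 s + rho g, so that I_s^2 = 1 + s^d B reads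
   |ds|^2 + 2 s rho = 1 + 2 Q with Q = s^d B / 2. On the hypersurface ds is the unit
   conormal, E is tangential and equals the trace-free second fundamental form, and
   rho = -H. Differentiating I_s^2 once gives (nabla^c s) E_cb = nabla_b Q - s nabla_b rho,
   and a divergence gives
     Delta Q = |E|^2 + rho J s + (2 - d) <ds, d rho> + <ds, kappa> + s Delta rho,
   where kappa_b = Ric_b^c nabla_c s - nabla_b (J s). Since s vanishes on the hypersurface,
   one more normal derivative (d = 3, yielding 3 B) or one more Laplacian (d = 4, yielding
   12 B) isolates B. What is left on the right are derivatives of E and rho at the
   hypersurface: the Gauss and Weingarten formulas and the Ricci identities turn them into
   tangential derivatives of the trace-free second fundamental form.

   All these identities are algebraic: they hold in a commutative ring with commuting
   derivations, and are applied to the rings of smooth functions on a chart domain and on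
   the parameter domain of the hypersurface, related by the pullback morphism. *)
Require Import Defs.
From HB Require Import structures.
From mathcomp Require Import all_boot all_order all_algebra.
From mathcomp Require Import all_classical all_reals all_analysis.
From mathcomp Require Import ring lra.

Set Implicit Arguments.
Unset Strict Implicit.
Unset Printing Implicit Defensive.

Import Order.TTheory GRing.Theory Num.Theory.
Import numFieldNormedType.Exports.

Local Open Scope classical_set_scope.
Local Open Scope ring_scope.

(** In a ring every identity is a polynomial one; the price is that division is limited to the
    element [half], and the equation for rho is kept as d rho = -(Delta s + J s). Equality in the
    rings of smooth functions means equality on a whole open set, so equations can be
    differentiated. Origin of the constants: Delta (s^d B / 2) = d (d - 1) / 2 s^(d - 2) B |ds|^2 +
    O(s^(d - 1)). For d = 3 this is 3 s B to lowest order, with normal derivative 3 B; for d = 4 it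
    is 6 s^2 B, with Laplacian 12 B. The normal derivatives of rho and E that appear on the way are
    removed by lower-order consequences of the same equation: at s = 0 the formula for Delta Q
    yields the normal derivative of rho, and Codazzi-type identities yield that of E. The dimension
    enters through the endomorphism x of II0: tr x^3 = 0 on surfaces and 2 tr x^4 = (tr x^2)^2 on
    three-dimensional hypersurfaces. On surfaces, moreover, the tangential part of the curvature
    contracts to a multiple of the metric, which II0 annihilates. *)

(** * Tensor calculus over a ring with commuting derivations *)

(* [A] stands for the smooth functions on a coordinate domain, [der a] for the partial
   derivative in the direction a *)
Structure derivations (n : nat) (A : comNzRingType) := Derivations {
  der :> 'I_n -> A -> A;
  derD : forall a f h, der a (f + h) = der a f + der a h;
  derM : forall a f h, der a (f * h) = der a f * h + f * der a h;
  derC : forall a b f, der a (der b f) = der b (der a f) }.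

(* [low a b] = g_ab and [upp a b] = g^ab *)
Structure metric (n : nat) (A : comNzRingType) := Metric {
  low :> 'I_n -> 'I_n -> A;
  upp : 'I_n -> 'I_n -> A;
  lowC : forall a b, low a b = low b a;
  uppC : forall a b, upp a b = upp b a;
  uppK : forall a c, \sum_b upp a b * low b c = (a == c)%:R }.

Section Sums.
Variables (n : nat) (A : comNzRingType).

Lemma sum_delta (F : 'I_n -> A) a : \sum_b (a == b)%:R * F b = F a.
Proof.
rewrite (bigD1 a) //= eqxx mul1r big1 ?addr0 // => b ba.
by rewrite eq_sym (negbTE ba) mul0r.
Qed.

Lemma contr_assoc m (u : 'I_n -> A) (M : 'I_n -> 'I_m -> A) (v : 'I_m -> A) :
  \sum_a u a * (\sum_e M a e * v e) = \sum_e (\sum_a u a * M a e) * v e.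
Proof.
under eq_bigr => a _ do rewrite mulr_sumr.
rewrite exchange_big; apply: eq_bigr => e _ /=.
by rewrite mulr_suml; apply: eq_bigr => a _; rewrite mulrA.
Qed.

End Sums.

(** * Levi-Civita connection and its Leibniz rules *)

Section Calculus.
Variables (n : nat) (A : comNzRingType) (d : derivations n A).

Lemma der0 a : d a 0 = 0.
Proof. by apply: (addrI (d a 0)); rewrite -derD !addr0. Qed.

Lemma derN a f : d a (- f) = - d a f.
Proof. by apply/eqP; rewrite -addr_eq0 -derD addNr der0. Qed.

Lemma derB a f h : d a (f - h) = d a f - d a h.
Proof. by rewrite derD derN. Qed.

Lemma der1 a : d a 1 = 0.
Proof.
by apply: (addrI (d a 1)); rewrite addr0 -[in RHS](mulr1 1) derM mulr1 mul1r.
Qed.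

Lemma der_nat a k : d a k%:R = 0.
Proof. by elim: k => [|k IH]; rewrite ?der0 // -natr1 derD IH der1 addr0. Qed.

Lemma der_sum a m (F : 'I_m -> A) : d a (\sum_i F i) = \sum_i d a (F i).
Proof. exact: (big_morph _ (derD d a) (der0 a)). Qed.

Variables (g : metric n A) (half : A).
Hypothesis halfP : half + half = 1.

Local Notation gi := (upp g).

(** Symmetry arguments below end in x + x = 0; [half] is what excludes 2-torsion. *)
Lemma half_eq0 (x : A) : x + x = 0 -> x = 0.
Proof. by move=> e; rewrite -[x]mul1r -halfP mulrDl -mulrDr e mulr0. Qed.

Lemma lowK a c : \sum_b g a b * gi b c = (a == c)%:R.
Proof.
rewrite eq_sym -(uppK g c a); apply: eq_bigr => b _.
by rewrite mulrC lowC uppC.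
Qed.

Lemma lower_raise (v : 'I_n -> A) a : \sum_b g a b * (\sum_c gi b c * v c) = v a.
Proof.
rewrite contr_assoc -[RHS](sum_delta v a).
by apply: eq_bigr => b _; rewrite lowK.
Qed.

Lemma raise_lower (v : 'I_n -> A) a : \sum_b gi a b * (\sum_c g b c * v c) = v a.
Proof.
rewrite contr_assoc -[RHS](sum_delta v a).
by apply: eq_bigr => b _; rewrite uppK.
Qed.

Lemma low_inj (v w : 'I_n -> A) :
  (forall a, \sum_b g a b * v b = \sum_b g a b * w b) -> v =1 w.
Proof.
move=> e a; rewrite -(raise_lower v) -(raise_lower w).
by apply: eq_bigr => b _; rewrite e.
Qed.

(* [chr c a b] = Gamma^c_ab; here [half] = 1/2 *)
Definition chr c a b : A :=
  half * \sum_e gi c e * (d a (g e b) + d b (g e a) - d e (g a b)).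

Lemma chrC c a b : chr c a b = chr c b a.
Proof.
by rewrite /chr; congr (_ * _); apply: eq_bigr => e _; rewrite (lowC g a b) [d a _ + _]addrC.
Qed.

Lemma chr_low f a b : \sum_c g f c * chr c a b =
  half * (d a (g f b) + d b (g f a) - d f (g a b)).
Proof.
rewrite /chr; under eq_bigr do rewrite mulrCA.
by rewrite -mulr_sumr lower_raise.
Qed.

(** In the sum of the two lowered Christoffel symbols, four of the six derivatives cancel and d_c
    g_ab occurs twice, each time halved. *)
Lemma metric_compat c a b :
  d c (g a b) = \sum_e chr e c a * g e b + \sum_e chr e c b * g a e.
Proof.
under eq_bigr do rewrite mulrC (lowC g _ b).
rewrite chr_low; under [X in _ + X]eq_bigr do rewrite mulrC.
rewrite chr_low (lowC g c b) (lowC g c a) (lowC g b a) -[LHS]mul1r -halfP; ring.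
Qed.

(** Lowering the index a reduces the claim to the derivative of g g^-1 = 1, into which metric
    compatibility is substituted. *)
Lemma der_upp c a b :
  d c (gi a b) = - (\sum_e chr a c e * gi e b + \sum_e chr b c e * gi a e).
Proof.
move: a; apply: (low_inj (v := fun a => d c (gi a b))) => x.
have -> : \sum_y g x y * d c (gi y b) = - \sum_y d c (g x y) * gi y b.
  apply/eqP; rewrite -addr_eq0 -big_split /=.
  under eq_bigr do rewrite addrC -derM.
  by rewrite -der_sum lowK der_nat.
under [RHS]eq_bigr do rewrite mulrN mulrDr.
rewrite sumrN big_split /=; congr (- _).
under eq_bigr do rewrite metric_compat mulrDl.
rewrite big_split /= addrC; congr (_ + _).
  rewrite contr_assoc; apply: eq_bigr => e _; congr (_ * _).
  by apply: eq_bigr => f _; rewrite mulrC.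
under [RHS]eq_bigr do under eq_bigr do rewrite mulrC.
rewrite (lower_raise (fun e => chr b c e)) -(raise_lower (fun e => chr e c x)).
apply: eq_bigr => y _; rewrite mulrC uppC; congr (_ * _).
by apply: eq_bigr => e _; rewrite mulrC lowC.
Qed.

Definition nab1 (S : 'I_n -> A) c a : A := d c (S a) - \sum_e chr e c a * S e.

Definition nab2 (T : 'I_n -> 'I_n -> A) c a b : A :=
  d c (T a b) - \sum_e chr e c a * T e b - \sum_e chr e c b * T a e.

Definition nab3 (X : 'I_n -> 'I_n -> 'I_n -> A) e c a b : A :=
  d e (X c a b) - \sum_f chr f e c * X f a b - \sum_f chr f e a * X c f b
  - \sum_f chr f e b * X c a f.

Definition ctr (T : 'I_n -> 'I_n -> A) : A := \sum_a \sum_b gi a b * T a b.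

Definition dot (S T : 'I_n -> A) : A := ctr (fun a b => S a * T b).

Definition dot2 (S T : 'I_n -> 'I_n -> A) : A := ctr (fun a b => dot (S a) (T b)).

Lemma eq_ctr T T' : (forall a b, T a b = T' a b) -> ctr T = ctr T'.
Proof. by move=> e; apply: eq_bigr => a _; apply: eq_bigr => b _; rewrite e. Qed.

Lemma ctrDE T T' : ctr (fun a b => T a b + T' a b) = ctr T + ctr T'.
Proof.
rewrite /ctr -big_split; apply: eq_bigr => a _.
by rewrite -big_split; apply: eq_bigr => b _; rewrite mulrDr.
Qed.

Lemma ctrZ x T : ctr (fun a b => x * T a b) = x * ctr T.
Proof.
rewrite /ctr mulr_sumr; apply: eq_bigr => a _.
by rewrite mulr_sumr; apply: eq_bigr => b _; rewrite mulrCA.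
Qed.

Lemma ctrN T : ctr (fun a b => - T a b) = - ctr T.
Proof. by rewrite -mulN1r -ctrZ; apply: eq_ctr => a b; rewrite mulN1r. Qed.

Lemma ctrB T T' : ctr (fun a b => T a b - T' a b) = ctr T - ctr T'.
Proof. by rewrite ctrDE ctrN. Qed.

Lemma ctr0 : ctr (fun _ _ => 0) = 0.
Proof. by rewrite /ctr big1 // => a _; rewrite big1 // => b _; rewrite mulr0. Qed.

Lemma ctr_sum m (T : 'I_m -> 'I_n -> 'I_n -> A) :
  ctr (fun a b => \sum_i T i a b) = \sum_i ctr (T i).
Proof.
under [in RHS]eq_bigr do rewrite /ctr.
rewrite [RHS]exchange_big; apply: eq_bigr => a _.
by rewrite [RHS]exchange_big; apply: eq_bigr => b _; rewrite mulr_sumr.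
Qed.

Lemma ctr_tr T : ctr (fun a b => T b a) = ctr T.
Proof.
rewrite /ctr [LHS]exchange_big /=.
by under eq_bigr do under eq_bigr do rewrite uppC.
Qed.

Lemma ctr_low : ctr g = n%:R.
Proof.
rewrite /ctr (eq_bigr (fun=> 1)) ?sumr_const ?card_ord // => a _.
under eq_bigr do rewrite lowC.
by rewrite uppK eqxx.
Qed.

Lemma eq_dot S S' T T' : S =1 S' -> T =1 T' -> dot S T = dot S' T'.
Proof. by move=> e f; apply: eq_ctr => a b; rewrite e f. Qed.

Lemma dotC S T : dot S T = dot T S.
Proof. by rewrite /dot -ctr_tr; apply: eq_ctr => a b; rewrite mulrC. Qed.

Lemma dotDl S S' T : dot (fun a => S a + S' a) T = dot S T + dot S' T.
Proof. by rewrite /dot -ctrDE; apply: eq_ctr => a b; rewrite mulrDl. Qed.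

Lemma dotDr S T T' : dot S (fun a => T a + T' a) = dot S T + dot S T'.
Proof. by rewrite dotC dotDl !(dotC S). Qed.

Lemma dotZl x S T : dot (fun a => x * S a) T = x * dot S T.
Proof. by rewrite /dot -ctrZ; apply: eq_ctr => a b; rewrite mulrA. Qed.

Lemma dotZr x S T : dot S (fun a => x * T a) = x * dot S T.
Proof. by rewrite dotC dotZl dotC. Qed.

Lemma dotNl S T : dot (fun a => - S a) T = - dot S T.
Proof. by rewrite -mulN1r -dotZl; apply: eq_dot => a //; rewrite mulN1r. Qed.

Lemma dotNr S T : dot S (fun a => - T a) = - dot S T.
Proof. by rewrite dotC dotNl dotC. Qed.

Lemma dotBl S S' T : dot (fun a => S a - S' a) T = dot S T - dot S' T.
Proof. by rewrite dotDl dotNl. Qed.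

Lemma dotBr S T T' : dot S (fun a => T a - T' a) = dot S T - dot S T'.
Proof. by rewrite dotDr dotNr. Qed.

Lemma dot_suml m (S : 'I_m -> 'I_n -> A) T :
  dot (fun a => \sum_i S i a) T = \sum_i dot (S i) T.
Proof.
rewrite -ctr_sum; apply: eq_ctr => a b.
by rewrite mulr_suml.
Qed.

Lemma dot_sumr m S (T : 'I_m -> 'I_n -> A) :
  dot S (fun a => \sum_i T i a) = \sum_i dot S (T i).
Proof. by rewrite dotC dot_suml; apply: eq_bigr => i _; rewrite dotC. Qed.

Lemma dot_lowl a S : dot (g a) S = S a.
Proof.
rewrite -[RHS](lower_raise S a); apply: eq_bigr => b _.
by rewrite mulr_sumr; apply: eq_bigr => c _; rewrite mulrCA.
Qed.

(** The derivative of g^ab produces exactly the Christoffel terms of the two slots, so contraction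
    commutes with the connection. *)
Lemma nab2_ctr T c : d c (ctr T) = ctr (nab2 T c).
Proof.
pose L a b := \sum_e chr e c a * T e b; pose L' a b := \sum_e chr e c b * T a e.
have -> : ctr (nab2 T c) = ctr (fun a b => d c (T a b)) - ctr L - ctr L'.
  by rewrite -!ctrB.
(* Moves the Christoffel symbol from the tensor onto the inverse metric, the form in which [der_upp]
   delivers it. *)
have eL T' : ctr (fun a b => \sum_e chr e c a * T' e b)
    = \sum_b \sum_a (\sum_e gi e b * chr a c e) * T' a b.
  rewrite /ctr exchange_big; apply: eq_bigr => b _ /=.
  by rewrite -contr_assoc.
have -> : ctr L' = ctr (fun a b => \sum_e chr e c a * T b e).
  by rewrite -ctr_tr.
rewrite eL eL.
have -> : d c (ctr T) = ctr (fun a b => d c (T a b))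
    + \sum_a \sum_b d c (gi a b) * T a b.
  rewrite der_sum -big_split; apply: eq_bigr => a _.
  rewrite der_sum -big_split; apply: eq_bigr => b _.
  by rewrite derM addrC.
rewrite -addrA -opprD; congr (_ + _).
rewrite exchange_big /= [X in - (_ + X)]exchange_big -big_split -sumrN /=.
apply: eq_bigr => b _; rewrite -big_split -sumrN; apply: eq_bigr => a _ /=.
rewrite der_upp -mulrDl mulNr; congr (- (_ * _)).
by congr (_ + _); apply: eq_bigr => e _; rewrite mulrC // uppC.
Qed.

Lemma eq_nab1 S S' c a : S =1 S' -> nab1 S c a = nab1 S' c a.
Proof. by move=> e; rewrite /nab1 e; under eq_bigr do rewrite e. Qed.

Lemma eq_nab2 T T' c a b : (forall a b, T a b = T' a b) -> nab2 T c a b = nab2 T' c a b.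
Proof.
move=> e; rewrite /nab2 e.
under eq_bigr do rewrite e; under [X in _ - _ - X]eq_bigr do rewrite e.
by [].
Qed.

Lemma nab1D S S' c a : nab1 (fun a => S a + S' a) c a = nab1 S c a + nab1 S' c a.
Proof.
rewrite /nab1 derD; under eq_bigr do rewrite mulrDr.
by rewrite big_split /=; ring.
Qed.

Lemma nab1Z f S c a : nab1 (fun a => f * S a) c a = d c f * S a + f * nab1 S c a.
Proof.
rewrite /nab1 derM; under eq_bigr do rewrite mulrCA.
by rewrite -mulr_sumr; ring.
Qed.

Lemma nab1N S c a : nab1 (fun a => - S a) c a = - nab1 S c a.
Proof.
rewrite /nab1 derN; under eq_bigr do rewrite mulrN.
by rewrite sumrN; ring.
Qed.

Lemma nab1B S S' c a : nab1 (fun a => S a - S' a) c a = nab1 S c a - nab1 S' c a.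
Proof. by rewrite nab1D nab1N. Qed.

Lemma nab2D T T' c a b :
  nab2 (fun a b => T a b + T' a b) c a b = nab2 T c a b + nab2 T' c a b.
Proof.
rewrite /nab2 derD; under eq_bigr do rewrite mulrDr.
under [X in _ - _ - X]eq_bigr do rewrite mulrDr.
by rewrite !big_split /=; ring.
Qed.

Lemma nab2Z f T c a b :
  nab2 (fun a b => f * T a b) c a b = d c f * T a b + f * nab2 T c a b.
Proof.
rewrite /nab2 derM; under eq_bigr do rewrite mulrCA.
under [X in _ - _ - X]eq_bigr do rewrite mulrCA.
by rewrite -!mulr_sumr; ring.
Qed.

Lemma nab2_low c a b : nab2 g c a b = 0.
Proof. by rewrite /nab2 metric_compat; ring. Qed.

Lemma nab2_tr T c a b : nab2 (fun a b => T b a) c a b = nab2 T c b a.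
Proof. by rewrite /nab2; ring. Qed.

Lemma nab3_sym X e c a b : (forall c a b, X c a b = X c b a) ->
  nab3 X e c a b = nab3 X e c b a.
Proof.
move=> s; rewrite /nab3 s.
under eq_bigr do rewrite s; under [X in _ - _ - X - _]eq_bigr do rewrite s.
by under [X in _ - _ - _ - X]eq_bigr do rewrite s; ring.
Qed.

Lemma eq_nab3 X X' e c a b : (forall c a b, X c a b = X' c a b) ->
  nab3 X e c a b = nab3 X' e c a b.
Proof.
move=> s; rewrite /nab3 s; congr (_ - _ - _ - _);
  by apply: eq_bigr => f _; rewrite s.
Qed.

Lemma nab3D X X' e c a b : nab3 (fun c a b => X c a b + X' c a b) e c a b
  = nab3 X e c a b + nab3 X' e c a b.
Proof.
rewrite /nab3 derD.
under eq_bigr do rewrite mulrDr; under [X in _ - _ - X - _]eq_bigr do rewrite mulrDr.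
under [X in _ - _ - _ - X]eq_bigr do rewrite mulrDr.
by rewrite !big_split /=; ring.
Qed.

Lemma nab3N X e c a b : nab3 (fun c a b => - X c a b) e c a b = - nab3 X e c a b.
Proof.
rewrite /nab3 derN.
under eq_bigr do rewrite mulrN; under [X in _ - _ - X - _]eq_bigr do rewrite mulrN.
under [X in _ - _ - _ - X]eq_bigr do rewrite mulrN.
by rewrite !sumrN /=; ring.
Qed.

Lemma nab3_swap X e c a b :
  nab3 (fun c a b => X a c b) e c a b = nab3 X e a c b.
Proof. by rewrite /nab3; ring. Qed.

Lemma nab3_low S e c a b :
  nab3 (fun c a b => S c * g a b) e c a b = nab1 S e c * g a b.
Proof.
rewrite /nab3 derM.
under eq_bigr do rewrite mulrA; rewrite -mulr_suml.
under [X in _ - _ - X - _]eq_bigr do rewrite mulrCA; rewrite -mulr_sumr.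
under [X in _ - _ - _ - X]eq_bigr do rewrite mulrCA; rewrite -mulr_sumr.
by rewrite metric_compat /nab1; ring.
Qed.

Lemma der_dot c S T : d c (dot S T) = dot (nab1 S c) T + dot S (nab1 T c).
Proof.
rewrite nab2_ctr -ctrDE; apply: eq_ctr => a b; rewrite /nab2 derM /nab1.
under eq_bigr do rewrite mulrA; rewrite -mulr_suml.
under [X in _ - X = _]eq_bigr do rewrite mulrCA; rewrite -mulr_sumr.
ring.
Qed.

Lemma nab1_dotl S T c b : nab1 (fun b => dot S (fun a => T a b)) c b
  = dot (nab1 S c) (fun a => T a b) + dot S (fun a => nab2 T c a b).
Proof.
rewrite /nab1 der_dot -addrA; congr (_ + _).
rewrite /nab1 /nab2 [RHS]dotBr; congr (_ - _).
by rewrite dot_sumr; apply: eq_bigr => e _; rewrite dotZr.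
Qed.

Lemma nab1_dotr P S c a : nab1 (fun a => dot (P a) S) c a
  = dot (nab2 P c a) S + dot (P a) (nab1 S c).
Proof.
under eq_nab1 => x do rewrite dotC.
rewrite (nab1_dotl S (fun a b => P b a)) addrC dotC [in RHS]dotC; congr (_ + _); last exact: dotC.
by rewrite dotC; apply: eq_dot => // x; rewrite nab2_tr.
Qed.

Lemma nab1_ctr X e b : nab1 (fun b => ctr (fun c a => X c a b)) e b
  = ctr (fun c a => nab3 X e c a b).
Proof.
rewrite /nab1 nab2_ctr /nab2 /nab3 [RHS]ctrB; congr (_ - _).
by rewrite ctr_sum; apply: eq_bigr => f _; rewrite ctrZ.
Qed.

Lemma der_dot2 c S T : d c (dot2 S T) = dot2 (nab2 S c) T + dot2 S (nab2 T c).
Proof.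
rewrite nab2_ctr -ctrDE; apply: eq_ctr => a b.
rewrite {1}/nab2 der_dot.
have -> : dot (nab2 S c a) (T b) = dot (nab1 (S a) c) (T b) - \sum_e chr e c a * dot (S e) (T b).
  rewrite -(eq_bigr _ (fun e _ => dotZl _ _ _)) -dot_suml -dotBl.
  by apply: eq_dot => // x; rewrite /nab2 /nab1; ring.
have -> : dot (S a) (nab2 T c b) = dot (S a) (nab1 (T b) c) - \sum_e chr e c b * dot (S a) (T e).
  rewrite -(eq_bigr _ (fun e _ => dotZr _ _ _)) -dot_sumr -dotBr.
  by apply: eq_dot => // x; rewrite /nab2 /nab1; ring.
ring.
Qed.

Lemma dot2_suml m (S : 'I_m -> 'I_n -> 'I_n -> A) T :
  dot2 (fun a b => \sum_i S i a b) T = \sum_i dot2 (S i) T.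
Proof. by rewrite -ctr_sum; apply: eq_ctr => a b; rewrite dot_suml. Qed.

Lemma dot2Zl x S T : dot2 (fun a b => x * S a b) T = x * dot2 S T.
Proof. by rewrite -ctrZ; apply: eq_ctr => a b; rewrite dotZl. Qed.

Lemma nab1_dot2 X T e c : nab1 (fun c => dot2 (X c) T) e c
  = dot2 (nab3 X e c) T + dot2 (X c) (nab2 T e).
Proof.
rewrite /nab1 der_dot2 addrAC; congr (_ + _).
rewrite -(eq_bigr _ (fun f _ => dot2Zl _ _ _)) -dot2_suml -ctrB.
apply: eq_ctr => a b; rewrite -dotBl; apply: eq_dot => // x.
by rewrite /nab2 /nab3; ring.
Qed.

Lemma nab1_grad f c a : nab1 (d^~ f) c a = nab1 (d^~ f) a c.
Proof.
by rewrite /nab1 derC; congr (_ - _); apply: eq_bigr => e _; rewrite chrC.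
Qed.

(** * Curvature: Ricci and Bianchi identities *)

(* [riem a b c e] = R_ab^c_e *)
Definition riem a b c e : A :=
  d a (chr c b e) - d b (chr c a e)
  + \sum_f (chr c a f * chr f b e - chr c b f * chr f a e).

Definition ric a b : A := \sum_c riem c a c b.

Definition scal : A := ctr ric.

(** Stated for an arbitrary contracted family, so that both sides of the Ricci identities below
    consist of the same sums, which [ring] takes as atoms. *)
Lemma riem_contr a b c (F : 'I_n -> A) : \sum_e riem a b e c * F e =
  \sum_e d a (chr e b c) * F e - \sum_e d b (chr e a c) * F e
  + \sum_f chr f b c * (\sum_e chr e a f * F e)
  - \sum_f chr f a c * (\sum_e chr e b f * F e).
Proof.
rewrite !contr_assoc -!sumrN -!big_split /=; apply: eq_bigr => e _.
rewrite /riem sumrB.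
under eq_bigr do rewrite mulrC; under [X in _ + (_ - X)]eq_bigr do rewrite mulrC.
ring.
Qed.

Lemma nab2_comm S c a b :
  nab2 (nab1 S) c a b - nab2 (nab1 S) a c b = - \sum_e riem c a e b * S e.
Proof.
rewrite riem_contr /nab2 /nab1 !derB !der_sum derC.
have e x y : \sum_e d x (chr e y b * S e)
    = \sum_e d x (chr e y b) * S e + \sum_e chr e y b * d x (S e).
  by rewrite -big_split; apply: eq_bigr => f _; rewrite derM.
rewrite !e.
have f x y : \sum_e chr e x b * (d y (S e) - \sum_f chr f y e * S f)
   = \sum_e chr e x b * d y (S e) - \sum_e chr e x b * \sum_f chr f y e * S f.
  by rewrite -sumrB; apply: eq_bigr => k _; rewrite mulrBr.
rewrite !f.
have -> : \sum_e chr e c a * (d e (S b) - \sum_f chr f e b * S f)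
   = \sum_e chr e a c * (d e (S b) - \sum_f chr f e b * S f).
  by apply: eq_bigr => k _; rewrite chrC.
ring.
Qed.

Lemma nab3_comm T c a x y :
  nab3 (nab2 T) c a x y - nab3 (nab2 T) a c x y
  = - (\sum_e riem c a e x * T e y) - \sum_e riem c a e y * T x e.
Proof.
rewrite !riem_contr /nab3 /nab2 !derB !der_sum derC.
have e k (p q : 'I_n -> A) : \sum_e d k (p e * q e)
    = \sum_e d k (p e) * q e + \sum_e p e * d k (q e).
  by rewrite -big_split; apply: eq_bigr => f _; rewrite derM.
rewrite !e.
have -> F : \sum_e chr e c a * F e = \sum_e chr e a c * F e.
  by apply: eq_bigr => k _; rewrite chrC.
have f (p q r s : 'I_n -> A) : \sum_e p e * (q e - r e - s e)
    = \sum_e p e * q e - \sum_e p e * r e - \sum_e p e * s e.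
  by rewrite -!sumrB; apply: eq_bigr => k _; ring.
rewrite !f.
(* Products of Christoffel symbols acting on different slots appear in both orders of
   differentiation; exchanging the two sums identifies them. *)
have sw (p q : 'I_n -> A) : \sum_f p f * (\sum_e q e * T f e) = \sum_f q f * \sum_e p e * T e f.
  under eq_bigr => k _ do (rewrite mulr_sumr; under eq_bigr => l _ do rewrite mulrCA).
  by rewrite exchange_big; apply: eq_bigr => k _ /=; rewrite mulr_sumr.
rewrite !sw.
ring.
Qed.

Definition rlow a b c e : A := \sum_f g c f * riem a b f e.

Lemma riemN a b c e : riem b a c e = - riem a b c e.
Proof. by rewrite /riem !sumrB; ring. Qed.

Lemma rlowN a b c e : rlow b a c e = - rlow a b c e.
Proof. by rewrite /rlow -sumrN; apply: eq_bigr => f _; rewrite riemN mulrN. Qed.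

(** The Ricci identity applied to the metric itself, whose second covariant derivative vanishes. *)
Lemma rlow_anti a b c e : rlow a b c e = - rlow a b e c.
Proof.
have z x y z t : nab3 (nab2 g) x y z t = 0.
  rewrite (eq_nab3 _ _ _ _ (X' := fun _ _ _ => 0)); last exact: nab2_low.
  by rewrite /nab3 der0 !big1 ?subr0 // => f _; rewrite mulr0.
have := nab3_comm g a b c e; rewrite !z subr0 => e0.
apply/eqP; rewrite -addr_eq0 -oppr_eq0 {}e0 /rlow opprD addrC; apply/eqP.
by congr (- _ - _); apply: eq_bigr => f _; rewrite mulrC // lowC.
Qed.

(** All terms cancel in pairs because the connection is torsion free, which here is [chrC]. *)
Lemma riem_bianchi a b c e : riem a b c e + riem b e c a + riem e a c b = 0.
Proof.
rewrite /riem !sumrB.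
have s x y z : \sum_f chr c x f * chr f y z = \sum_f chr c x f * chr f z y.
  by apply: eq_bigr => f _; rewrite [chr f y z]chrC.
rewrite (s a b e) (s b e a) (s e a b) (chrC c b e) (chrC c a e) (chrC c a b).
ring.
Qed.

Lemma riem_rlow a b c e : riem a b c e = \sum_f gi c f * rlow a b f e.
Proof. by rewrite (raise_lower (fun f => riem a b f e)). Qed.

Lemma riem_tr a b : \sum_c riem a b c c = 0.
Proof.
have -> : \sum_c riem a b c c = ctr (fun c f => rlow a b f c).
  by apply: eq_bigr => c _; rewrite riem_rlow.
apply: half_eq0; rewrite -{1}ctr_tr -ctrDE -ctr0; apply: eq_ctr => c f.
by rewrite rlow_anti addNr.
Qed.

(** Trace of the first Bianchi identity: the skew part of Ric comes from R_ab^c_c, which vanishes by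
    [riem_tr]. *)
Lemma ricC a b : ric a b = ric b a.
Proof.
apply/eqP; rewrite -subr_eq0; apply/eqP.
rewrite /ric -sumrB.
have e c : riem c a c b - riem c b c a = - riem a b c c.
  by apply/eqP; rewrite -subr_eq0 -(riem_bianchi a b c c) (riemN b c); apply/eqP; ring.
under eq_bigr do rewrite e.
by rewrite sumrN riem_tr oppr0.
Qed.

(** Components of nabla_x R_ab^c_e. The index c stays up because the second Bianchi identity is
    proved with c and e as matrix indices. *)
Definition riem_nab x a b c e : A := d x (riem a b c e)
  - \sum_h chr h x a * riem h b c e - \sum_h chr h x b * riem a h c e
  + \sum_h chr c x h * riem a b h e - \sum_h chr h x e * riem a b c h.

Definition rlow_nab x a b c e : A := \sum_f g c f * riem_nab x a b f e.

(** The metric is parallel, so lowering commutes with the derivative; this carries the antisymmetry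
    in c and e over to the derivative of the curvature. *)
Lemma rlow_nabE x a b c e : rlow_nab x a b c e =
  d x (rlow a b c e) - \sum_h chr h x a * rlow h b c e
    - \sum_h chr h x b * rlow a h c e - \sum_h chr h x c * rlow a b h e
    - \sum_h chr h x e * rlow a b c h.
Proof.
have k (p : 'I_n -> A) (M : 'I_n -> 'I_n -> A) : \sum_f g c f * (\sum_h p h * M h f)
    = \sum_h p h * \sum_f g c f * M h f.
  under eq_bigr => f _ do (rewrite mulr_sumr; under eq_bigr => h _ do rewrite mulrCA).
  by rewrite exchange_big; apply: eq_bigr => h _ /=; rewrite mulr_sumr.
have -> : rlow_nab x a b c e = \sum_f g c f * d x (riem a b f e)
    - \sum_h chr h x a * rlow h b c e - \sum_h chr h x b * rlow a h c e
    + \sum_f g c f * (\sum_h chr f x h * riem a b h e)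
    - \sum_h chr h x e * rlow a b c h.
  rewrite /rlow_nab /riem_nab /rlow -!k -!sumrN -!big_split /=; apply: eq_bigr => f _; ring.
have -> : d x (rlow a b c e) = \sum_f g c f * d x (riem a b f e)
    + \sum_f d x (g c f) * riem a b f e.
  by rewrite /rlow der_sum -big_split; apply: eq_bigr => f _; rewrite derM addrC.
have -> : \sum_f d x (g c f) * riem a b f e = \sum_h chr h x c * rlow a b h e
    + \sum_f g c f * (\sum_h chr f x h * riem a b h e).
  rewrite /rlow !contr_assoc -big_split; apply: eq_bigr => f _ /=.
  rewrite metric_compat mulrDl; congr (_ * _ + _ * _).
  by apply: eq_bigr => h _; rewrite mulrC.
ring.
Qed.

Lemma rlow_nab_anti x a b c e : rlow_nab x a b c e = - rlow_nab x a b e c.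
Proof.
rewrite !rlow_nabE rlow_anti derN.
under [X in _ - X - _ - _ - _ = _]eq_bigr do rewrite rlow_anti mulrN.
under [X in _ - _ - X - _ - _ = _]eq_bigr do rewrite rlow_anti mulrN.
under [X in _ - _ - _ - X - _ = _]eq_bigr do rewrite rlow_anti mulrN.
under [X in _ - _ - _ - _ - X = _]eq_bigr do rewrite rlow_anti mulrN.
by rewrite !sumrN; ring.
Qed.

Lemma riem_nabN x a b c e : riem_nab x b a c e = - riem_nab x a b c e.
Proof.
rewrite /riem_nab riemN derN.
under eq_bigr do rewrite riemN mulrN.
under [X in _ - _ - X + _ - _]eq_bigr do rewrite riemN mulrN.
under [X in _ - _ - _ + X - _]eq_bigr do rewrite riemN mulrN.
under [X in _ - _ - _ + _ - X]eq_bigr do rewrite riemN mulrN.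
by rewrite !sumrN; ring.
Qed.

Let G a : 'M[A]_n := \matrix_(c, e) chr c a e.
Let dM a (M : 'M[A]_n) : 'M[A]_n := map_mx (d a) M.
(* The curvature of the connection matrices [G a]: [cyc] is its Bianchi identity. *)
Let Rm a b := dM a (G b) - dM b (G a) + (G a *m G b - G b *m G a).

Let aE (M N : 'M[A]_n) i j : (M + N) i j = M i j + N i j.
Proof. by rewrite mxE. Qed.

Let nE (M : 'M[A]_n) i j : (- M) i j = - M i j.
Proof. by rewrite mxE. Qed.

Let riemM a b c e : riem a b c e = Rm a b c e.
Proof.
rewrite /Rm !mxE /riem; congr (_ + _).
by rewrite -sumrB; apply: eq_bigr => f _; rewrite !mxE.
Qed.

Let dMD a M N : dM a (M + N) = dM a M + dM a N.
Proof. by apply/matrixP => i j; rewrite !mxE derD. Qed.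

Let dMN a M : dM a (- M) = - dM a M.
Proof. by apply/matrixP => i j; rewrite !mxE derN. Qed.

Let dMM a M N : dM a (M *m N) = dM a M *m N + M *m dM a N.
Proof.
apply/matrixP => i j; rewrite !mxE der_sum -big_split; apply: eq_bigr => k _.
by rewrite !mxE derM.
Qed.

Let dMC a b M : dM a (dM b M) = dM b (dM a M).
Proof. by apply/matrixP => i j; rewrite !mxE derC. Qed.

Let cyc x a b : dM x (Rm a b) + G x *m Rm a b - Rm a b *m G x
  + (dM a (Rm b x) + G a *m Rm b x - Rm b x *m G a)
  + (dM b (Rm x a) + G b *m Rm x a - Rm x a *m G b) = 0.
Proof.
rewrite /Rm !(dMD, dMN, dMM, mulmxDl, mulmxDr, mulNmx, mulmxN, mulmxA).
rewrite (dMC x a) (dMC x b) (dMC a b).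
by apply/matrixP => i j; rewrite !(aE, nE) [RHS]mxE; ring.
Qed.

(** [cyc] accounts for the indices c and e. The Christoffel terms on the form indices cancel in
    pairs, Gamma being symmetric in its lower indices and R antisymmetric in its first two. *)
Lemma riem_bianchi2 x a b c e :
  riem_nab x a b c e + riem_nab a b x c e + riem_nab b x a c e = 0.
Proof.
have k u v w : riem_nab u v w c e = (dM u (Rm v w) + G u *m Rm v w - Rm v w *m G u) c e
    - \sum_h chr h u v * riem h w c e - \sum_h chr h u w * riem v h c e.
  rewrite /riem_nab !mxE riemM.
  have -> : \sum_h chr c u h * riem v w h e = \sum_j G u c j * Rm v w j e.
    by apply: eq_bigr => h _; rewrite riemM !mxE.
  have -> : \sum_h chr h u e * riem v w c h = \sum_j Rm v w c j * G u j e.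
    by apply: eq_bigr => h _; rewrite riemM mulrC [G _ _ _]mxE.
  rewrite !mxE; ring.
rewrite !k.
have s u v w : \sum_h chr h u v * riem h w c e = - \sum_h chr h v u * riem w h c e.
  by rewrite -sumrN; apply: eq_bigr => h _; rewrite chrC riemN mulrN.
rewrite (s x a b) (s a b x) (s b x a).
have := congr1 (fun M : 'M[A]_n => M c e) (cyc x a b).
by rewrite !(aE, nE) [RHS]mxE => z; rewrite -[RHS]z; ring.
Qed.

(** The Christoffel terms on the upper and on the lower index c are the same double sum with
    opposite signs. *)
Lemma riem_nab_ctr x b e : \sum_c riem_nab x c b c e = nab2 ric x b e.
Proof.
rewrite /riem_nab /nab2 /ric.
have k (p : 'I_n -> A) (M : 'I_n -> 'I_n -> A) :
    \sum_h p h * (\sum_c M h c) = \sum_c \sum_h p h * M h c.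
  by rewrite exchange_big; apply: eq_bigr => h _ /=; rewrite mulr_sumr.
rewrite !k der_sum -!sumrB.
rewrite -[LHS]addr0 -[X in _ + X](subrr (\sum_c \sum_h chr h x c * riem h b c e)).
rewrite [X in _ + (_ - X)]exchange_big addrA -!sumrN -!big_split /=.
by apply: eq_bigr => c _; ring.
Qed.

(** The second Bianchi identity traced twice: one term is d Sc, the other two are each minus the
    divergence of Ric. *)
Lemma ric_bianchi e : d e scal = ctr (fun b f => nab2 ric b f e) *+ 2.
Proof.
(* Q_x^c = g^bf nabla_x R_be^c_f; antisymmetry in the last pair makes its lowered form -nabla_x
   Ric_ey. *)
pose Q x c := ctr (fun b f => riem_nab x b e c f).
have lowQ x y : \sum_c g y c * Q x c = - nab2 ric x e y.
  rewrite -riem_nab_ctr -sumrN /Q.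
  have -> : \sum_c g y c * ctr (fun b f => riem_nab x b e c f)
      = ctr (fun b f => rlow_nab x b e y f).
    by rewrite ctr_sum; apply: eq_bigr => c _; rewrite ctrZ.
  apply: eq_bigr => b _; rewrite -[RHS](raise_lower (fun b' => - riem_nab x b e b' y)).
  apply: eq_bigr => f _; rewrite rlow_nab_anti /rlow_nab -sumrN.
  by congr (_ * _); apply: eq_bigr => h _; rewrite mulrN.
have trQ : \sum_c Q c c = - ctr (fun b f => nab2 ric b f e).
  rewrite -ctrN; apply: eq_bigr => c _; rewrite -[LHS](raise_lower (Q c)).
  apply: eq_bigr => f _; rewrite lowQ; congr (_ * - _).
  by rewrite -nab2_tr; apply: eq_nab2 => u v; rewrite ricC.
have k : d e scal + \sum_c Q c c - ctr (fun b f => nab2 ric b f e) = 0.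
  rewrite /scal nab2_ctr /Q -ctr_sum -ctrDE -ctrB -[RHS]ctr0.
  apply: eq_ctr => b f.
  have -> : nab2 ric b f e = nab2 ric b e f.
    by rewrite -nab2_tr; apply: eq_nab2 => u v; rewrite ricC.
  rewrite -!riem_nab_ctr -sumrN -!big_split big1 // => c _ /=.
  by rewrite -riem_nabN riem_bianchi2.
by apply/eqP; rewrite -subr_eq0 -k trQ; apply/eqP; ring.
Qed.

End Calculus.

(** * The Laplacian and powers of the defining function *)

Section Laplacian.
Variables (n : nat) (A : comNzRingType) (d : derivations n A).
Variables (g : metric n A) (half : A).
Hypothesis halfP : half + half = 1.

Local Notation gi := (upp g).
Local Notation chr := (chr d g half).
Local Notation nab1 := (nab1 d g half).
Local Notation nab2 := (nab2 d g half).
Local Notation nab3 := (nab3 d g half).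
Local Notation riem := (riem d g half).
Local Notation ric := (ric d g half).
Local Notation ctr := (ctr g).
Local Notation dot := (dot g).
Local Notation dot2 := (dot2 g).

Definition lap (f : A) : A := ctr (nab1 (d^~ f)).

Lemma dot_ctrl (T : 'I_n -> 'I_n -> 'I_n -> A) S :
  dot (fun x => ctr (fun a b => T a b x)) S = ctr (fun a b => dot (T a b) S).
Proof.
rewrite dot_suml; apply: eq_bigr => a _.
by rewrite dot_suml; apply: eq_bigr => b _; rewrite dotZl.
Qed.

Lemma dot2_ctrl (T : 'I_n -> 'I_n -> 'I_n -> 'I_n -> A) S :
  dot2 (fun x y => ctr (fun a b => T a b x y)) S = ctr (fun a b => dot2 (T a b) S).
Proof.
rewrite dot2_suml; apply: eq_bigr => a _.
by rewrite dot2_suml; apply: eq_bigr => b _; rewrite dot2Zl.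
Qed.

Lemma eq_dot2 S S' T T' : (forall a b, S a b = S' a b) ->
  (forall a b, T a b = T' a b) -> dot2 S T = dot2 S' T'.
Proof. by move=> e f; apply: eq_ctr => a b; apply: eq_dot. Qed.

Lemma dot2C S T : dot2 S T = dot2 T S.
Proof. by rewrite /dot2 -ctr_tr; apply: eq_ctr => a b; rewrite dotC. Qed.

Lemma dot2Dl S S' T : dot2 (fun a b => S a b + S' a b) T = dot2 S T + dot2 S' T.
Proof. by rewrite -ctrDE; apply: eq_ctr => a b; rewrite -dotDl. Qed.

Lemma dot2_lowl S : dot2 g S = ctr S.
Proof.
rewrite -ctr_tr; apply: eq_ctr => a b; rewrite dot_lowl.
by [].
Qed.

Lemma der_exp a f k : d a (f ^+ k.+1) = k.+1%:R * f ^+ k * d a f.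
Proof.
elim: k => [|k IH]; first by rewrite expr1 expr0 !mul1r.
by rewrite exprS derM IH -[k.+2]add1n natrD exprS; ring.
Qed.

(** The exponent k + 2 avoids truncated subtraction, and s^k is kept in front: the coefficient (k +
    2) (k + 1) C ds ds is the lowest order in s, the only one that reaches the hypersurface in the
    end. *)
Lemma nab1_grad_exp s C k a b : nab1 (d^~ (s ^+ k.+2 * C)) a b
  = s ^+ k * (k.+2%:R * k.+1%:R * C * (d a s * d b s)
     + s * (k.+2%:R * (C * nab1 (d^~ s) a b + d a s * d b C + d a C * d b s)
            + s * nab1 (d^~ C) a b)).
Proof.
have e b' : d b' (s ^+ k.+2 * C) = s ^+ k.+1 * (k.+2%:R * (C * d b' s) + s * d b' C).
  by rewrite derM der_exp [s ^+ k.+2]exprS; ring.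
by rewrite (eq_nab1 _ _ _ _ _ e) nab1Z der_exp nab1D !nab1Z !der_nat exprS; ring.
Qed.

Lemma lap_exp s C k : lap (s ^+ k.+2 * C)
  = s ^+ k * (k.+2%:R * k.+1%:R * C * dot (d^~ s) (d^~ s)
     + s * (k.+2%:R * (C * lap s + dot (d^~ s) (d^~ C) *+ 2) + s * lap C)).
Proof.
rewrite /lap (eq_ctr _ (fun a b => nab1_grad_exp s C k a b)).
move: (nab1 (d^~ s)) (nab1 (d^~ C)) => P Q.
rewrite ctrZ ctrDE !ctrZ ctrDE !ctrZ !ctrDE !ctrZ mulr2n.
have -> : ctr (fun a b => d a C * d b s) = dot (d^~ s) (d^~ C) by rewrite dotC.
by rewrite /dot; ring.
Qed.

Lemma ctr_riem b e : ctr (fun c a => riem c b e a) = - \sum_f gi e f * ric b f.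
Proof.
rewrite (eq_ctr _ (fun c a => riem_rlow d g half c b e a)) ctr_sum -sumrN.
apply: eq_bigr => f _; rewrite ctrZ -mulrN; congr (_ * _).
rewrite (eq_ctr _ (fun c a => rlow_anti d g halfP c b f a)) ctrN; congr (- _).
by apply: eq_bigr => c _; rewrite -riem_rlow.
Qed.

(* The contracted Ricci identity, the first step of Bochner's formula. *)
Lemma ctr_nab2_hess f b : ctr (fun c a => nab2 (nab1 (d^~ f)) c a b)
  = d b (lap f) + dot (ric b) (d^~ f).
Proof.
have e c a : nab2 (nab1 (d^~ f)) c a b
    = nab2 (nab1 (d^~ f)) b c a - \sum_e riem c b e a * d e f.
  rewrite -nab2_comm // -nab2_tr addrC subrK.
  by apply: eq_nab2 => x y; rewrite nab1_grad.
rewrite (eq_ctr _ e) ctrB -nab2_ctr //; congr (_ + _).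
rewrite ctr_sum -sumrN dotC; apply: eq_bigr => e0 _.
rewrite (eq_ctr _ (fun c a => mulrC _ _)) ctrZ ctr_riem mulrN opprK mulr_sumr.
by apply: eq_bigr => f0 _; rewrite mulrCA.
Qed.

(** * Consequences of the singular Yamabe equation *)

Variables (s J rho : A).
Hypothesis rhoE : n%:R * rho = - (lap s + J * s).

Local Notation N := (d^~ s).
Local Notation R1 := (d^~ rho).
Local Notation Hs := (nab1 N).

(** [J] is an arbitrary element at this stage. The trace of [hess0] is -J s, so that it becomes
    trace free on the hypersurface. *)
Definition hess0 a b : A := Hs a b + rho * g a b.

Definition nab_hess0 := nab2 hess0.

Definition kap b : A := dot (ric b) N - d b (J * s).

Lemma hessC f a b : nab1 (d^~ f) a b = nab1 (d^~ f) b a.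
Proof. exact: nab1_grad. Qed.

Lemma hess0C a b : hess0 a b = hess0 b a.
Proof. by rewrite /hess0 hessC lowC. Qed.

Lemma nab_hess0C c a b : nab_hess0 c a b = nab_hess0 c b a.
Proof. by rewrite /nab_hess0 -nab2_tr; apply: eq_nab2 => x y; rewrite hess0C. Qed.

Lemma nab_hess0E c a b : nab_hess0 c a b = nab2 Hs c a b + d c rho * g a b.
Proof. by rewrite /nab_hess0 nab2D nab2Z nab2_low // mulr0 addr0. Qed.

(** The Ricci identity for ds together with the derivative of rho g. It is the ambient source of the
    Codazzi equation: the derivative index is exchanged with a slot of E at the cost of curvature
    and d rho. *)
Lemma hess0_codazzi c a b : nab_hess0 c a b = nab_hess0 a c b
  - \sum_e riem c a e b * d e s + d c rho * g a b - d a rho * g c b.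
Proof. by rewrite -nab2_comm // !nab_hess0E; ring. Qed.

Lemma ctr_hess0 : ctr hess0 = - (J * s).
Proof.
rewrite ctrDE ctrZ ctr_low mulrC rhoE -/(lap s); ring.
Qed.

(** Substituting Delta s = -n rho - J s in the contracted Ricci identity turns its gradient into -n
    d rho, whence the factor 1 - n. *)
Lemma div_hess0 b : ctr (fun c a => nab_hess0 c a b)
  = (1 - n%:R) * d b rho + kap b.
Proof.
rewrite (eq_ctr _ (fun c a => nab_hess0E c a b)) ctrDE ctr_nab2_hess.
have -> : ctr (fun c a => d c rho * g a b) = d b rho.
  by rewrite -[RHS](dot_lowl g b R1) dotC; apply: eq_ctr => x y; rewrite lowC.
have -> : d b (lap s) = - (n%:R * d b rho) - d b (J * s).
  have -> : lap s = - (n%:R * rho) - J * s by rewrite rhoE; ring.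
  by rewrite derB derN derM der_nat mul0r add0r.
by rewrite /kap; ring.
Qed.

Variables (k : nat) (Bd : A).
Hypothesis IsqE : dot N N + (s * rho) *+ 2 = 1 + s ^+ k.+2 * Bd.

(** In the applications k + 2 is the ambient dimension. *)
Let Q := s ^+ k.+2 * (half * Bd).

Lemma hess0_N b : dot N (fun c => hess0 c b) = d b Q - s * d b rho.
Proof.
apply/eqP; rewrite -subr_eq0; apply/eqP/(half_eq0 halfP).
have e1 : dot N (fun c => hess0 c b) = dot N (Hs b) + rho * d b s.
  rewrite /hess0 dotDr dotZr; congr (_ + _ * _).
    by apply: eq_dot => // x; rewrite hessC.
  rewrite dotC -[RHS](dot_lowl g b N); apply: eq_dot => // x; exact: lowC.
have e2 : d b (dot N N) = dot N (Hs b) *+ 2.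
  by rewrite (der_dot d g halfP) mulr2n; congr (_ + _); rewrite dotC.
have e3 : s ^+ k.+2 * Bd = Q + Q.
  by rewrite -mulrDr -mulrDl halfP mul1r.
have := congr1 (d b) IsqE; rewrite e3 (mulr2n (s * rho)) !derD e2 der1 derM => e4.
by rewrite e1; move/eqP: e4; rewrite -subr_eq0 => /eqP e4; rewrite -[RHS]e4; ring.
Qed.

(** The Leibniz rule applied to [hess0_N]. Its trace leads to [lap_defect]; untraced, and restricted
    to the hypersurface, it gives components of nabla E with a normal argument. *)
Lemma nab_hess0_N a b : dot (Hs a) (fun c => hess0 c b)
    + dot N (fun c => nab_hess0 a c b)
  = nab1 (d^~ Q) a b - d a s * d b rho - s * nab1 R1 a b.
Proof.
rewrite -nab1_dotl // (eq_nab1 _ _ _ _ _ hess0_N) nab1B nab1Z; ring.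
Qed.

Lemma lap_defect : lap Q = dot2 hess0 hess0 + rho * J * s + (2 - n%:R) * dot N R1
  + dot N kap + s * lap rho.
Proof.
have e a b : nab1 (d^~ Q) a b = dot (Hs a) (fun c => hess0 c b)
    + dot N (fun c => nab_hess0 a c b) + d a s * d b rho + s * nab1 R1 a b.
  by rewrite nab_hess0_N; ring.
rewrite {1}/lap (eq_ctr _ e) 3!ctrDE ctrZ -/(dot N R1) -/(lap rho).
have -> : ctr (fun a b => dot N (fun c => nab_hess0 a c b))
    = (1 - n%:R) * dot N R1 + dot N kap.
  rewrite -dotZr -dotDr.
  have <- : dot N (fun b => ctr (fun a c => nab_hess0 a c b))
      = dot N (fun b => (1 - n%:R) * d b rho + kap b).
    by apply: eq_dot => // b; apply: div_hess0.
  rewrite dotC dot_ctrl; apply: eq_ctr => a b; rewrite dotC.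
  by apply: eq_dot => // c; apply: nab_hess0C.
(* Here Hs = E - rho g, and the trace -J s of E contributes rho J s. *)
have -> : ctr (fun a b => dot (Hs a) (fun c => hess0 c b)) = dot2 hess0 hess0 + rho * J * s.
  have -> : dot2 hess0 hess0 = dot2 Hs hess0 + rho * dot2 g hess0.
    by rewrite -dot2Zl -dot2Dl.
  rewrite dot2_lowl ctr_hess0 -mulrA mulrN addrNK.
  by apply: eq_dot2 => // x y; apply: hess0C.
ring.
Qed.

End Laplacian.

(** * Second derivatives of E in a flat metric *)

Section FlatLaplacian.
Variables (n : nat) (A : comNzRingType) (d : derivations n A).
Variables (g : metric n A) (half : A).
Hypothesis halfP : half + half = 1.

Local Notation nab1 := (nab1 d g half).
Local Notation nab2 := (nab2 d g half).
Local Notation nab3 := (nab3 d g half).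
Local Notation lap := (lap d g half).
Local Notation ctr := (ctr g).
Local Notation dot := (dot g).
Local Notation dot2 := (dot2 g).

Hypothesis flat : forall a b c e, riem d g half a b c e = 0.

Variables (s rho : A).
Hypothesis rhoE : n%:R * rho = - lap s.

Local Notation N := (d^~ s).
Local Notation R1 := (d^~ rho).
Local Notation R2 := (nab1 R1).
Local Notation Hs := (nab1 N).
Local Notation E := (hess0 d g half s rho).
Local Notation X := (nab_hess0 d g half s rho).
Local Notation Z := (nab3 X).

Lemma ric0 a b : ric d g half a b = 0.
Proof. by rewrite /ric big1. Qed.

Lemma scal0 : scal d g half = 0.
Proof. by rewrite /scal (eq_ctr _ ric0) ctr0. Qed.

Lemma div_hess_flat f b : ctr (fun c a => nab2 (nab1 (d^~ f)) c a b) = d b (lap f).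
Proof.
rewrite ctr_nab2_hess // -[RHS]addr0; congr (_ + _).
by rewrite (eq_dot _ (ric0 b) (frefl _)) /dot -[RHS](ctr0 g); apply: eq_ctr => x y; rewrite mul0r.
Qed.

Lemma nab_hess0_codazzi c a b : X c a b = X a c b + d c rho * g a b - d a rho * g c b.
Proof.
rewrite hess0_codazzi // big1 ?subr0 // => e _.
by rewrite flat mul0r.
Qed.

Lemma div_hess0_flat b : ctr (fun c a => X c a b) = (1 - n%:R) * d b rho.
Proof.
rewrite (div_hess0 halfP (J := 0)) ?mul0r ?addr0 // /kap mul0r der0 subr0.
have -> : dot (ric d g half b) N = 0.
  by rewrite (eq_dot _ (ric0 b) (frefl _)) /dot -[RHS](ctr0 g); apply: eq_ctr => x y; rewrite mul0r.
by rewrite addr0.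
Qed.

Lemma Zcomm e c a b : Z e c a b = Z c e a b.
Proof.
apply/eqP; rewrite -subr_eq0 nab3_comm // !big1 ?oppr0 ?addr0 // => f _;
  by rewrite flat mul0r.
Qed.

Lemma Zcodazzi e c a b : Z e c a b = Z e a c b + R2 e c * g a b - R2 e a * g c b.
Proof.
rewrite (eq_nab3 _ _ _ _ _ _ _ (nab_hess0_codazzi)) nab3D nab3D nab3N nab3_swap.
by rewrite nab3_low // (nab3_swap _ _ _ (fun c a b => d c rho * g a b)) nab3_low.
Qed.

(** The Codazzi identity moves a slot of E into derivative position, derivatives commute, and the
    derivative of div E = (1 - n) d rho remains; the term nabla d rho lost in the exchange makes the
    coefficient -n. *)
Lemma lap_hess0 a b : ctr (fun e c => Z e c a b) = lap rho * g a b - n%:R * R2 a b.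
Proof.
rewrite (eq_ctr _ (fun e c => Zcodazzi e c a b)) ctrB ctrDE.
rewrite (eq_ctr _ (fun e c => Zcomm e a c b)) -nab1_ctr //.
rewrite (eq_nab1 _ _ _ _ _ div_hess0_flat) nab1Z derB der1 der_nat subrr mul0r add0r.
rewrite (eq_ctr _ (fun e c => mulrC _ _)) ctrZ -/(lap rho).
have -> : ctr (fun e c => R2 e a * g c b) = R2 a b.
  rewrite nab1_grad -[RHS](dot_lowl g b (R2^~ a)) dotC; apply: eq_ctr => x y.
  by rewrite lowC.
ring.
Qed.

Lemma ctr_hess0_flat : ctr E = 0.
Proof. by rewrite (ctr_hess0 (J := 0)) ?mul0r ?oppr0 ?addr0. Qed.

Let tau := lap rho.

(** Product rule, with Delta E from [lap_hess0]; its pure trace part is annihilated by the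
    trace-free E. *)
Lemma lap_dot2_hess0 : lap (dot2 E E)
  = (ctr (fun e c => dot2 (X e) (X c)) - n%:R * dot2 R2 E) *+ 2.
Proof.
have e c : d c (dot2 E E) = dot2 (X c) E + dot2 (X c) E.
  by rewrite (der_dot2 d g halfP) (dot2C _ E).
rewrite /lap (eq_ctr _ (fun a b => eq_nab1 _ _ _ _ _ e)).
rewrite (eq_ctr _ (fun a b => nab1D _ _ _ _ _ _ _)) ctrDE -mulr2n; congr (_ *+ 2).
rewrite (eq_ctr _ (fun a b => nab1_dot2 _ _ halfP _ _ _ _)) ctrDE addrC; congr (_ + _).
  by rewrite -ctr_tr; apply: eq_ctr => a b.
rewrite -(dot2_ctrl _ (fun e c a b => Z e c a b)).
have -> : dot2 (fun x y => ctr (fun a b => Z a b x y)) E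
    = dot2 (fun x y => tau * g x y + (- n%:R) * R2 x y) E.
  by apply: eq_dot2 => // a b; rewrite lap_hess0 mulNr.
by rewrite dot2Dl !dot2Zl dot2_lowl ctr_hess0_flat mulr0 add0r mulNr.
Qed.

(** In a flat metric Delta commutes with d, and Delta s = -n rho; the cross term uses Hs = E - rho
    g. *)
Lemma lap_dot_grads : lap (dot N R1) = - n%:R * dot R1 R1 + dot N (d^~ tau)
   + (dot2 E R2 - rho * tau) *+ 2.
Proof.
have e c : d c (dot N R1) = dot (Hs c) R1 + dot (R2 c) N.
  by rewrite (der_dot d g halfP) (dotC _ N).
rewrite /lap (eq_ctr _ (fun a b => eq_nab1 _ _ _ _ _ e)).
rewrite (eq_ctr _ (fun a b => nab1D _ _ _ _ _ _ _)) ctrDE.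
rewrite !(eq_ctr _ (fun a b => nab1_dotr _ _ halfP _ _ _ _)) !ctrDE.
rewrite -!dot_ctrl.
have -> : ctr (fun a b => dot (R2 b) (Hs a)) = ctr (fun a b => dot (Hs b) (R2 a)).
  by rewrite -ctr_tr; apply: eq_ctr => a b; rewrite dotC.
have -> : ctr (fun a b => dot (Hs b) (R2 a)) = dot2 E R2 - rho * tau.
  rewrite -[LHS]ctr_tr -/(dot2 Hs R2).
  have -> : dot2 E R2 = dot2 Hs R2 + rho * dot2 g R2 by rewrite -dot2Zl -dot2Dl.
  by rewrite dot2_lowl addrK.
rewrite (eq_dot _ (div_hess_flat s) (frefl _)) (eq_dot _ (div_hess_flat rho) (frefl _)).
have -> : dot (d^~ (lap s)) R1 = - n%:R * dot R1 R1.
  rewrite -dotZl; apply: eq_dot => // a.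
  by rewrite -[lap s]opprK -rhoE derN derM der_nat mul0r add0r mulNr.
by rewrite (dotC _ (d^~ tau)); ring.
Qed.

Lemma lapM f h : lap (f * h) = lap f * h + dot (d^~ f) (d^~ h) *+ 2 + f * lap h.
Proof.
have e c : d c (f * h) = h * d c f + f * d c h by rewrite derM mulrC.
rewrite {1}/lap (eq_ctr _ (fun a b => eq_nab1 _ _ _ _ _ e)).
rewrite (eq_ctr _ (fun a b => nab1D _ _ _ _ _ _ _)) ctrDE.
rewrite !(eq_ctr _ (fun a b => nab1Z _ _ _ _ _ _ _)) 2!ctrDE !ctrZ.
by rewrite -/(dot (d^~ f) (d^~ h)) -/(dot (d^~ h) (d^~ f)) (dotC _ (d^~ h)) /lap; ring.
Qed.

Lemma lapD f h : lap (f + h) = lap f + lap h.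
Proof.
rewrite /lap -ctrDE; apply: eq_ctr => a b; rewrite -nab1D.
by apply: eq_nab1 => c; rewrite derD.
Qed.

Lemma lapN f : lap (- f) = - lap f.
Proof.
rewrite /lap -ctrN; apply: eq_ctr => a b; rewrite -nab1N.
by apply: eq_nab1 => c; rewrite derN.
Qed.

Lemma kap_flat b : kap d g half s 0 b = 0.
Proof.
rewrite /kap mul0r der0 subr0 (eq_dot _ (ric0 b) (frefl _)) /dot -[RHS](ctr0 g).
by apply: eq_ctr => x y; rewrite mul0r.
Qed.

(** The argument of [lap] is the right-hand side of [lap_defect] for n = 4 and J = 0. The
    coefficient 12 is 2 * 4 from |E|^2 plus 2 * 2 from <ds, d rho>; the terms rho Delta rho and <ds,
    d Delta rho> cancel. *)
Lemma lap_lap_defect : n%:R = 4%:R :> A ->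
  lap (dot2 E E - 2%:R * dot N R1 + s * lap rho)
  = ctr (fun e c => dot2 (X e) (X c)) *+ 2 - 12%:R * dot2 E (nab1 R1)
    + 8%:R * dot R1 R1 + s * lap (lap rho).
Proof.
move=> n4.
have -> : dot2 E E - 2%:R * dot N R1 + s * lap rho
   = dot2 E E - (dot N R1 + dot N R1) + s * lap rho by ring.
rewrite !(lapD, lapN) lap_dot2_hess0 // lap_dot_grads // lapM.
have -> : lap s = - (4%:R * rho) by rewrite -n4 rhoE opprK.
by rewrite n4 (dot2C g _ E) /tau; ring.
Qed.

End FlatLaplacian.

(** * The divergence of kappa in dimension three *)

Section KappaDivergence.
Variables (n : nat) (A : comNzRingType) (d : derivations n A).
Variables (g : metric n A) (half : A).
Hypothesis halfP : half + half = 1.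
Variables (s J : A).

Local Notation Hs := (nab1 d g half (d^~ s)).
Local Notation ric := (ric d g half).

(** Since Sc = 4 J, the contracted Bianchi identity reads div Ric = 2 dJ, and 2 <dJ, ds> is also the
    cross term of Delta (J s): the first derivatives of J cancel. *)
Lemma ctr_nab1_kap : scal d g half = 4%:R * J ->
  ctr g (nab1 d g half (kap d g half s J))
  = dot2 g ric Hs - s * lap d g half J - J * lap d g half s.
Proof.
move=> scalE; rewrite /kap.
rewrite (eq_ctr _ (fun a b => nab1B _ _ _ _ _ _ _)) ctrB -/(lap d g half (J * s)).
rewrite (eq_ctr _ (fun a b => nab1_dotr _ _ halfP _ _ _ _)) ctrDE -dot_ctrl lapM.
have -> : ctr g (fun a b => dot g (ric b) (Hs a)) = dot2 g ric Hs by rewrite -ctr_tr.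
have e c : ctr g (fun a b => nab2 d g half ric a b c) = 2%:R * d c J.
  apply/eqP; rewrite -subr_eq0; apply/eqP/(half_eq0 halfP).
  have := ric_bianchi d g halfP c; rewrite scalE derM der_nat mul0r add0r => e0.
  by apply/eqP; rewrite -subr_eq0; apply/eqP; rewrite -[RHS](subrr (4%:R * d c J)) {1}e0; ring.
by rewrite (eq_dot _ e (frefl _)) dotZl (dotC g (d^~ J)); ring.
Qed.

End KappaDivergence.

(** * Evaluation of covariant tensors on vectors *)

Section Evaluation.
Variables (n : nat) (B : comNzRingType).
Implicit Types (S u v w : 'I_n -> B) (T : 'I_n -> 'I_n -> B).

(** A pairing without metric. Along the hypersurface the arguments are the tangent vectors [J i] and
    the unit normal [nu]; nesting [ev1] reduces the linearity of the higher evaluations to this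
    one. *)
Definition ev1 S v : B := \sum_a v a * S a.

Definition ev2 T v w : B := ev1 (fun a => ev1 (T a) w) v.

Definition ev3 (X : 'I_n -> 'I_n -> 'I_n -> B) u v w : B :=
  ev1 (fun c => ev2 (X c) v w) u.

Definition ev4 (Z : 'I_n -> 'I_n -> 'I_n -> 'I_n -> B) t u v w : B :=
  ev1 (fun e => ev3 (Z e) u v w) t.

Lemma eq_ev1 S S' v : S =1 S' -> ev1 S v = ev1 S' v.
Proof. by move=> e; apply: eq_bigr => a _; rewrite e. Qed.

Lemma eq_ev2 T T' v w : (forall a b, T a b = T' a b) -> ev2 T v w = ev2 T' v w.
Proof. by move=> e; apply: eq_ev1 => a; apply: eq_ev1. Qed.

Lemma eq_ev1r S v v' : v =1 v' -> ev1 S v = ev1 S v'.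
Proof. by move=> e; apply: eq_bigr => a _; rewrite e. Qed.

Lemma eq_ev2r T v v' w w' : v =1 v' -> w =1 w' -> ev2 T v w = ev2 T v' w'.
Proof. by move=> e f; rewrite /ev2 (eq_ev1r _ e); apply: eq_ev1 => a; apply: eq_ev1r. Qed.

Lemma ev1Dr S v w : ev1 S (fun a => v a + w a) = ev1 S v + ev1 S w.
Proof. by rewrite -big_split; apply: eq_bigr => a _; rewrite mulrDl. Qed.

Lemma ev1Zr S x v : ev1 S (fun a => x * v a) = x * ev1 S v.
Proof. by rewrite /ev1 mulr_sumr; apply: eq_bigr => a _; rewrite mulrA. Qed.

Lemma ev1Nr S v : ev1 S (fun a => - v a) = - ev1 S v.
Proof. by rewrite /ev1 -sumrN; apply: eq_bigr => a _; rewrite mulNr. Qed.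

Lemma ev1_sumr m S (v : 'I_m -> 'I_n -> B) :
  ev1 S (fun a => \sum_l v l a) = \sum_l ev1 S (v l).
Proof.
rewrite /ev1 [RHS]exchange_big; apply: eq_bigr => a _ /=.
by rewrite mulr_suml.
Qed.

Lemma ev1C S v : ev1 S v = ev1 v S.
Proof. by apply: eq_bigr => a _; rewrite mulrC. Qed.

Lemma ev1Dl S S' v : ev1 (fun a => S a + S' a) v = ev1 S v + ev1 S' v.
Proof. by rewrite ev1C ev1Dr !(ev1C v). Qed.

Lemma ev1Zl x S v : ev1 (fun a => x * S a) v = x * ev1 S v.
Proof. by rewrite ev1C ev1Zr ev1C. Qed.

Lemma ev1Nl S v : ev1 (fun a => - S a) v = - ev1 S v.
Proof. by rewrite ev1C ev1Nr ev1C. Qed.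

Lemma ev1_suml m (S : 'I_m -> 'I_n -> B) v :
  ev1 (fun a => \sum_l S l a) v = \sum_l ev1 (S l) v.
Proof. by rewrite ev1C ev1_sumr; apply: eq_bigr => l _; rewrite ev1C. Qed.

Lemma ev1_0l v : ev1 (fun=> 0) v = 0.
Proof. by rewrite /ev1 big1 // => a _; rewrite mulr0. Qed.

Lemma ev2_tr T v w : ev2 T v w = ev2 (fun a b => T b a) w v.
Proof.
rewrite /ev2 /ev1.
under eq_bigr do rewrite mulr_sumr; rewrite exchange_big /=.
by apply: eq_bigr => b _; rewrite mulr_sumr; apply: eq_bigr => a _; rewrite mulrCA.
Qed.

Lemma ev2E T v w : ev2 T v w = ev1 (fun b => ev1 (T^~ b) v) w.
Proof. exact: ev2_tr. Qed.

Lemma ev3E X u v w :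
  ev3 X u v w = ev2 (fun a b => ev1 (fun c => X c a b) u) v w.
Proof.
rewrite /ev3 /ev2 -/(ev2 (fun c a => ev1 (X c a) w) u v) ev2E.
by apply: eq_ev1 => a; rewrite -/(ev2 (fun c b => X c a b) u w) ev2E.
Qed.

Lemma ev4E Z t u v w :
  ev4 Z t u v w = ev3 (fun c a b => ev1 (fun e => Z e c a b) t) u v w.
Proof.
rewrite /ev4 /ev3 -/(ev2 (fun e c => ev2 (Z e c) v w) t u) ev2E.
by apply: eq_ev1 => c; rewrite -/(ev3 (fun e a b => Z e c a b) t v w) ev3E.
Qed.

Lemma ev2D T T' v w : ev2 (fun a b => T a b + T' a b) v w = ev2 T v w + ev2 T' v w.
Proof. by rewrite /ev2 -ev1Dl; apply: eq_ev1 => a; rewrite ev1Dl. Qed.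

Lemma ev2Z x T v w : ev2 (fun a b => x * T a b) v w = x * ev2 T v w.
Proof. by rewrite /ev2 -ev1Zl; apply: eq_ev1 => a; rewrite ev1Zl. Qed.

Lemma ev2N T v w : ev2 (fun a b => - T a b) v w = - ev2 T v w.
Proof. by rewrite /ev2 -ev1Nl; apply: eq_ev1 => a; rewrite ev1Nl. Qed.

Lemma ev2M S S' v w : ev2 (fun a b => S a * S' b) v w = ev1 S v * ev1 S' w.
Proof. by rewrite mulrC -ev1Zl; apply: eq_ev1 => a; rewrite ev1Zl mulrC. Qed.

Lemma ev3_swap X u v w : ev3 (fun c a b => X a c b) u v w = ev3 X v u w.
Proof. exact: (ev2_tr (fun c a => ev1 (X a c) w)). Qed.

Lemma eq_ev3 X X' u v w : (forall c a b, X c a b = X' c a b) ->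
  ev3 X u v w = ev3 X' u v w.
Proof. by move=> k; apply: eq_ev1 => c; apply: eq_ev2. Qed.

Lemma ev3D X X' u v w : ev3 (fun c a b => X c a b + X' c a b) u v w
  = ev3 X u v w + ev3 X' u v w.
Proof. by rewrite /ev3 -ev1Dl; apply: eq_ev1 => c; exact: ev2D. Qed.

Lemma ev3N X u v w : ev3 (fun c a b => - X c a b) u v w = - ev3 X u v w.
Proof. by rewrite /ev3 -ev1Nl; apply: eq_ev1 => c; exact: ev2N. Qed.

Lemma ev3M S T u v w : ev3 (fun c a b => S c * T a b) u v w = ev1 S u * ev2 T v w.
Proof. by rewrite mulrC -ev1Zl; apply: eq_ev1 => c; rewrite ev2Z mulrC. Qed.

Lemma ev4_swap Z t u v w : ev4 (fun e c a b => Z c e a b) t u v w = ev4 Z u t v w.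
Proof. exact: (ev2_tr (fun e c => ev2 (Z c e) v w)). Qed.

Lemma ev4_swap23 Z t u v w : ev4 (fun e c a b => Z e a c b) t u v w = ev4 Z t v u w.
Proof. by apply: eq_ev1 => e; exact: ev3_swap. Qed.

Lemma ev4D Z Z' t u v w : ev4 (fun e c a b => Z e c a b + Z' e c a b) t u v w
  = ev4 Z t u v w + ev4 Z' t u v w.
Proof.
rewrite /ev4 -ev1Dl; apply: eq_ev1 => e; rewrite /ev3 -ev1Dl; apply: eq_ev1 => c.
exact: ev2D.
Qed.

Lemma ev4N Z t u v w : ev4 (fun e c a b => - Z e c a b) t u v w = - ev4 Z t u v w.
Proof.
rewrite /ev4 -ev1Nl; apply: eq_ev1 => e; rewrite /ev3 -ev1Nl; apply: eq_ev1 => c.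
exact: ev2N.
Qed.

Lemma ev4M T T' t u v w :
  ev4 (fun e c a b => T e c * T' a b) t u v w = ev2 T t u * ev2 T' v w.
Proof.
rewrite mulrC /ev4 -ev1Zl; apply: eq_ev1 => e; rewrite /ev3 -ev1Zl.
by apply: eq_ev1 => c; rewrite ev2Z mulrC.
Qed.

Lemma eq_ev4 Z Z' t u v w : (forall e c a b, Z e c a b = Z' e c a b) ->
  ev4 Z t u v w = ev4 Z' t u v w.
Proof. by move=> k; apply: eq_ev1 => e; apply: eq_ev1 => c; apply: eq_ev2. Qed.

End Evaluation.

(** * Contractions as traces of endomorphisms *)

Section Traces.
Variables (m : nat) (B : comNzRingType) (g : metric m B).
Implicit Types (S T : 'I_m -> 'I_m -> B) (P : 'M[B]_m).

Definition mxt T : 'M[B]_m := \matrix_(i, j) T i j.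

(** The mixed tensor T_i^j. Contractions of products of symmetric tensors become traces of matrix
    products, to which the trace identities of low dimension apply. *)
Definition endo T : 'M[B]_m := mxt T *m mxt (upp g).

Lemma eq_endo T T' : (forall i j, T i j = T' i j) -> endo T = endo T'.
Proof. by move=> e; congr (_ *m _); apply/matrixP => i j; rewrite !mxE e. Qed.

Lemma endo_low : endo g = 1%:M.
Proof.
by apply/matrixP => i j; rewrite !mxE -(lowK g); apply: eq_bigr => k _; rewrite !mxE.
Qed.

Lemma endoD S T : endo (fun i j => S i j + T i j) = endo S + endo T.
Proof. by rewrite -mulmxDl; congr (_ *m _); apply/matrixP => i j; rewrite !mxE. Qed.

Lemma endoZ x T : endo (fun i j => x * T i j) = x *: endo T.
Proof. by rewrite /endo scalemxAl; congr (_ *m _); apply/matrixP => i j; rewrite !mxE. Qed.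

Lemma endoN T : endo (fun i j => - T i j) = - endo T.
Proof. by rewrite -mulNmx; congr (_ *m _); apply/matrixP => i j; rewrite !mxE. Qed.

Lemma endo_comp S T :
  endo (fun i j => \sum_k (endo S) i k * T k j) = endo S *m endo T.
Proof.
rewrite {3}/endo mulmxA; congr (_ *m _).
by apply/matrixP => i j; rewrite !mxE; apply: eq_bigr => k _; rewrite !mxE.
Qed.

Lemma ctrE T : ctr g T = \tr (endo T).
Proof.
apply: eq_bigr => i _; rewrite !mxE; apply: eq_bigr => j _.
by rewrite !mxE uppC mulrC.
Qed.

Lemma ctr_ctr (F : 'I_m -> 'I_m -> 'I_m -> 'I_m -> B) :
  ctr g (fun a b => ctr g (F a b)) = ctr g (fun c e => ctr g (fun a b => F a b c e)).
Proof.
rewrite [LHS]ctr_sum; apply: eq_bigr => c _; rewrite ctr_sum; apply: eq_bigr => e _.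
exact: ctrZ.
Qed.

Lemma dot2_tr S T : dot2 g (fun i j => S j i) (fun i j => T j i) = dot2 g S T.
Proof. exact: ctr_ctr. Qed.

Lemma dot2E S T : (forall i j, T i j = T j i) ->
  dot2 g S T = \tr (endo S *m endo T).
Proof.
move=> TC; rewrite -endo_comp -ctrE; apply: eq_ctr => i j.
rewrite /dot /ctr exchange_big; apply: eq_bigr => k _ /=.
rewrite mxE mulr_suml; apply: eq_bigr => l _.
by rewrite !mxE (TC k j); ring.
Qed.

End Traces.

(** * Restriction to a hypersurface *)

(* [r : A -> B] is the pullback along a parametrization F, [J i a] = d_i F^a, [na] and [nu]
   are the components of the unit conormal and of the unit normal along F. *)
Section Hypersurface.
Variables (m : nat) (A B : comNzRingType).
Variables (dA : derivations m.+1 A) (dB : derivations m B) (r : {rmorphism A -> B}).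
Variables (J : 'I_m -> 'I_m.+1 -> B).
Hypothesis chain : forall i f, dB i (r f) = \sum_a J i a * r (dA a f).
Hypothesis JC : forall i j a, dB i (J j a) = dB j (J i a).

Variables (gA : metric m.+1 A) (gB : metric m B) (half : A).
Hypothesis halfP : half + half = 1.
Local Notation rg := (fun a b => r (gA a b)).
Hypothesis gBE : forall i j, gB i j = ev2 rg (J i) (J j).

Variables (na nu : 'I_m.+1 -> B).
Hypothesis naE : forall a, na a = \sum_b r (gA a b) * nu b.
Hypothesis naJ : forall i, ev1 na (J i) = 0.
Hypothesis nann : ev1 na nu = 1.

Lemma rhalfP : r half + r half = 1.
Proof. by rewrite -rmorphD halfP rmorph1. Qed.

Lemma rg_nu v : ev2 rg v nu = ev1 na v.
Proof. by apply: eq_ev1 => a; rewrite naE; apply: eq_bigr => b _; rewrite mulrC. Qed.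

Lemma rgC v w : ev2 rg v w = ev2 rg w v.
Proof. by rewrite ev2_tr; apply: eq_ev2 => a b; rewrite lowC. Qed.

(** In the frame formed by the normal and the [J i] the ambient metric is block diagonal with blocks
    1 and [gB]; inverting it in that frame gives the splitting. Through [ctrr_split], every ambient
    trace becomes a tangential trace plus a normal-normal component. *)
Lemma upp_split a b :
  r (upp gA a b) = \sum_i \sum_j upp gB i j * (J i a * J j b) + nu a * nu b.
Proof.
(* Since 1 + m and m.+1 are convertible, Q is at once a block matrix and a square one. *)
pose Q : (matrix B (1 + m) m.+1) := col_mx (\row_x nu x) (\matrix_(i, x) J i x).
pose G : 'M[B]_m.+1 := \matrix_(x, y) r (gA x y).
pose Gi : 'M[B]_m.+1 := \matrix_(x, y) r (upp gA x y).
pose H : 'M[B]_m := \matrix_(i, j) gB i j.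
pose Hi : 'M[B]_m := \matrix_(i, j) upp gB i j.
pose D : 'M[B]_(1 + m) := block_mx 1%:M 0 0 Hi.
have HHi : H *m Hi = 1%:M.
  by apply/matrixP => i j; rewrite !mxE -(lowK gB); apply: eq_bigr => k _; rewrite !mxE.
have GiG : Gi *m G = 1%:M.
  apply/matrixP => i j; rewrite !mxE -(rmorph_nat r (i == j)) -(uppK gA) rmorph_sum.
  by apply: eq_bigr => k _; rewrite !mxE rmorphM.
have entry p q (U : 'M[B]_(p, m.+1)) (V : 'M[B]_(q, m.+1)) i j :
    (U *m (G *m V^T)) i j = ev2 rg (U i) (V j).
  rewrite !mxE; apply: eq_bigr => x _; congr (_ * _).
  by rewrite !mxE; apply: eq_bigr => y _; rewrite !mxE mulrC.
have QN k : Q (lshift m k) =1 nu by move=> x; rewrite col_mxEu mxE.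
have QJ k : Q (rshift 1 k) =1 J k by move=> x; rewrite col_mxEd mxE.
have QGQ : Q *m (G *m Q^T) = block_mx 1%:M 0 0 H.
  apply/matrixP => i j; rewrite entry /Q.
  case: (split_ordP i) => i' ->; case: (split_ordP j) => j' ->.
  - by rewrite (eq_ev2r _ (QN i') (QN j')) rg_nu nann block_mxEul !ord1 mxE eqxx.
  - by rewrite (eq_ev2r _ (QN i') (QJ j')) rgC rg_nu naJ block_mxEur mxE.
  - by rewrite (eq_ev2r _ (QJ i') (QN j')) rg_nu naJ block_mxEdl mxE.
  - by rewrite (eq_ev2r _ (QJ i') (QJ j')) -gBE block_mxEdr mxE.
have QP : Q *m (G *m Q^T *m D) = 1%:M.
  rewrite mulmxA QGQ mulmx_block !(mulmx0, mul0mx, mulmx1, mul1mx, addr0, add0r) HHi.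
  by rewrite -scalar_mx_block.
(* A right inverse of the square matrix Q is a left inverse, which turns Q G Q^T D = 1 into G^-1 =
   Q^T D Q. *)
have := mulmx1C QP; rewrite -2!mulmxA => /(congr1 (mulmx Gi)).
rewrite (mulmxA Gi G) GiG mul1mx mulmx1 => /matrixP/(_ a b).
rewrite [Gi _ _]mxE => <-.
rewrite /Q /D tr_col_mx -mulmxA mul_block_col mul_row_col !(mul0mx, mul1mx, add0r, addr0).
rewrite !mxE addrC; congr (_ + _); last by rewrite big_ord1 !mxE.
apply: eq_bigr => i _; rewrite !mxE mulr_sumr; apply: eq_bigr => j _.
by rewrite !mxE; ring.
Qed.

Definition ctrr (T : 'I_m.+1 -> 'I_m.+1 -> B) : B := \sum_a \sum_b r (upp gA a b) * T a b.

Lemma ctrr_split T : ctrr T = ctr gB (fun i j => ev2 T (J i) (J j)) + ev2 T nu nu.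
Proof.
have e v w : \sum_a \sum_b (v a * w b) * T a b = ev2 T v w.
  apply: eq_bigr => a _; rewrite mulr_sumr; apply: eq_bigr => b _.
  by rewrite mulrA.
rewrite /ctrr -e.
under eq_bigr do under eq_bigr do rewrite upp_split mulrDl.
under eq_bigr do rewrite big_split; rewrite big_split /=; congr (_ + _).
under eq_bigr do under eq_bigr do rewrite mulr_suml.
under eq_bigr do rewrite exchange_big; rewrite exchange_big /=; apply: eq_bigr => i _.
under eq_bigr do under eq_bigr do rewrite mulr_suml.
under eq_bigr do rewrite exchange_big; rewrite exchange_big /=; apply: eq_bigr => j _.
rewrite -e mulr_sumr; apply: eq_bigr => a _; rewrite mulr_sumr; apply: eq_bigr => b _.
by rewrite !mulrA.
Qed.

Lemma r_ctr T : r (ctr gA T) = ctrr (fun a b => r (T a b)).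
Proof.
rewrite rmorph_sum; apply: eq_bigr => a _; rewrite rmorph_sum; apply: eq_bigr => b _.
by rewrite rmorphM.
Qed.

Lemma eq_ctrr T T' : (forall a b, T a b = T' a b) -> ctrr T = ctrr T'.
Proof. by move=> e; apply: eq_bigr => a _; apply: eq_bigr => b _; rewrite e. Qed.

Lemma ev1_ctrr (T : 'I_m.+1 -> 'I_m.+1 -> 'I_m.+1 -> B) v :
  ev1 (fun a => ctrr (T a)) v = ctrr (fun b c => ev1 (fun a => T a b c) v).
Proof.
rewrite ev1_suml; apply: eq_bigr => b _; rewrite ev1_suml; apply: eq_bigr => c _.
by rewrite ev1Zl.
Qed.

Lemma ev2_ctrr (T : 'I_m.+1 -> 'I_m.+1 -> 'I_m.+1 -> 'I_m.+1 -> B) v w :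
  ev2 (fun a b => ctrr (T a b)) v w = ctrr (fun c e => ev2 (fun a b => T a b c e) v w).
Proof. by rewrite /ev2 -ev1_ctrr; apply: eq_ev1 => a; rewrite ev1_ctrr. Qed.

Definition dotr S S' : B := ctrr (fun a b => S a * S' b).

Definition dot2r T T' : B := ctrr (fun a b => dotr (T a) (T' b)).

Lemma dotr_split (S S' : 'I_m.+1 -> B) : dotr S S'
  = dot gB (fun i => ev1 S (J i)) (fun i => ev1 S' (J i)) + ev1 S nu * ev1 S' nu.
Proof. by rewrite /dotr ctrr_split ev2M; congr (_ + _); apply: eq_ctr => i j; rewrite ev2M. Qed.

Lemma ev2_dotr (T T' : 'I_m.+1 -> 'I_m.+1 -> B) (v w : 'I_m.+1 -> B) :
  ev2 (fun a b => dotr (T a) (T' b)) v w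
  = dotr (fun c => ev1 (T^~ c) v) (fun c => ev1 (T'^~ c) w).
Proof. by rewrite ev2_ctrr; apply: eq_ctrr => a b; rewrite ev2M. Qed.

Lemma dot2r_split (T T' : 'I_m.+1 -> 'I_m.+1 -> B) : dot2r T T'
  = dot2 gB (fun i j => ev2 T (J i) (J j)) (fun i j => ev2 T' (J i) (J j))
    + dot gB (fun i => ev2 T (J i) nu) (fun i => ev2 T' (J i) nu)
    + dot gB (fun i => ev2 T nu (J i)) (fun i => ev2 T' nu (J i))
    + ev2 T nu nu * ev2 T' nu nu.
Proof.
rewrite /dot2r ctrr_split ev2_dotr dotr_split -!ev2E addrA; congr (_ + _ + _); last first.
  by apply: eq_dot => i; rewrite -ev2E.
rewrite -ctrDE; apply: eq_ctr => i j; rewrite ev2_dotr dotr_split -!ev2E.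
by congr (_ + _); apply: eq_dot => k; rewrite -ev2E.
Qed.

Lemma r_dot2 T T' : r (dot2 gA T T') = dot2r (fun a b => r (T a b)) (fun a b => r (T' a b)).
Proof.
rewrite r_ctr; apply: eq_ctrr => a b; rewrite r_ctr.
by apply: eq_ctrr => c e; rewrite rmorphM.
Qed.

Lemma r_dot S S' : r (dot gA S S') = dotr (fun a => r (S a)) (fun a => r (S' a)).
Proof. by rewrite r_ctr; apply: eq_ctrr => a b; rewrite rmorphM. Qed.

Lemma ev2_dot2r (X X' : 'I_m.+1 -> 'I_m.+1 -> 'I_m.+1 -> B) v w :
  ev2 (fun a b => dot2r (X a) (X' b)) v w
  = dot2r (fun a b => ev1 (fun c => X c a b) v) (fun a b => ev1 (fun c => X' c a b) w).
Proof. by rewrite ev2_ctrr; apply: eq_ctrr => a b; rewrite ev2_dotr. Qed.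

(** Lower the index of v, then raise it with [upp_split]. The Gauss and Weingarten formulas are this
    decomposition for derivatives of the frame. *)
Lemma vec_split (v : 'I_m.+1 -> B) a :
  v a = \sum_i (\sum_j upp gB i j * ev2 rg v (J j)) * J i a + ev1 na v * nu a.
Proof.
pose w b := \sum_c r (gA b c) * v c.
have {1}-> : v a = \sum_b r (upp gA a b) * w b.
  rewrite contr_assoc -[LHS](sum_delta v a); apply: eq_bigr => c _.
  rewrite -(rmorph_nat r (a == c)) -(uppK gA) rmorph_sum; congr (_ * _).
  by apply: eq_bigr => b _; rewrite rmorphM.
have ew u : ev1 w u = ev2 rg v u.
  by rewrite rgC; apply: eq_ev1 => b; apply: eq_bigr => c _; rewrite mulrC.
under eq_bigr do rewrite upp_split mulrDl.
rewrite big_split /=; congr (_ + _); last first.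
  by rewrite -rg_nu -ew mulrC mulr_sumr; apply: eq_bigr => b _; rewrite mulrA.
under eq_bigr do rewrite mulr_suml; rewrite exchange_big /=; apply: eq_bigr => i _.
under eq_bigr do rewrite mulr_suml; rewrite exchange_big mulr_suml /=.
apply: eq_bigr => j _; rewrite -ew /ev1 mulr_sumr mulr_suml.
by apply: eq_bigr => b _; ring.
Qed.

(** Connection coefficients of the ambient tangent bundle pulled back by F; they differentiate
    fields defined only along the hypersurface, such as [J i] and [nu]. *)
Definition cn k e a : B := \sum_c J k c * r (chr dA gA half e c a).

(* Covariant derivatives along F of vector fields ([Dup]) and covector fields ([Dlow]) *)
Definition Dup k v a : B := dB k (v a) + \sum_e cn k a e * v e.

Definition Dlow k (S : 'I_m.+1 -> B) a : B := dB k (S a) - \sum_e cn k e a * S e.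

Lemma der_ev1 k S v : dB k (ev1 S v) = ev1 (Dlow k S) v + ev1 S (Dup k v).
Proof.
have -> : ev1 (Dlow k S) v = ev1 (fun a => dB k (S a)) v
    - \sum_a v a * (\sum_e cn k e a * S e).
  by rewrite -sumrB; apply: eq_bigr => a _; rewrite mulrBr.
rewrite contr_assoc.
have -> : ev1 S (Dup k v) = \sum_a dB k (v a) * S a
    + \sum_e (\sum_a v a * cn k e a) * S e.
  rewrite -big_split; apply: eq_bigr => a _ /=; rewrite -mulrDl; congr ((_ + _) * _).
  by apply: eq_bigr => e _; rewrite mulrC.
rewrite addrA addrAC addrNK addrC der_sum -big_split; apply: eq_bigr => a _ /=.
by rewrite derM addrC.
Qed.

Let cnE k e a x : cn k e a * x = ev1 (fun c => r (chr dA gA half e c a) * x) (J k).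
Proof. by rewrite mulr_suml; apply: eq_bigr => c _; rewrite mulrA. Qed.

Let der_rE k f : dB k (r f) = ev1 (fun c => r (dA c f)) (J k).
Proof. exact: chain. Qed.

Lemma Dlow_r k S a : Dlow k (fun a => r (S a)) a
  = ev1 (fun c => r (nab1 dA gA half S c a)) (J k).
Proof.
rewrite /Dlow der_rE; under eq_bigr do rewrite cnE.
rewrite -ev1_suml -ev1Nl -ev1Dl; apply: eq_ev1 => c.
rewrite rmorphB rmorph_sum; congr (_ - _).
by apply: eq_bigr => e _; rewrite -rmorphM.
Qed.

Lemma r_nab2 k T a b :
  dB k (r (T a b)) - \sum_e cn k e a * r (T e b) - \sum_e cn k e b * r (T a e)
  = ev1 (fun c => r (nab2 dA gA half T c a b)) (J k).
Proof.
rewrite der_rE; under eq_bigr do rewrite cnE.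
under [X in _ - _ - X]eq_bigr do rewrite cnE.
rewrite -!ev1_suml -!ev1Nl -!ev1Dl; apply: eq_ev1 => c.
rewrite !rmorphB !rmorph_sum; congr (_ - _ - _);
  by apply: eq_bigr => e _; rewrite -rmorphM.
Qed.

Lemma r_nab3 k X c a b :
  dB k (r (X c a b)) - \sum_e cn k e c * r (X e a b) - \sum_e cn k e a * r (X c e b)
    - \sum_e cn k e b * r (X c a e)
  = ev1 (fun e => r (nab3 dA gA half X e c a b)) (J k).
Proof.
rewrite der_rE; under eq_bigr do rewrite cnE.
under [X in _ - _ - X - _]eq_bigr do rewrite cnE.
under [X in _ - _ - _ - X]eq_bigr do rewrite cnE.
rewrite -!ev1_suml -!ev1Nl -!ev1Dl; apply: eq_ev1 => e.
rewrite !rmorphB !rmorph_sum; congr (_ - _ - _ - _);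
  by apply: eq_bigr => f _; rewrite -rmorphM.
Qed.

Lemma der_ev1_r k S v : dB k (ev1 (fun a => r (S a)) v)
  = ev2 (fun c a => r (nab1 dA gA half S c a)) (J k) v + ev1 (fun a => r (S a)) (Dup k v).
Proof.
rewrite der_ev1; congr (_ + _).
by rewrite ev2E; apply: eq_ev1 => a; apply: Dlow_r.
Qed.

Definition Dlow2 k (T : 'I_m.+1 -> 'I_m.+1 -> B) a b : B :=
  dB k (T a b) - \sum_e cn k e a * T e b - \sum_e cn k e b * T a e.

Lemma der_ev2 k T v w : dB k (ev2 T v w)
  = ev2 (Dlow2 k T) v w + ev2 T (Dup k v) w + ev2 T v (Dup k w).
Proof.
rewrite {1}/ev2 der_ev1 [RHS]addrAC; congr (_ + _).
rewrite /ev2 -ev1Dl; apply: eq_ev1 => a.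
rewrite /Dlow der_ev1 addrAC; congr (_ + _).
rewrite -(eq_bigr _ (fun e _ => ev1Zl _ _ _)) -ev1_suml -ev1Nl -ev1Dl.
by apply: eq_ev1 => b; rewrite /Dlow /Dlow2 addrAC.
Qed.

Lemma der_ev2_r k T v w : dB k (ev2 (fun a b => r (T a b)) v w)
  = ev3 (fun c a b => r (nab2 dA gA half T c a b)) (J k) v w
    + ev2 (fun a b => r (T a b)) (Dup k v) w + ev2 (fun a b => r (T a b)) v (Dup k w).
Proof.
rewrite der_ev2 ev3E; congr (_ + _ + _).
by apply: eq_ev2 => a b; rewrite /Dlow2 r_nab2.
Qed.

Lemma der_ev3_r k X u v w : dB k (ev3 (fun c a b => r (X c a b)) u v w)
  = ev4 (fun e c a b => r (nab3 dA gA half X e c a b)) (J k) u v w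
    + ev3 (fun c a b => r (X c a b)) (Dup k u) v w
    + ev3 (fun c a b => r (X c a b)) u (Dup k v) w
    + ev3 (fun c a b => r (X c a b)) u v (Dup k w).
Proof.
have e0 c : Dlow k (fun c => ev2 (fun a b => r (X c a b)) v w) c
  = ev2 (fun a b => ev1 (fun e => r (nab3 dA gA half X e c a b)) (J k)) v w
    + ev2 (fun a b => r (X c a b)) (Dup k v) w + ev2 (fun a b => r (X c a b)) v (Dup k w).
  rewrite /Dlow der_ev2 addrAC; congr (_ + _); rewrite addrAC; congr (_ + _).
  rewrite -(eq_bigr _ (fun e _ => ev2Z _ _ _ _)) -ev1_suml -ev1Nl -ev1Dl.
  apply: eq_ev1 => a; rewrite -ev1_suml -ev1Nl -ev1Dl; apply: eq_ev1 => b.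
  by rewrite -r_nab3 /Dlow2; ring.
by rewrite {1}/ev3 der_ev1 (eq_ev1 _ e0) !ev1Dl ev4E /ev3; ring.
Qed.

Local Notation chB := (chr dB gB (r half)).

Definition sff k i : B := ev1 (Dlow k na) (J i).

(** Torsion freeness: the second derivatives of F and the Christoffel symbols are both symmetric. *)
Lemma DupC k i a : Dup k (J i) a = Dup i (J k) a.
Proof.
rewrite /Dup JC; congr (_ + _); rewrite /cn.
under eq_bigr do rewrite mulr_suml; rewrite exchange_big /=.
under [RHS]eq_bigr do rewrite mulr_suml.
apply: eq_bigr => c _; apply: eq_bigr => e _.
by rewrite chrC; ring.
Qed.

Lemma der_rg k v w : dB k (ev2 rg v w) = ev2 rg (Dup k v) w + ev2 rg v (Dup k w).
Proof.
rewrite (der_ev2_r k gA) -[RHS]add0r addrA; congr (_ + _ + _).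
rewrite ev3E /ev2 /ev1 big1 // => a _; rewrite big1 ?mulr0 // => b _.
by rewrite big1 ?mulr0 // => c _; rewrite nab2_low // rmorph0 mulr0.
Qed.

Lemma sffE k i : sff k i = - ev1 na (Dup k (J i)).
Proof.
have := der_ev1 k na (J i); rewrite naJ der0 => /esym/eqP.
by rewrite addr_eq0 => /eqP.
Qed.

Lemma sffC k i : sff k i = sff i k.
Proof. by rewrite !sffE; congr (- _); apply: eq_ev1r => a; rewrite DupC. Qed.

(** Koszul's formula: the tangential part of the ambient derivative satisfies the relations that
    characterize the Levi-Civita connection of the induced metric. *)
Lemma chr_induced k i j : ev2 rg (Dup k (J i)) (J j) = \sum_l gB j l * chB l k i.
Proof.
have L p q s : dB p (gB q s) = ev2 rg (Dup p (J q)) (J s) + ev2 rg (Dup p (J s)) (J q).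
  by rewrite gBE der_rg (rgC (J q)).
have sw p q s : ev2 rg (Dup p (J q)) (J s) = ev2 rg (Dup q (J p)) (J s).
  by apply: eq_ev2r => // a; rewrite DupC.
rewrite chr_low.
rewrite !L (sw i k j) (sw j i k) (sw k j i) (sw j k i).
rewrite -[LHS]mul1r -rhalfP; ring.
Qed.

(* Gauss' formula *)
Lemma Dup_tangent k i a :
  Dup k (J i) a = \sum_l chB l k i * J l a - sff k i * nu a.
Proof.
rewrite vec_split sffE mulNr opprK; congr (_ + _); apply: eq_bigr => l _.
by under eq_bigr do rewrite chr_induced; rewrite (raise_lower gB (fun l => chB l k i)).
Qed.

Definition shape k p : B := \sum_q upp gB p q * sff k q.

(* Weingarten's formula *)
Lemma Dup_normal k a : Dup k nu a = \sum_p shape k p * J p a.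
Proof.
have half_eq0B (x : B) : x + x = 0 -> x = 0 by apply: half_eq0 rhalfP x.
rewrite vec_split.
have -> : ev1 na (Dup k nu) = 0.
  apply: half_eq0B; rewrite -{1}rg_nu -rg_nu.
  by have := der_rg k nu nu; rewrite rg_nu nann der1 (rgC nu) => /esym.
rewrite mul0r addr0; apply: eq_bigr => i _; congr (_ * _); apply: eq_bigr => j _.
congr (_ * _); rewrite sffE.
have := der_rg k nu (J j); rewrite rgC rg_nu naJ der0 (rgC nu) rg_nu => /esym/eqP.
by rewrite addr_eq0 => /eqP.
Qed.

Lemma Dup_lin p v q (c : 'I_q -> B) V x w a :
  (forall b, v b = \sum_t c t * V t b - x * w b) ->
  Dup p v a = \sum_t (dB p (c t) * V t a + c t * Dup p (V t) a)
    - (dB p x * w a + x * Dup p w a).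
Proof.
move=> e; rewrite /Dup e derB der_sum derM.
under [X in _ + X = _]eq_bigr do rewrite e mulrBr mulr_sumr.
rewrite sumrB exchange_big /=.
have -> : \sum_t (dB p (c t) * V t a + c t * (dB p (V t a) + \sum_b cn p a b * V t b))
    = \sum_t dB p (c t * V t a) + \sum_t \sum_b cn p a b * (c t * V t b).
  rewrite -big_split; apply: eq_bigr => t _ /=; rewrite derM mulrDr mulr_sumr addrA.
  by congr (_ + _); apply: eq_bigr => b _; rewrite mulrCA.
have -> : \sum_b cn p a b * (x * w b) = x * \sum_b cn p a b * w b.
  by rewrite mulr_sumr; apply: eq_bigr => b _; rewrite mulrCA.
ring.
Qed.

Lemma ev1_Dup_tangent S k i : ev1 S (Dup k (J i))
  = \sum_l chB l k i * ev1 S (J l) - sff k i * ev1 S nu.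
Proof.
rewrite (eq_ev1r _ (Dup_tangent k i)) ev1Dr ev1Nr ev1Zr ev1_sumr.
by congr (_ - _); apply: eq_bigr => l _; rewrite ev1Zr.
Qed.

Lemma ev1_Dup_normal S k : ev1 S (Dup k nu) = \sum_p shape k p * ev1 S (J p).
Proof.
rewrite (eq_ev1r _ (Dup_normal k)) ev1_sumr.
by apply: eq_bigr => l _; rewrite ev1Zr.
Qed.

Let ev2r T v k i : ev2 T v (Dup k (J i))
  = \sum_l chB l k i * ev2 T v (J l) - sff k i * ev2 T v nu.
Proof.
by rewrite !ev2E ev1_Dup_tangent; under [in RHS]eq_bigr do rewrite ev2E.
Qed.

(** By Gauss' formula each slot adds, to the pulled-back derivative, the second fundamental form
    times the component with the normal in that slot. *)
Lemma nab2_pull T k i j :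
  nab2 dB gB (r half) (fun i j => ev2 (fun a b => r (T a b)) (J i) (J j)) k i j
  = ev3 (fun c a b => r (nab2 dA gA half T c a b)) (J k) (J i) (J j)
    - sff k i * ev2 (fun a b => r (T a b)) nu (J j)
    - sff k j * ev2 (fun a b => r (T a b)) (J i) nu.
Proof.
rewrite /nab2 der_ev2_r ev2r /ev2.
by rewrite (ev1_Dup_tangent (fun a => ev1 (fun b => r (T a b)) (J j))); ring.
Qed.

Lemma nab3_pull X l k i j :
  nab3 dB gB (r half)
    (fun k i j => ev3 (fun c a b => r (X c a b)) (J k) (J i) (J j)) l k i j
  = ev4 (fun e c a b => r (nab3 dA gA half X e c a b)) (J l) (J k) (J i) (J j)
    - sff l k * ev3 (fun c a b => r (X c a b)) nu (J i) (J j)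
    - sff l i * ev3 (fun c a b => r (X c a b)) (J k) nu (J j)
    - sff l j * ev3 (fun c a b => r (X c a b)) (J k) (J i) nu.
Proof.
rewrite /nab3 der_ev3_r.
have -> : ev3 (fun c a b => r (X c a b)) (Dup l (J k)) (J i) (J j)
    = \sum_p chB p l k * ev3 (fun c a b => r (X c a b)) (J p) (J i) (J j)
      - sff l k * ev3 (fun c a b => r (X c a b)) nu (J i) (J j).
  exact: ev1_Dup_tangent.
have -> : ev3 (fun c a b => r (X c a b)) (J k) (Dup l (J i)) (J j)
    = \sum_p chB p l i * ev3 (fun c a b => r (X c a b)) (J k) (J p) (J j)
      - sff l i * ev3 (fun c a b => r (X c a b)) (J k) nu (J j).
  rewrite !ev3E {1}/ev2 ev1_Dup_tangent; congr (_ - _).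
  by apply: eq_bigr => p _; rewrite ev3E.
rewrite !(ev3E _ (J k) (J i)) ev2r.
under [X in _ - _ - _ - X = _]eq_bigr do rewrite ev3E.
ring.
Qed.

(** The curvature of the pulled-back connection is the pulled-back curvature; the second derivatives
    of F cancel by [JC]. *)
Lemma Dup_comm k l v a : Dup k (Dup l v) a - Dup l (Dup k v) a =
  \sum_e (ev2 (fun b c => r (riem dA gA half b c a e)) (J k) (J l)) * v e.
Proof.
have e p q : Dup p (Dup q v) a = dB p (dB q (v a))
    + (\sum_e dB p (cn q a e) * v e + \sum_e cn q a e * dB p (v e)
    + \sum_e cn p a e * dB q (v e) + \sum_f (\sum_e cn p a e * cn q e f) * v f).
  rewrite -contr_assoc /Dup derD der_sum -!addrA; congr (_ + _).
  rewrite -!big_split; apply: eq_bigr => f _ /=.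
  by rewrite derM; ring.
rewrite !e derC.
have k0 e' : ev2 (fun b c => r (riem dA gA half b c a e')) (J k) (J l)
    = dB k (cn l a e') - dB l (cn k a e')
      + \sum_f cn k a f * cn l f e' - \sum_f cn l a f * cn k f e'.
  have d1 p q : dB p (cn q a e') = \sum_c dB p (J q c) * r (chr dA gA half a c e')
      + ev2 (fun b c => r (dA b (chr dA gA half a c e'))) (J p) (J q).
    rewrite ev2E der_sum -big_split; apply: eq_bigr => c _ /=.
    by rewrite derM der_rE.
  have d2 p q : \sum_f cn p a f * cn q f e'
      = ev2 (fun b c => \sum_f r (chr dA gA half a b f) * r (chr dA gA half f c e'))
          (J p) (J q).
    have -> : ev2 (fun b c => \sum_f r (chr dA gA half a b f) * r (chr dA gA half f c e'))
       (J p) (J q) = \sum_f ev2 (fun b c => r (chr dA gA half a b f)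
          * r (chr dA gA half f c e')) (J p) (J q).
      by rewrite /ev2 -ev1_suml; apply: eq_ev1 => b; rewrite ev1_suml.
    by apply: eq_bigr => f _; rewrite ev2M.
  rewrite !d1 !d2 (ev2_tr _ (J l) (J k)) [X in _ - X]ev2_tr.
  under [X in _ - (X + _)]eq_bigr do rewrite JC.
  rewrite opprD addrACA addrN add0r -!ev2N -!ev2D; apply: eq_ev2 => b c.
  rewrite /riem rmorphD rmorphB rmorph_sum -[RHS]addrA -sumrB; congr (_ + _).
  apply: eq_bigr => f _.
  by rewrite rmorphB !rmorphM.
under [RHS]eq_bigr do rewrite k0.
rewrite -[RHS](eq_bigr _ (fun e _ => erefl)).
have -> : \sum_e0 (dB k (cn l a e0) - dB l (cn k a e0)
      + \sum_f cn k a f * cn l f e0 - \sum_f cn l a f * cn k f e0) * v e0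
   = \sum_e0 dB k (cn l a e0) * v e0 - \sum_e0 dB l (cn k a e0) * v e0
     + \sum_e0 (\sum_f cn k a f * cn l f e0) * v e0
     - \sum_e0 (\sum_f cn l a f * cn k f e0) * v e0.
  by rewrite -!sumrN -!big_split; apply: eq_bigr => f _ /=; ring.
ring.
Qed.

(** Pairing with [J j] removes the normal part, and the induced metric is invertible. *)
Lemma tangent_free (x : 'I_m -> B) y :
  (forall a, \sum_p x p * J p a + y * nu a = 0) -> forall p, x p = 0.
Proof.
move=> z; suff e : x =1 (fun=> 0) by [].
apply: (low_inj (g := gB)) => j.
have : ev2 rg (fun a => \sum_p x p * J p a + y * nu a) (J j) = 0.
  by rewrite (eq_ev2r (v' := fun=> 0) _ _ (frefl (J j))) // ev2E /ev1 big1 // => a _;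
     rewrite big1 ?mulr0 // => b _; rewrite mul0r.
rewrite rgC ev2E ev1Dr ev1_sumr ev1Zr -ev2E rg_nu naJ mulr0 addr0 => e.
rewrite [RHS]big1 => [|p _]; last by rewrite mulr0.
by rewrite -[RHS]e; apply: eq_bigr => p _; rewrite ev1Zr gBE mulrC ev2E.
Qed.

(** Gauss' equation: in a flat space the derivatives of [J i] along F commute, and their tangential
    part is read off from the Gauss and Weingarten formulas. *)
Lemma riem_induced k l q i : (forall a b c e, riem dA gA half a b c e = 0) ->
  riem dB gB (r half) k l q i = sff l i * shape k q - sff k i * shape l q.
Proof.
move=> flat; apply/eqP; rewrite -subr_eq0; apply/eqP; move: q.
(* The normal component of the identity, a Codazzi expression; [tangent_free] reads off the
   tangential one. *)
pose y : B := \sum_p (chB p k i * sff l p) - \sum_p (chB p l i * sff k p)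
    - dB k (sff l i) + dB l (sff k i).
apply: (tangent_free (y := y)) => a.
have dd p q : Dup p (Dup q (J i)) a
    = \sum_s (dB p (chB s q i) + \sum_t chB s p t * chB t q i - sff q i * shape p s) * J s a
      - (\sum_t chB t q i * sff p t + dB p (sff q i)) * nu a.
  rewrite (Dup_lin _ _ (Dup_tangent q i)) Dup_normal.
  under eq_bigr do rewrite Dup_tangent mulrBr.
  rewrite big_split sumrB /=.
  have -> : \sum_t chB t q i * (\sum_l chB l p t * J l a)
      = \sum_l (\sum_t chB l p t * chB t q i) * J l a.
    rewrite contr_assoc; apply: eq_bigr => s _; congr (_ * _).
    by apply: eq_bigr => t _; rewrite mulrC.
  under [X in _ + (_ - X)]eq_bigr do rewrite mulrA; rewrite -mulr_suml.
  have -> : \sum_s (dB p (chB s q i) + \sum_t chB s p t * chB t q i - sff q i * shape p s)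
        * J s a = \sum_s dB p (chB s q i) * J s a
        + \sum_s (\sum_t chB s p t * chB t q i) * J s a
        - sff q i * \sum_s shape p s * J s a.
    by rewrite mulr_sumr -!sumrN -!big_split; apply: eq_bigr => t _ /=; ring.
  ring.
have := Dup_comm k l (J i) a.
rewrite big1 => [|e _]; last first.
  rewrite /ev2 /ev1 big1 ?mul0r // => b _.
  by rewrite big1 ?mulr0 // => c _; rewrite flat rmorph0 mulr0.
rewrite !dd => e0; rewrite -[RHS]e0 /y.
have -> : \sum_q (riem dB gB (r half) k l q i - (sff l i * shape k q - sff k i * shape l q))
    * J q a = \sum_s (dB k (chB s l i) + \sum_t chB s k t * chB t l i - sff l i * shape k s) * J s a
    - \sum_s (dB l (chB s k i) + \sum_t chB s l t * chB t k i - sff k i * shape l s) * J s a.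
  by rewrite -sumrB; apply: eq_bigr => t _; rewrite /riem sumrB; ring.
ring.
Qed.

(** * The singular Yamabe equation along the hypersurface *)

(* The ambient dimension is q.+3 in the applications. *)
Variables (s rho Jsc Bd : A) (q : nat).
Hypothesis s0 : r s = 0.
Hypothesis naN : forall a, na a = r (dA a s).
Hypothesis rhoE : m.+1%:R * rho = - (lap dA gA half s + Jsc * s).
Hypothesis IsqE : dot gA (dA^~ s) (dA^~ s) + (s * rho) *+ 2 = 1 + s ^+ q.+3 * Bd.

Local Notation N := (dA^~ s).
Local Notation Hs := (nab1 dA gA half N).
Local Notation E := (hess0 dA gA half s rho).
Local Notation X := (nab_hess0 dA gA half s rho).
Local Notation Z := (nab3 dA gA half X).
Local Notation R2 := (nab1 dA gA half (dA^~ rho)).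
Local Notation rHs := (fun a b => r (Hs a b)).
Local Notation rE := (fun a b => r (E a b)).
Local Notation rX := (fun c a b => r (X c a b)).
Local Notation rZ := (fun e c a b => r (Z e c a b)).
Local Notation rR1 := (fun a => r (dA a rho)).
Local Notation rR2 := (fun a b => r (R2 a b)).

Lemma nuE b : nu b = \sum_a r (upp gA b a) * na a.
Proof.
under eq_bigr do rewrite naE.
rewrite contr_assoc -[LHS](sum_delta nu b); apply: eq_bigr => c _; congr (_ * _).
rewrite -(rmorph_nat r (b == c)) -(uppK gA) rmorph_sum.
by apply: eq_bigr => a _; rewrite rmorphM.
Qed.

Lemma r_dotN T : r (dot gA N T) = ev1 (fun a => r (T a)) nu.
Proof.
rewrite dotC rmorph_sum /ev1; apply: eq_bigr => a _.
rewrite rmorph_sum nuE mulr_suml; apply: eq_bigr => b _.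
by rewrite !rmorphM naN; ring.
Qed.

Lemma r_normN : r (dot gA N N) = 1.
Proof. by rewrite r_dotN -nann; apply: eq_bigr => a _; rewrite naN. Qed.

(** In [hess0_N] the derivative of Q still carries a factor s^(q + 2). *)
Lemma hess0_nu b : ev1 (fun c => rE c b) nu = 0.
Proof.
rewrite -r_dotN (hess0_N halfP IsqE) rmorphB derM der_exp.
by rewrite [s ^+ q.+2]exprS [s ^+ q.+3]exprS !(rmorphM, rmorphD) s0 !(mul0r, mulr0, addr0, subr0).
Qed.

Lemma hess0_nul w : ev2 rE nu w = 0.
Proof. by rewrite ev2E /ev1 big1 // => b _; rewrite [X in _ * X]hess0_nu mulr0. Qed.

Lemma hess0_nur v : ev2 rE v nu = 0.
Proof.
rewrite ev2_tr -[RHS](hess0_nul v); apply: eq_ev2 => a b.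
by rewrite hess0C.
Qed.

Lemma hessE v w : ev2 rHs v w = ev2 rE v w - r rho * ev2 rg v w.
Proof.
rewrite -ev2Z -ev2N -ev2D; apply: eq_ev2 => a b.
by rewrite -rmorphM -rmorphB addrK.
Qed.

Lemma hess_nur v : ev2 rHs v nu = - r rho * ev1 na v.
Proof. by rewrite hessE hess0_nur rg_nu sub0r mulNr. Qed.

Lemma hess_nul v : ev2 rHs nu v = - r rho * ev1 na v.
Proof. by rewrite hessE hess0_nul rgC rg_nu sub0r mulNr. Qed.

Lemma sff_hess i j : sff i j = ev2 rHs (J i) (J j).
Proof.
rewrite ev2E; apply: eq_ev1 => a; rewrite -Dlow_r /Dlow naN; congr (_ - _).
by apply: eq_bigr => e _; rewrite naN.
Qed.

Definition sff0 i j : B := ev2 rE (J i) (J j).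

Lemma sff0E i j : sff0 i j = sff i j + r rho * gB i j.
Proof. by rewrite sff_hess hessE -gBE addrNK. Qed.

Lemma sff0C i j : sff0 i j = sff0 j i.
Proof. by rewrite !sff0E sffC lowC. Qed.

(** On the hypersurface Delta s = -(m + 1) rho, of which the normal-normal component of the Hessian
    takes -rho. *)
Lemma tr_sff : ctr gB sff = - (m%:R * r rho).
Proof.
have : r (ctr gA Hs) = ctr gB sff - r rho.
  rewrite r_ctr ctrr_split hess_nur nann mulr1; congr (_ + _).
  by apply: eq_ctr => i j; rewrite sff_hess.
have -> : ctr gA Hs = - (m.+1%:R * rho) - Jsc * s by rewrite rhoE /lap; ring.
rewrite rmorphB rmorphN !rmorphM s0 mulr0 subr0 rmorph_nat -natr1.
by move=> e; rewrite -[LHS](subrK (r rho)) -e; ring.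
Qed.

Definition hess_sff v w : B :=
  ctr gB (fun i j => ev2 rHs v (J i) * ev2 rE (J j) w).

Lemma r_dot_hess v w :
  ev2 (fun a b => r (dot gA (Hs a) (fun c => E c b))) v w = hess_sff v w.
Proof.
rewrite (eq_ev2 _ _ (T' := fun a b => dotr (rHs a) (rE^~ b))) => [|a b]; last exact: r_dot.
rewrite (ev2_dotr rHs (fun a b => rE b a)) dotr_split [X in _ + _ * X](hess0_nul w) mulr0 addr0.
by apply: eq_ctr => i j; rewrite -ev2E.
Qed.

(** [nab_hess0_N] at s = 0, where the second derivatives of Q vanish because Q has order at least
    three in s. *)
Lemma nab_hess0_nu v w :
  hess_sff v w + ev3 rX v nu w = - (ev1 na v * ev1 rR1 w).
Proof.
rewrite -r_dot_hess.
have -> : ev3 rX v nu w = ev2 (fun a b => ev1 (fun c => rX a c b) nu) v w.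
  by apply: eq_ev1 => a; rewrite ev2E.
rewrite -ev2D -ev2M -ev2N; apply: eq_ev2 => a b.
rewrite -r_dotN -rmorphD (nab_hess0_N halfP IsqE) nab1_grad_exp exprS -mulrA.
rewrite !(rmorphB, rmorphM) s0 !mul0r subr0 sub0r naN.
by [].
Qed.

(** The product of II and II0 as endomorphisms, x^2 - rho x in terms of the endomorphism x of
    II0. *)
Definition sffh k j : B := ctr gB (fun i l => sff k i * sff0 l j).

(** In the names of the components of X = nabla E and Z = nabla nabla E, t marks a tangential
    argument, n a normal one and v an arbitrary one. *)
Lemma X_tnt k j : ev3 rX (J k) nu (J j) = - sffh k j.
Proof.
have := nab_hess0_nu (J k) (J j); rewrite naJ mul0r oppr0 => /eqP.
rewrite addrC addr_eq0 => /eqP ->; congr (- _).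
by apply: eq_ctr => i l; rewrite sff_hess.
Qed.

Lemma X_nnv v : ev3 rX nu nu v = - ev1 rR1 v.
Proof.
have := nab_hess0_nu nu v; rewrite nann mul1r => <-.
rewrite /hess_sff -[LHS]add0r; congr (_ + _); rewrite -[LHS](ctr0 gB).
by apply: eq_ctr => i j; rewrite hess_nul naJ mulr0 mul0r.
Qed.

Lemma X_tnn k : ev3 rX (J k) nu nu = 0.
Proof.
have := nab_hess0_nu (J k) nu; rewrite naJ mul0r oppr0 => <-.
rewrite /hess_sff -[LHS]add0r; congr (_ + _); rewrite -[LHS](ctr0 gB).
by apply: eq_ctr => i j; rewrite hess0_nur mulr0.
Qed.

Lemma XC u v w : ev3 rX u v w = ev3 rX u w v.
Proof.
by apply: eq_ev1 => c; rewrite ev2_tr; apply: eq_ev2 => a b; rewrite nab_hess0C.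
Qed.

Lemma X_ttn k j : ev3 rX (J k) (J j) nu = - sffh k j.
Proof. by rewrite XC X_tnt. Qed.

Local Notation hB := (nab2 dB gB (r half) sff0).

(** The corrections of [nab2_pull] vanish because E has no normal components. *)
Lemma nab_sff0 k i j : hB k i j = ev3 rX (J k) (J i) (J j).
Proof. by rewrite nab2_pull hess0_nul hess0_nur !mulr0 !subr0. Qed.

Lemma nab2_sff0 l k i j : nab3 dB gB (r half) hB l k i j
  = ev4 rZ (J l) (J k) (J i) (J j) - sff l k * ev3 rX nu (J i) (J j)
    + sff l i * sffh k j + sff l j * sffh k i.
Proof.
rewrite (eq_nab3 _ _ _ _ _ _ _ nab_sff0) nab3_pull X_tnt X_ttn.
by ring.
Qed.

(** Derivative of [X_nnv] along the hypersurface, Weingarten's formula being applied to both normal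
    arguments. *)
Lemma Z_tnnt i j : ev4 rZ (J i) nu nu (J j) = - ev2 rR2 (J i) (J j)
  + \sum_p shape i p * sffh p j - \sum_p shape i p * ev3 rX nu (J p) (J j).
Proof.
have := der_ev3_r i X nu nu (J j).
rewrite !X_nnv derN der_ev1_r.
have -> : ev3 rX (Dup i nu) nu (J j) = - \sum_p shape i p * sffh p j.
  rewrite [LHS]ev1_Dup_normal -sumrN; apply: eq_bigr => p _.
  by rewrite [X in _ * X]X_tnt mulrN.
have -> : ev3 rX nu (Dup i nu) (J j) = \sum_p shape i p * ev3 rX nu (J p) (J j).
  rewrite ev3E [LHS]ev1_Dup_normal; apply: eq_bigr => p _.
  by rewrite ev3E.
move/eqP; rewrite -subr_eq0 => /eqP e.
by apply/eqP; rewrite -subr_eq0 -oppr_eq0 -[X in _ == X]e; apply/eqP; ring.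
Qed.

Local Notation rhon := (ev1 rR1 nu).

(** Each slot of nabla E is split into tangential and normal parts. By symmetry in the last two
    slots mixed components count twice, and those with a tangential derivative and two normal slots
    vanish. *)
Lemma normX_split : r (ctr gA (fun e c => dot2 gA (X e) (X c)))
  = ctr gB (fun k l => dot2 gB (hB k) (hB l)) + dot2 gB sffh sffh *+ 2
    + dot2 gB (fun i j => ev3 rX nu (J i) (J j)) (fun i j => ev3 rX nu (J i) (J j))
    + dot gB (fun i => ev1 rR1 (J i)) (fun i => ev1 rR1 (J i)) *+ 2 + rhon ^+ 2.
Proof.
have e v w : ev2 (fun a b => r (dot2 gA (X a) (X b))) v w
    = dot2 gB (fun i j => ev3 rX v (J i) (J j)) (fun i j => ev3 rX w (J i) (J j))
    + dot gB (fun i => ev3 rX v (J i) nu) (fun i => ev3 rX w (J i) nu) *+ 2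
    + ev3 rX v nu nu * ev3 rX w nu nu.
  rewrite (eq_ev2 _ _ (fun a b => r_dot2 _ _)).
  rewrite (ev2_dot2r rX rX) dot2r_split -!ev3E.
  have k u u' : dot gB (fun i => ev2 (fun a b => ev1 (fun c => r (X c a b)) u) nu (J i))
      (fun i => ev2 (fun a b => ev1 (fun c => r (X c a b)) u') nu (J i))
      = dot gB (fun i => ev3 rX u (J i) nu) (fun i => ev3 rX u' (J i) nu).
    by apply: eq_dot => i; rewrite -ev3E XC.
  rewrite k mulr2n addrA; congr (_ + _ + _ + _).
    by apply: eq_dot2 => i j; rewrite ev3E.
  by apply: eq_dot => i; rewrite ev3E.
have -> : dot gB (fun i => ev1 rR1 (J i)) (fun i => ev1 rR1 (J i))
    = dot gB (fun i => ev3 rX nu (J i) nu) (fun i => ev3 rX nu (J i) nu).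
  rewrite -[LHS]opprK -dotNl -dotNr.
  by apply: eq_dot => i; rewrite XC X_nnv.
rewrite r_ctr ctrr_split e X_nnv (eq_ctr _ (fun i j => e _ _)) ctrDE.
have -> : ctr gB (fun a b => ev3 rX (J a) nu nu * ev3 rX (J b) nu nu) = 0.
  by rewrite -[RHS](ctr0 gB); apply: eq_ctr => a b; rewrite X_tnn mul0r.
rewrite ctrDE.
have -> : ctr gB (fun k l => dot2 gB (hB k) (hB l))
    = ctr gB (fun k l => dot2 gB (fun i j => ev3 rX (J k) (J i) (J j))
                                 (fun i j => ev3 rX (J l) (J i) (J j))).
  by apply: eq_ctr => k l; apply: eq_dot2 => i j; rewrite nab_sff0.
have -> : ctr gB (fun a b => dot gB (fun i => ev3 rX (J a) (J i) nu)
      (fun i => ev3 rX (J b) (J i) nu) *+ 2) = dot2 gB sffh sffh *+ 2.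
  rewrite [RHS]mulr2n -ctrDE; apply: eq_ctr => k l.
  rewrite mulr2n; congr (_ + _); rewrite -[RHS]opprK -dotNl -dotNr;
    by apply: eq_dot => i; rewrite X_ttn.
ring.
Qed.

(** [lap_defect] at s = 0, where Delta Q vanishes to order q + 1. This is the relation that
    determines the normal derivative of rho. *)
Lemma defect_on_hypersurface :
  dot2 gB sff0 sff0 + (1 - m%:R) * rhon + ev1 (fun b => r (kap dA gA half s Jsc b)) nu = 0.
Proof.
have cE : r (2 - m.+1%:R) = 1 - m%:R.
  by rewrite rmorphB !rmorph_nat -[m.+1]add1n natrD; ring.
have := congr1 r (lap_defect halfP rhoE IsqE).
move: (2 - m.+1%:R) cE => c cE.
rewrite lap_exp exprS -mulrA !(rmorphM, rmorphD) s0 !(mul0r, mulr0) addr0 cE.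
rewrite !r_dotN r_dot2 dot2r_split hess0_nul mul0r addr0.
have z T T' : (forall i, T i = 0) -> dot gB T T' = 0.
  by move=> t; rewrite /dot -[RHS](ctr0 gB); apply: eq_ctr => i j; rewrite t mul0r.
rewrite !z => [||i]; [|by move=> i; exact: hess0_nul|exact: hess0_nur].
by rewrite !addr0 => ->.
Qed.

(** The contracted Codazzi equation: the tangential trace is the ambient divergence of E less the
    component [X_nnv], which changes 1 - n into 1 - m. *)
Lemma div_sff0 i : ctr gB (fun b c => hB c i b)
  = (1 - m%:R) * ev1 rR1 (J i) + ev1 (fun b => r (kap dA gA half s Jsc b)) (J i).
Proof.
have e : ev1 (fun b => r (ctr gA (fun c a => X c a b))) (J i)
    = ctr gB (fun b c => hB c i b) - ev1 rR1 (J i).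
  rewrite (eq_ev1 _ (fun b => r_ctr _)) ev1_ctrr ctrr_split; congr (_ + _).
    by rewrite -[LHS]ctr_tr; apply: eq_ctr => b c; rewrite nab_sff0 XC.
  exact: X_nnv.
rewrite -[LHS](subrK (ev1 rR1 (J i))) -e.
have -> : ev1 (fun b => r (ctr gA (fun c a => X c a b))) (J i)
    = (1 - m.+1%:R) * ev1 rR1 (J i) + ev1 (fun b => r (kap dA gA half s Jsc b)) (J i).
  rewrite -ev1Zl -ev1Dl; apply: eq_ev1 => b.
  by rewrite (div_hess0 halfP rhoE) rmorphD rmorphM rmorphB rmorph1 rmorph_nat.
by rewrite -natr1; ring.
Qed.

Local Notation x := (endo gB sff0).
Local Notation w := (endo gB sffh).

Lemma endo_sff : endo gB sff = x - (r rho)%:M.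
Proof.
rewrite -scalemx1 -(endo_low gB) -endoZ -endoN -endoD; apply: eq_endo => i j.
by rewrite sff0E addrK.
Qed.

Lemma shapeE k p : shape k p = endo gB sff k p.
Proof. by rewrite mxE; apply: eq_bigr => q' _; rewrite !mxE mulrC uppC. Qed.

Lemma endo_sffh : w = x *m x - r rho *: x.
Proof.
rewrite -mul_scalar_mx -mulmxBl -endo_sff -endo_comp; apply: eq_endo => k j.
rewrite /sffh /ctr exchange_big; apply: eq_bigr => l _ /=.
rewrite mxE mulr_suml; apply: eq_bigr => i _.
by rewrite !mxE; ring.
Qed.

(** II differs from II0 by a multiple of the metric, so that their product is a polynomial in
    II0. *)
Lemma sffhC i j : sffh i j = sffh j i.
Proof.
have e k l : sffh k l = ctr gB (fun i j => sff0 k i * sff0 j l) - r rho * sff0 k l.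
  rewrite -(dot_lowl gB k (sff0^~ l)) -dotZl -ctrB.
  by apply: eq_ctr => a b; rewrite (sff0E k a); ring.
rewrite !e (sff0C i j) -ctr_tr; congr (_ - _); apply: eq_ctr => a b.
by rewrite mulrC (sff0C a j) (sff0C i b).
Qed.

Lemma tr_x : \tr x = 0.
Proof.
rewrite -ctrE (eq_ctr _ sff0E) ctrDE ctrZ ctr_low tr_sff; ring.
Qed.

Lemma dot2_sff0 T : dot2 gB sff0 T = \tr (endo gB T *m x).
Proof. by rewrite dot2C dot2E //; exact: sff0C. Qed.

Lemma dot2_sff0_tr T : dot2 gB sff0 (fun i j => T j i) = dot2 gB sff0 T.
Proof.
rewrite -[RHS]dot2_tr; apply: eq_dot2 => // i j; exact: sff0C.
Qed.

(** * Flat ambient metric: the formula in dimension four *)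

Section FlatAmbient.
Hypothesis flat : forall a b c e, riem dA gA half a b c e = 0.
Hypothesis Jsc0 : Jsc = 0.

Let rhoE0 : m.+1%:R * rho = - lap dA gA half s.
Proof. by rewrite rhoE Jsc0 mul0r addr0. Qed.

(** The flat Codazzi identity exchanges the normal derivative with a tangential slot, where [X_tnt]
    applies. *)
Lemma X_ntt i j : ev3 rX nu (J i) (J j) = - sffh i j + rhon * gB i j.
Proof.
have e : ev3 rX nu (J i) (J j) = ev3 (fun c a b => r (X a c b)) nu (J i) (J j)
   + rhon * ev2 rg (J i) (J j) - ev1 rR1 (J i) * ev2 rg nu (J j).
  rewrite (eq_ev3 _ _ _ (X' := fun c a b => (r (X a c b) + r (dA c rho) * r (gA a b))
     - r (dA a rho) * r (gA c b))); last first.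
    by move=> c a b; rewrite (nab_hess0_codazzi halfP flat) !(rmorphB, rmorphD, rmorphM).
  rewrite ev3D ev3N ev3D (ev3M rR1 rg); congr (_ - _).
  by rewrite (ev3_swap (fun c a b => r (dA c rho) * r (gA a b))) (ev3M rR1 rg).
by rewrite e (ev3_swap rX) X_tnt (rgC nu) rg_nu naJ mulr0 subr0 gBE.
Qed.

(** The Codazzi identity moves the second normal into a slot; commuting derivatives then puts the
    tangential one first, the case of [Z_tnnt]. *)
Lemma Z_nntt i j : ev4 rZ nu nu (J i) (J j) = ev4 rZ (J i) nu nu (J j)
  + ev2 rR2 nu nu * gB i j.
Proof.
rewrite (eq_ev4 _ _ _ _ (Z' := fun e c a b => (r (Z e a c b) + r (R2 e c) * r (gA a b))
   - r (R2 e a) * r (gA c b))); last first.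
  by move=> e c a b; rewrite (Zcodazzi halfP flat) !(rmorphB, rmorphD, rmorphM).
rewrite ev4D ev4N ev4D ev4M (ev4_swap23 rZ) (ev4_swap23 (fun e c a b => r (R2 e c) * r (gA a b))).
rewrite ev4M (rgC nu (J j)) rg_nu naJ mulr0 subr0 -gBE; congr (_ + _).
rewrite -(ev4_swap rZ); apply: eq_ev4 => e c a b.
by rewrite (Zcomm flat).
Qed.

Lemma kap0 v : ev1 (fun b => r (kap dA gA half s Jsc b)) v = 0.
Proof.
rewrite -[RHS](ev1_0l v); apply: eq_ev1 => b.
by rewrite Jsc0 kap_flat // rmorph0.
Qed.

(** Trace of [nab2_sff0]: the tangential trace of Z is the ambient one, known from [lap_hess0], less
    its normal-normal part. *)
Lemma tr_nab2_sff0 i j : ctr gB (fun l k => nab3 dB gB (r half) hB l k i j)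
  = r (lap dA gA half rho) * gB i j - m.+1%:R * ev2 rR2 (J i) (J j)
    - ev4 rZ nu nu (J i) (J j) + m%:R * r rho * ev3 rX nu (J i) (J j)
    + \sum_k endo gB sff i k * sffh k j + \sum_k endo gB sff j k * sffh k i.
Proof.
have e : ev2 (fun a b => r (ctr gA (fun e c => Z e c a b))) (J i) (J j)
    = ctr gB (fun l k => ev4 rZ (J l) (J k) (J i) (J j)) + ev4 rZ nu nu (J i) (J j).
  by rewrite (eq_ev2 _ _ (fun a b => r_ctr _)) ev2_ctrr ctrr_split.
rewrite (eq_ctr _ (fun l k => nab2_sff0 l k i j)) 2!ctrDE ctrB.
have -> : ctr gB (fun l k => sff l k * ev3 rX nu (J i) (J j))
    = - (m%:R * r rho) * ev3 rX nu (J i) (J j).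
  by rewrite -tr_sff mulrC -ctrZ; apply: eq_ctr => l k; rewrite mulrC.
have k0 p q' : ctr gB (fun l k => sff l p * sffh k q') = \sum_k endo gB sff p k * sffh k q'.
  rewrite /ctr exchange_big; apply: eq_bigr => k _ /=.
  rewrite mxE mulr_suml; apply: eq_bigr => l _.
  by rewrite !mxE (sffC l p); ring.
rewrite !k0 -[ctr gB _](addrK (ev4 rZ nu nu (J i) (J j))) -e.
have -> : ev2 (fun a b => r (ctr gA (fun e c => Z e c a b))) (J i) (J j)
    = r (lap dA gA half rho) * gB i j - m.+1%:R * ev2 rR2 (J i) (J j).
  rewrite gBE -ev2Z -ev2Z -ev2N -ev2D; apply: eq_ev2 => a b.
  rewrite (lap_hess0 halfP flat rhoE0).
  have -> f h k l : r (f * h - k%:R * l) = r f * r h - k%:R * r l.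
    by rewrite rmorphB !rmorphM rmorph_nat.
  by [].
ring.
Qed.

(** Contraction with II0 kills the pure trace terms and leaves traces of powers of x. The result
    trades <II0, nabla d rho> for the intrinsic Laplacian of II0. *)
Lemma laplacian_sff0 : dot2 gB sff0 (fun i j => ctr gB (fun l k => nab3 dB gB (r half) hB l k i j))
  = - m%:R * dot2 gB sff0 (fun i j => ev2 rR2 (J i) (J j))
    + rhon * \tr (x *m x) + m%:R * r rho * (r rho * \tr (x *m x) - \tr (x *m x *m x)).
Proof.
have e i j : ctr gB (fun l k => nab3 dB gB (r half) hB l k i j)
  = r (lap dA gA half rho) * gB i j - m.+1%:R * ev2 rR2 (J i) (J j)
    - (- ev2 rR2 (J i) (J j) + \sum_p endo gB sff i p * sffh p j
       - \sum_p endo gB sff i p * (- sffh p j + rhon * gB p j) + ev2 rR2 nu nu * gB i j)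
    + m%:R * r rho * (- sffh i j + rhon * gB i j)
    + \sum_k endo gB sff i k * sffh k j + \sum_k endo gB sff j k * sffh k i.
  rewrite tr_nab2_sff0 Z_nntt Z_tnnt X_ntt.
  have -> : \sum_p shape i p * ev3 rX nu (J p) (J j)
      = \sum_p endo gB sff i p * (- sffh p j + rhon * gB p j).
    by apply: eq_bigr => p _; rewrite shapeE X_ntt.
  have -> // : \sum_p shape i p * sffh p j = \sum_p endo gB sff i p * sffh p j.
  by apply: eq_bigr => p _; rewrite shapeE.
rewrite (eq_dot2 _ (fun a b => erefl (sff0 a b)) e) dot2C dot2Dl !(dot2C _ _ sff0) dot2_sff0.
rewrite (dot2_sff0_tr (fun i j => \sum_k endo gB sff i k * sffh k j)) dot2_sff0.
rewrite [dot2 gB sff0 _ in RHS]dot2_sff0 !(endoD, endoN, endo_comp, endoZ) endo_low.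
rewrite endo_sff endo_sffh.
move: tr_x; move: x (endo gB (fun i j => ev2 rR2 (J i) (J j))) => y P y0.
have tD (M M' : 'M[B]_m) : \tr (M + M') = \tr M + \tr M' := raddfD _ M M'.
have tN (M : 'M[B]_m) : \tr (- M) = - \tr M := raddfN _ M.
have sL k (M M' : 'M[B]_m) : (k *: M) *m M' = k *: (M *m M') by rewrite scalemxAl.
have sR k (M M' : 'M[B]_m) : M *m (k *: M') = k *: (M *m M') by rewrite scalemxAr.
rewrite !(mulmxDl, mulmxDr, mulmxN, mulNmx, mul_scalar_mx, sL, sR, mulmx1, mul1mx,
  mulmxA, tD, tN, mxtraceZ) y0.
ring.
Qed.

(** Gauss' equation traced twice, (tr II)^2 - |II|^2, with II = II0 - rho g. *)
Lemma scal_induced :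
  scal dB gB (r half) = (m%:R * r rho) ^+ 2 - m%:R * r rho ^+ 2 - \tr (x *m x).
Proof.
have e l i : ric dB gB (r half) l i
    = \tr (endo gB sff) * sff l i - \sum_k endo gB sff l k * sff k i.
  rewrite /ric mulr_suml -sumrB; apply: eq_bigr => k _.
  by rewrite riem_induced // !shapeE; ring.
rewrite /scal ctrE (eq_endo _ e) endoD endoN endoZ endo_comp endo_sff.
have tD (M M' : 'M[B]_m) : \tr (M + M') = \tr M + \tr M' := raddfD _ M M'.
have tN (M : 'M[B]_m) : \tr (- M) = - \tr M := raddfN _ M.
move: tr_x; move: x => y y0.
rewrite !(mulmxBl, mulmxBr, mul_scalar_mx, mul_mx_scalar, tD, tN, mxtraceZ).
rewrite !(mxtrace_scalar, mxtraceZ, y0) -mulr_natl; ring.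
Qed.

(** Delta (s^4 B / 2) = s^2 (6 B |ds|^2 + O(s)), and Delta (s^2 C) = 2 C at s = 0 since |ds| = 1
    there: this is the factor 12. *)
Lemma r_lap_lap_defect : q = 1%N -> m%:R = 3%:R :> A ->
  12%:R * r Bd = r (ctr gA (fun e c => dot2 gA (X e) (X c)) *+ 2
    - 12%:R * dot2 gA E R2 + 8%:R * dot gA (dA^~ rho) (dA^~ rho)).
Proof.
move=> q1 m3; have n4 : m.+1%:R = 4%:R :> A by rewrite -natr1 m3 natr1.
have := lap_lap_defect halfP flat rhoE0 n4.
have -> : dot2 gA E E - 2%:R * dot gA N (dA^~ rho) + s * lap dA gA half rho
    = lap dA gA half (s ^+ q.+3 * (half * Bd)).
  rewrite (lap_defect halfP rhoE IsqE) n4 Jsc0.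
  have -> : dot gA N (kap dA gA half s 0) = 0.
    by rewrite dotC /dot -[RHS](ctr0 gA); apply: eq_ctr => a b; rewrite kap_flat // mul0r.
  ring.
have rs a u : r (a + s * u) = r a by rewrite rmorphD rmorphM s0 mul0r addr0.
move/(congr1 r); rewrite q1 (lap_exp _ _ _ s _ 2) (lap_exp _ _ _ s _ 0) expr0 mul1r !rs => <-.
rewrite [r (_ * _ * dot _ _ _)]rmorphM r_normN mulr1 [r (_ * (_ + _))]rmorphM rs.
rewrite [r (_ * _ * dot _ _ _)]rmorphM r_normN mulr1 -rmorphM -[12%:R in LHS](rmorph_nat r).
rewrite -rmorphM; congr (r _).
transitivity (12%:R * ((half + half) * Bd)); first by rewrite halfP mul1r.
ring.
Qed.

(** All coefficients are twice those of the final formula, and the scalar curvature stands for 4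
    times the intrinsic J. Four times [laplacian_sff0] with m = 3 absorbs the term -12 <II0, nabla d
    rho>. *)
Lemma obstruction_flat4 : q = 1%N -> m%:R = 3%:R :> A ->
  \tr (x *m x *m x *m x) *+ 2 = \tr (x *m x) ^+ 2 ->
  12%:R * r Bd =
    ctr gB (fun k l => dot2 gB (hB k) (hB l)) *+ 2
    + dot2 gB sff0 (fun i j => ctr gB (fun l k => nab3 dB gB (r half) hB l k i j)) *+ 4
    + dot gB (fun i => ctr gB (fun b c => hB c i b)) (fun i => ctr gB (fun b c => hB c i b)) *+ 3
    - scal dB gB (r half) * dot2 gB sff0 sff0 + dot2 gB sff0 sff0 ^+ 2 *+ 2.
Proof.
move=> q1 m3 t4; rewrite r_lap_lap_defect // laplacian_sff0 scal_induced.
have m3B : m%:R = 3%:R :> B by rewrite -(rmorph_nat r m) m3 rmorph_nat.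
(* For m = 3 the divergence of II0 is -2 d rho on tangent vectors. The 12 |d rho|^2 collected from
   |nabla E|^2 and |d rho|^2 thus become 3 |div II0|^2. *)
have -> : dot gB (fun i => ctr gB (fun b c => hB c i b)) (fun i => ctr gB (fun b c => hB c i b))
    = 4%:R * dot gB (fun i => ev1 rR1 (J i)) (fun i => ev1 rR1 (J i)).
  have e i : ctr gB (fun b c => hB c i b) = - 2%:R * ev1 rR1 (J i).
    by rewrite div_sff0 kap0 m3B; ring.
  by rewrite (eq_dot _ e e) dotZl dotZr; ring.
have tD (M M' : 'M[B]_m) : \tr (M + M') = \tr M + \tr M' := raddfD _ M M'.
have tN (M : 'M[B]_m) : \tr (- M) = - \tr M := raddfN _ M.
have sL k (M M' : 'M[B]_m) : (k *: M) *m M' = k *: (M *m M') by rewrite scalemxAl.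
have sR k (M M' : 'M[B]_m) : M *m (k *: M') = k *: (M *m M') by rewrite scalemxAr.
have := defect_on_hypersurface; rewrite kap0 addr0 m3B dot2_sff0 => df.
have -> : r (ctr gA (fun e c => dot2 gA (X e) (X c)) *+ 2
    - 12%:R * dot2 gA E R2 + 8%:R * dot gA (dA^~ rho) (dA^~ rho))
  = r (ctr gA (fun e c => dot2 gA (X e) (X c))) *+ 2
    - 12%:R * dot2 gB sff0 (fun i j => ev2 rR2 (J i) (J j))
    + 8%:R * (dot gB (fun i => ev1 rR1 (J i)) (fun i => ev1 rR1 (J i)) + rhon ^+ 2).
  rewrite rmorphD rmorphB [X in r X + _]mulr2n rmorphD !(rmorphM r _%:R) !rmorph_nat.
  rewrite r_dot r_dot2 dotr_split dot2r_split hess0_nul mul0r.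
  have z T T' : (forall i, T i = 0) -> dot gB T T' = 0.
    by move=> t; rewrite /dot -[RHS](ctr0 gB); apply: eq_ctr => i j; rewrite t mul0r.
  rewrite (z (fun i => ev2 rE (J i) nu)) => [|i]; last exact: hess0_nur.
  rewrite (z (fun i => ev2 rE nu (J i))) => [|i]; last exact: hess0_nul.
  by rewrite mulr2n !addr0 -expr2.
have vC i j : - sffh i j + rhon * gB i j = - sffh j i + rhon * gB j i.
  by rewrite sffhC lowC.
rewrite normX_split (eq_dot2 _ X_ntt X_ntt) (dot2E gB _ vC) (dot2E gB _ sffhC).
rewrite !(endoD, endoN, endoZ) endo_low endo_sffh dot2_sff0.
move: tr_x t4 df; move: x => y y0 t4 df.
rewrite !(mulmxDl, mulmxDr, mulmxN, mulNmx, mul_scalar_mx, sL, sR, mulmx1, mul1mx,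
  mulmxA, tD, tN, mxtraceZ, mxtrace1) y0 m3B.
(* [defect_on_hypersurface] for m = 3: |II0|^2 is twice the normal derivative of rho. *)
have e2 : \tr (y *m y) = 2%:R * rhon.
  by apply/eqP; rewrite -subr_eq0 -[X in _ == X]df; apply/eqP; ring.
have e4 : \tr (y *m y *m y *m y) = 2%:R * rhon ^+ 2.
  apply/eqP; rewrite -subr_eq0; apply/eqP/(half_eq0 rhalfP).
  move/eqP: t4; rewrite -subr_eq0 e2 => /eqP t4.
  by rewrite -[RHS]t4; ring.
by rewrite e4 e2; ring.
Qed.

End FlatAmbient.

(** * Arbitrary ambient metric: the formula for surfaces *)

Local Notation K1 := (kap dA gA half s Jsc).
Local Notation rK1 := (fun a => r (K1 a)).
Local Notation rK2 := (fun a b => r (nab1 dA gA half K1 a b)).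
Local Notation rric := (fun a b => r (ric dA gA half a b)).
Local Notation rR4 := (fun a b c e => r (rlow dA gA half a b c e)).

Let dot0l S S' : (forall i, S i = 0) -> dot gB S S' = 0.
Proof.
by move=> t; rewrite /dot -[RHS](ctr0 gB); apply: eq_ctr => i j; rewrite t mul0r.
Qed.

Lemma der_dotN_nu S : ev1 (fun c => r (dA c (dot gA N S))) nu
  = - r rho * ev1 (fun a => r (S a)) nu + ev2 (fun a b => r (nab1 dA gA half S a b)) nu nu.
Proof.
have e c : r (dA c (dot gA N S)) = dotr (rHs c) (fun a => r (S a))
    + ev1 (fun b => r (nab1 dA gA half S c b)) nu.
  by rewrite (der_dot dA gA halfP) rmorphD r_dot r_dotN.
rewrite (eq_ev1 _ e) ev1Dl; congr (_ + _).
rewrite ev1_ctrr.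
have -> : ctrr (fun b c => ev1 (fun a => r (Hs a b) * r (S c)) nu)
    = dotr (fun b => ev1 (fun a => r (Hs a b)) nu) (fun a => r (S a)).
  by apply: eq_ctrr => b c; rewrite mulrC -ev1Zl; apply: eq_ev1 => a; rewrite mulrC.
rewrite dotr_split -ev2E hess_nul nann mulr1 dot0l ?add0r // => i.
by rewrite -ev2E hess_nul naJ mulr0.
Qed.

(** Delta (s^3 B / 2) = s (3 B |ds|^2 + O(s)), and the normal derivative of s is 1. The other side
    is [lap_defect] with n = 3, differentiated term by term. *)
Lemma normal_derivative_defect : q = 0%N -> m%:R = 2%:R :> A ->
  3%:R * r Bd = dot2 gB sff0 (fun i j => ev3 rX nu (J i) (J j)) *+ 2
    + r rho * r Jsc + r rho * rhon - ev2 rR2 nu nu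
    - r rho * ev1 rK1 nu + ev2 rK2 nu nu + r (lap dA gA half rho).
Proof.
move=> q0 m2.
have n3 : 2%:R - m.+1%:R = -1 :> A by rewrite -(natr1 m) m2; ring.
pose L := lap dA gA half (s ^+ q.+3 * (half * Bd)).
have rs a u : r (a + s * u) = r a by rewrite rmorphD rmorphM s0 mul0r addr0.
have rds c u : r (dA c (s * u)) = na c * r u.
  by rewrite derM addrC addrC rs rmorphM naN.
have <- : ev1 (fun c => r (dA c L)) nu = 3%:R * r Bd.
  have e c : r (dA c L) = 3%:R * r Bd * na c.
    rewrite /L q0 (lap_exp _ _ _ s _ 1) expr1 rds rs rmorphM r_normN mulr1 mulrC.
    congr (_ * _); rewrite -[3%:R in RHS](rmorph_nat r) -rmorphM; congr (r _).
    transitivity (3%:R * ((half + half) * Bd)); last by rewrite halfP mul1r.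
    ring.
  by rewrite (eq_ev1 _ e) ev1Zl nann mulr1.
have LE : L = dot2 gA E E + s * (rho * Jsc) - dot gA N (dA^~ rho) + dot gA N K1
    + s * lap dA gA half rho.
  by rewrite /L (lap_defect halfP rhoE IsqE) n3; ring.
have e c : r (dA c L) = dot2r (rX c) rE *+ 2 + na c * r (rho * Jsc)
    - r (dA c (dot gA N (dA^~ rho))) + r (dA c (dot gA N K1)) + na c * r (lap dA gA half rho).
  have dE : dA c (dot2 gA E E) = dot2 gA (X c) E *+ 2.
    by rewrite (der_dot2 dA gA halfP) (dot2C _ E) mulr2n.
  rewrite LE 4!derD derN dE 4!rmorphD rmorphN !rds rmorphMn.
  by rewrite r_dot2.
rewrite (eq_ev1 _ e) 4!ev1Dl ev1Nl !der_dotN_nu.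
have -> : ev1 (fun c => na c * r (rho * Jsc)) nu = r rho * r Jsc.
  by rewrite -rmorphM -[RHS]mulr1 -nann -ev1Zl; apply: eq_ev1 => c; rewrite mulrC.
have -> : ev1 (fun c => na c * r (lap dA gA half rho)) nu = r (lap dA gA half rho).
  by rewrite -[RHS]mulr1 -nann -ev1Zl; apply: eq_ev1 => c; rewrite mulrC.
have -> : ev1 (fun c => dot2r (rX c) rE *+ 2) nu
    = dot2 gB sff0 (fun i j => ev3 rX nu (J i) (J j)) *+ 2.
  rewrite mulr2n -[in RHS]mulr2n.
  have -> : ev1 (fun c => dot2r (rX c) rE *+ 2) nu = ev1 (fun c => dot2r (rX c) rE) nu *+ 2.
    by rewrite mulr2n -ev1Dl; apply: eq_ev1 => c; rewrite mulr2n.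
  congr (_ *+ 2).
  have -> : ev1 (fun c => dot2r (rX c) rE) nu
      = dot2r (fun a b => ev1 (fun c => rX c a b) nu) rE.
    rewrite ev1_ctrr; apply: eq_ctrr => a b; rewrite ev1_ctrr; apply: eq_ctrr => c f.
    by rewrite mulrC -ev1Zl; apply: eq_ev1 => k; rewrite mulrC.
  rewrite dot2r_split hess0_nul mulr0 addr0.
  rewrite [X in _ + X + _]dotC [X in _ + _ + X]dotC !dot0l ?addr0 => [|i|i].
  - by rewrite dot2C; apply: eq_dot2 => // i j; rewrite -ev3E.
  - exact: hess0_nul.
  - exact: hess0_nur.
ring.
Qed.

(** As in the flat case, the Codazzi exchange now leaving the curvature with two normal
    arguments. *)
Lemma X_ntt_riem i j : ev3 rX nu (J i) (J j)
  = - sffh i j - ev4 rR4 nu (J i) nu (J j) + rhon * gB i j.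
Proof.
have kE c a b : r (\sum_e riem dA gA half c a e b * dA e s)
    = ev1 (fun e => r (rlow dA gA half c a e b)) nu.
  rewrite rmorph_sum; under eq_bigr do rewrite rmorphM -naN naE mulr_sumr.
  rewrite exchange_big; apply: eq_bigr => f _ /=.
  rewrite rmorph_sum mulr_sumr; apply: eq_bigr => e _.
  by rewrite rmorphM (lowC gA f e); ring.
have e : ev3 rX nu (J i) (J j) = ev3 (fun c a b => r (X a c b)) nu (J i) (J j)
   - ev4 rR4 nu (J i) nu (J j) + rhon * ev2 rg (J i) (J j) - ev1 rR1 (J i) * ev2 rg nu (J j).
  rewrite (eq_ev3 _ _ _ (X' := fun c a b => (r (X a c b)
     - ev1 (fun e => r (rlow dA gA half c a e b)) nu + r (dA c rho) * r (gA a b))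
     - r (dA a rho) * r (gA c b))); last first.
    by move=> c a b; rewrite hess0_codazzi // rmorphB rmorphD rmorphB kE !rmorphM.
  rewrite ev3D ev3N ev3D ev3D ev3N (ev3M rR1 rg); congr (_ - _ + _ - _).
    by apply: eq_ev1 => c; apply: eq_ev1 => a; rewrite ev2E.
  by rewrite (ev3_swap (fun c a b => r (dA c rho) * r (gA a b))) (ev3M rR1 rg).
by rewrite e (ev3_swap rX) X_tnt (rgC nu) rg_nu naJ mulr0 subr0 gBE.
Qed.

(** The trace defining Ric split along the frame. On a surface II0 annihilates the tangential part,
    so that <II0, Ric> sees only the curvature with two normal arguments. *)
Lemma ric_tangent i j : ev2 rric (J i) (J j)
  = ctr gB (fun k l => ev4 rR4 (J k) (J i) (J l) (J j)) + ev4 rR4 nu (J i) nu (J j).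
Proof.
have e a b : r (ric dA gA half a b) = ctrr (fun c f => r (rlow dA gA half c a f b)).
  rewrite -r_ctr; congr (r _).
  by apply: eq_bigr => c _; rewrite riem_rlow.
rewrite (eq_ev2 _ _ e) ev2_ctrr ctrr_split.
have k u u' v v' : ev2 (fun c f => ev2 (fun a b => r (rlow dA gA half c a f b)) v v') u u'
   = ev4 rR4 u v u' v'.
  apply: eq_ev1 => c.
  exact: (ev3_swap (fun a f b => r (rlow dA gA half c a f b)) u' v v').
by rewrite k; congr (_ + _); apply: eq_ctr => p p'; rewrite k.
Qed.

(** Links the normal-normal part of nabla kappa, present in [normal_derivative_defect], with its
    tangential trace, present in [divdiv_sff0]. The coefficient of rho J is 3 - 4: Delta s gives 3,
    and Sc = 4 J gives -4. *)
Lemma div_kap_on_hypersurface : m%:R = 2%:R :> A -> scal dA gA half = 4%:R * Jsc ->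
  ctr gB (fun i j => ev2 rK2 (J i) (J j)) + ev2 rK2 nu nu
  = dot2 gB sff0 (fun i j => ev2 rric (J i) (J j)) - r rho * r Jsc.
Proof.
move=> m2 scalE; have n3 : m.+1%:R = 3%:R :> A by rewrite -(natr1 m) m2; ring.
rewrite -ctrr_split -r_ctr ctr_nab1_kap //.
have -> : lap dA gA half s = - (3%:R * rho) - Jsc * s.
  by rewrite -n3 rhoE; ring.
have -> : dot2 gA (ric dA gA half) Hs = dot2 gA (ric dA gA half) E - 4%:R * (rho * Jsc).
  have -> : dot2 gA (ric dA gA half) E = dot2 gA Hs (ric dA gA half)
      + rho * dot2 gA gA (ric dA gA half) by rewrite dot2C -dot2Zl -dot2Dl.
  by rewrite dot2_lowl -/(scal dA gA half) scalE dot2C; ring.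
have -> : dot2 gA (ric dA gA half) E - 4%:R * (rho * Jsc) - s * lap dA gA half Jsc
    - Jsc * (- (3%:R * rho) - Jsc * s)
    = dot2 gA E (ric dA gA half) - rho * Jsc + s * (Jsc * Jsc - lap dA gA half Jsc).
  by rewrite (dot2C gA E); ring.
rewrite rmorphD rmorphB !rmorphM s0 mul0r addr0 r_dot2 dot2r_split hess0_nul mul0r.
rewrite (dot0l (S := fun i => ev2 rE (J i) nu)) => [|i]; last exact: hess0_nur.
rewrite (dot0l (S := fun i => ev2 rE nu (J i))) => [|i]; last exact: hess0_nul.
by rewrite !addr0.
Qed.

Lemma Z_sym t u v w : ev4 rZ t u v w = ev4 rZ t u w v.
Proof.
apply: eq_ev1 => e; apply: eq_ev1 => c; rewrite ev2_tr; apply: eq_ev2 => a b.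
by rewrite nab3_sym //; exact: nab_hess0C.
Qed.

(** The normal derivative of E coming from [Z_tnnt] and from [nab2_sff0] cancels, as do the traces
    of II times [sffh]; what remains of the second fundamental form is tr II tr (II II0) = -2 rho
    |II0|^2. *)
Lemma divdiv_sff0 : m%:R = 2%:R :> A ->
  ctr gB (fun l i => ctr gB (fun k j => nab3 dB gB (r half) hB l k i j))
  = ctr gB (fun i j => ev2 rK2 (J i) (J j)) - ctr gB (fun i j => ev2 rR2 (J i) (J j))
    - 2%:R * r rho * \tr (x *m x).
Proof.
move=> m2.
pose v i j := ev3 rX nu (J i) (J j).
have vC i j : v i j = v j i by rewrite /v XC.
have e0 l i : ctr gB (fun k j => ev4 rZ (J l) (J k) (J i) (J j))
    = ev2 rK2 (J l) (J i) - ev2 rR2 (J l) (J i)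
      - \sum_p endo gB sff l p * sffh p i + \sum_p endo gB sff l p * v p i.
  have e1 : ev2 (fun e b => r (nab1 dA gA half (fun b => ctr gA (fun c a => X c a b)) e b))
       (J l) (J i) = ctr gB (fun k j => ev4 rZ (J l) (J k) (J i) (J j))
      + ev4 rZ (J l) nu nu (J i).
    have e2 e b : r (nab1 dA gA half (fun b => ctr gA (fun c a => X c a b)) e b)
        = ctrr (fun c a => r (Z e c a b)) by rewrite nab1_ctr // r_ctr.
    rewrite (eq_ev2 _ _ e2) ev2_ctrr ctrr_split.
    have e3 u u' t w' : ev2 (fun c a => ev2 (fun e b => r (Z e c a b)) t w') u u'
        = ev4 rZ t u u' w'.
      by rewrite ev4E; apply: eq_ev1 => c; apply: eq_ev1 => a; rewrite ev2E.
    by rewrite e3; congr (_ + _); apply: eq_ctr => k j; rewrite e3 Z_sym.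
  have e4 : ev2 (fun e b => r (nab1 dA gA half (fun b => ctr gA (fun c a => X c a b)) e b))
       (J l) (J i) = ev2 rK2 (J l) (J i) - 2%:R * ev2 rR2 (J l) (J i).
    rewrite -ev2Z -ev2N -ev2D; apply: eq_ev2 => e b.
    rewrite (eq_nab1 _ _ _ _ _ (fun b => div_hess0 halfP rhoE b)) nab1D nab1Z.
    have -> : 1 - m.+1%:R = - 2%:R :> A by rewrite -(natr1 m) m2; ring.
    rewrite derN der_nat oppr0 mul0r add0r addrC rmorphD !rmorphM rmorphN rmorph_nat mulNr.
    by [].
  rewrite -[LHS](addrK (ev4 rZ (J l) nu nu (J i))) -e1 e4 Z_tnnt.
  under eq_bigr do rewrite shapeE; under [X in _ - (_ - X)]eq_bigr do rewrite shapeE.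
  by rewrite /v; ring.
have e5 l i : ctr gB (fun k j => nab3 dB gB (r half) hB l k i j)
    = ev2 rK2 (J l) (J i) - ev2 rR2 (J l) (J i)
      - \sum_p endo gB sff l p * sffh p i + \sum_p endo gB sff l p * v p i
      - ctr gB (fun k j => sff l k * v i j) + sff l i * ctr gB sffh
      + ctr gB (fun k j => sff l j * sffh k i).
  rewrite (eq_ctr _ (fun k j => nab2_sff0 l k i j)) 2!ctrDE ctrB e0.
  by rewrite ctrZ.
rewrite (eq_ctr _ e5).
rewrite 2!ctrDE ctrB ctrDE 2!ctrB.
have -> : ctr gB (fun l i => ctr gB (fun k j => sff l k * v i j)) = dot2 gB sff v.
  by apply: eq_ctr => l i.
have -> : ctr gB (fun l i => ctr gB (fun k j => sff l j * sffh k i)) = dot2 gB sff sffh.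
  apply: eq_ctr => l i; rewrite -[LHS]ctr_tr; apply: eq_ctr => j k.
  by rewrite (sffhC k).
have -> : ctr gB (fun l i => sff l i * ctr gB sffh) = ctr gB sff * ctr gB sffh.
  by rewrite mulrC -ctrZ; apply: eq_ctr => l i; rewrite mulrC.
rewrite !ctrE (dot2E gB _ vC) (dot2E gB _ sffhC) !endo_comp.
rewrite endo_sffh endo_sff; move: tr_x; move: x (endo gB v) => y V y0.
move: (endo gB (fun i j => ev2 rK2 (J i) (J j))) (endo gB (fun i j => ev2 rR2 (J i) (J j))) => P P'.
have tD (M M' : 'M[B]_m) : \tr (M + M') = \tr M + \tr M' := raddfD _ M M'.
have tN (M : 'M[B]_m) : \tr (- M) = - \tr M := raddfN _ M.
have sL k (M M' : 'M[B]_m) : (k *: M) *m M' = k *: (M *m M') by rewrite scalemxAl.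
have sR k (M M' : 'M[B]_m) : M *m (k *: M') = k *: (M *m M') by rewrite scalemxAr.
rewrite !(mulmxDl, mulmxDr, mulmxN, mulNmx, mul_scalar_mx, sL, sR, mulmx1, mul1mx,
  mulmxA, tD, tN, mxtraceZ, mxtrace_scalar) y0.
have m2B : m%:R = 2%:R :> B by rewrite -(rmorph_nat r m) m2 rmorph_nat.
by rewrite -(mulr_natl _ m) m2B; ring.
Qed.

(** The last two premises are the algebra special to surfaces, supplied by [trace_cube2] and
    [contract_curvature2]. Since -rho is the mean curvature, only the replacement of Ric by the
    Schouten tensor is left. *)
Lemma obstruction3 : q = 0%N -> m%:R = 2%:R :> A -> scal dA gA half = 4%:R * Jsc ->
  \tr (x *m x *m x) = 0 ->
  (forall R4 : 'I_m -> 'I_m -> 'I_m -> 'I_m -> B,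
     (forall k i l j, R4 i k l j = - R4 k i l j) ->
     (forall k i l j, R4 k i j l = - R4 k i l j) ->
     dot2 gB sff0 (fun i j => ctr gB (fun k l => R4 k i l j)) = 0) ->
  - (3%:R * r Bd) =
    ctr gB (fun l i => ctr gB (fun k j => nab3 dB gB (r half) hB l k i j))
    - r rho * dot2 gB sff0 sff0
    + dot2 gB sff0 (fun i j => ev2 rric (J i) (J j)).
Proof.
move=> q0 m2 scalE t3 R40.
have m2B : m%:R = 2%:R :> B by rewrite -(rmorph_nat r m) m2 rmorph_nat.
rewrite normal_derivative_defect // divdiv_sff0 //.
have := div_kap_on_hypersurface m2 scalE.
have := defect_on_hypersurface; rewrite m2B dot2_sff0.
have -> : r (lap dA gA half rho) = ctr gB (fun i j => ev2 rR2 (J i) (J j)) + ev2 rR2 nu nu.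
  by rewrite r_ctr ctrr_split.
have -> : dot2 gB sff0 (fun i j => ev3 rX nu (J i) (J j)) =
    r rho * \tr (x *m x) - dot2 gB sff0 (fun i j => ev2 rric (J i) (J j)).
  rewrite (eq_dot2 _ (fun a b => erefl (sff0 a b)) X_ntt_riem).
  have -> : dot2 gB sff0 (fun i j => ev2 rric (J i) (J j))
      = dot2 gB sff0 (fun i j => ev4 rR4 nu (J i) nu (J j)).
    rewrite (eq_dot2 _ (fun a b => erefl (sff0 a b)) ric_tangent).
    rewrite dot2C dot2Dl !(dot2C _ _ sff0) R40 ?add0r // => k i l j.
      rewrite -(ev4_swap rR4) -ev4N; apply: eq_ev4 => e c a b.
      by rewrite rlowN rmorphN.
    rewrite -ev4N /ev4; apply: eq_ev1 => e; apply: eq_ev1 => c.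
    rewrite ev2_tr; apply: eq_ev2 => a b.
    by rewrite (rlow_anti dA gA halfP) rmorphN.
  rewrite dot2C 2!dot2Dl !(dot2C _ _ sff0).
  have -> : dot2 gB sff0 (fun a b => rhon * gB a b) = 0.
    by rewrite dot2_sff0 endoZ endo_low -scalemxAl mul1mx mxtraceZ tr_x mulr0.
  rewrite addr0.
  have n0 T : dot2 gB sff0 (fun a b => - T a b) = - dot2 gB sff0 T.
    by rewrite !dot2_sff0 endoN mulNmx raddfN.
  rewrite !n0; congr (_ - _).
  rewrite dot2_sff0 endo_sffh mulmxBl raddfB /= t3 -scalemxAl mxtraceZ; ring.
set u := \tr (x *m x); set h := dot2 gB sff0 _.
move=> e1 e2.
have -> : ev2 rK2 nu nu = h - r rho * r Jsc - ctr gB (fun i j => ev2 rK2 (J i) (J j)).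
  by rewrite -e2; ring.
have -> : rhon = u + ev1 rK1 nu.
  by apply/eqP; rewrite eq_sym -subr_eq0 -[X in _ == X]e1; apply/eqP; ring.
ring.
Qed.

End Hypersurface.

(** * Algebraic identities special to dimensions two and three *)

Section LowDimension.
Variable (B : comNzRingType).

(** Cayley-Hamilton for a trace-free matrix of size two: M^2 = -det M, so that tr M^3 = -det M tr
    M. *)
Lemma trace_cube2 m (M : 'M[B]_m) : m = 2%N -> \tr M = 0 -> \tr (M *m M *m M) = 0.
Proof.
move=> m2; subst m; rewrite /mxtrace !big_ord_recl !big_ord0 addr0.
move=> /eqP; rewrite addr_eq0 => /eqP e.
rewrite !(mxE, big_ord_recl, big_ord0) e; ring.
Qed.

(** Cayley-Hamilton for a trace-free matrix of size three: M^3 = tr (M^2) / 2 M + det M; multiply by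
    M and take the trace. *)
Lemma trace_fourth3 m (M : 'M[B]_m) : m = 3%N -> \tr M = 0 ->
  \tr (M *m M *m M *m M) *+ 2 = \tr (M *m M) ^+ 2.
Proof.
move=> m3; subst m; rewrite -[M *m M *m M *m M]mulmxA; set N := M *m M.
have N3 i j : N i j = M i 0 * M 0 j + M i (lift 0 0) * M (lift 0 0) j
    + M i (lift 0 (lift 0 0)) * M (lift 0 (lift 0 0)) j.
  by rewrite mxE !big_ord_recl big_ord0 addr0 addrA.
rewrite /mxtrace !big_ord_recl !big_ord0 !addr0 => /eqP; rewrite addr_eq0 => /eqP e.
rewrite !mxE !big_ord_recl !big_ord0 !N3 e; ring.
Qed.

(** In dimension two such a tensor has a single component up to sign, so its contraction is a
    multiple of the metric, orthogonal to the trace-free h. *)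
Lemma contract_curvature2 m (g : metric m B) (half : B) (h : 'I_m -> 'I_m -> B)
    (R4 : 'I_m -> 'I_m -> 'I_m -> 'I_m -> B) : m = 2%N ->
  half + half = 1 -> ctr g h = 0 ->
  (forall k i l j, R4 i k l j = - R4 k i l j) ->
  (forall k i l j, R4 k i j l = - R4 k i l j) ->
  dot2 g h (fun i j => ctr g (fun k l => R4 k i l j)) = 0.
Proof.
move=> m2; subst m => halfP h0 a1 a2.
have z1 k l j : R4 k k l j = 0 by apply: (half_eq0 halfP); rewrite {1}a1 addNr.
have z2 k i l : R4 k i l l = 0 by apply: (half_eq0 halfP); rewrite {1}a2 addNr.
rewrite /dot2 /dot /ctr !big_ord_recl !big_ord0 in h0 *.
set o := lift ord0 ord0 in h0 *.
rewrite !z1 !z2 !(a1 ord0 o) !(a2 _ _ ord0 o) (uppC g o ord0) in h0 *.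
(* The determinant of the inverse metric; the contraction is D times the single component times the
   trace of h. *)
set D := upp g ord0 ord0 * upp g o o - upp g ord0 o ^+ 2.
transitivity (D * R4 ord0 o ord0 o * 0); last by rewrite mulr0.
by rewrite -[in RHS]h0 /D; ring.
Qed.

End LowDimension.

(** * Rings of smooth functions *)

Section NearDifferentiable.
Variables (R : realType) (V W : normedModType R).

(** The first-order expansion only sees a neighbourhood of x, and uniqueness of the differential
    transfers it from f to g. *)
Lemma near_eq_differentiable (f g : V -> W) x :
  (\near x, f x = g x) -> differentiable f x -> differentiable g x.
Proof.
move=> fg df; have /diff_locallyP[dc dE] := df.
have gE : g \o shift x = cst (g x) + 'd f x +o_ 0 id.
  apply/eqaddoP => _/posnumP[e].
  have /eqaddoP/(_ _ [gt0 of e%:num]) := dE.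
  have fx : f x = g x := nbhs_singleton fg.
  have : \forall h \near 0, f (h + x) = g (h + x).
    by move: fg; rewrite (near_shift 0 x) subr0; apply: filterS.
  apply: filterS2 => h e1.
  by rewrite !fctE /= e1 fx.
have dd := diff_unique dc gE.
by apply/diff_locallyP; rewrite dd.
Qed.

End NearDifferentiable.

Section SmoothCalculus.
Variables (R : realType) (n : nat).
Implicit Types (U : set 'rV[R]_n) (f g : 'rV[R]_n -> R) (x : 'rV[R]_n).

(* All partial derivatives of order at most k are differentiable on U. *)
Fixpoint Ck (k : nat) U f : Prop :=
  (forall x, U x -> differentiable f x) /\
  (if k is k'.+1 then forall a, Ck k' U (partial a f) else True).

Lemma CkW k U f : Ck k.+1 U f -> Ck k U f.
Proof.
elim: k f => [|k IH] f [d p]; split=> // a.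
exact/IH/p.
Qed.

Lemma Ck0 k U f x : Ck k U f -> U x -> differentiable f x.
Proof. by case: k => [|k] [d _]; apply: d. Qed.

(** [foldr partial f s] applies the last element of s first while [Ck] unfolds the first derivative
    taken, hence the decomposition of lists by [rcons]. *)
Lemma smooth_onP U f : smooth_on U f <-> forall k, Ck k U f.
Proof.
split=> [sf k|Cf s].
  elim: k f sf => [|k IH] f sf; first by split=> // x; exact: (sf [::]).
  split=> [|a]; first exact: (sf [::]).
  by apply: IH => s x Ux; have := sf (rcons s a) x Ux; rewrite foldr_rcons.
elim/last_ind: s f Cf => [|s a IH] f Cf x Ux; first exact: Ck0 (Cf 0%N) Ux.
by rewrite foldr_rcons; apply: IH => // k; exact: (proj2 (Cf k.+1)).
Qed.

Lemma near_open U x (P : set 'rV[R]_n) : open U -> U x -> (forall y, U y -> P y) -> \near x, P x.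
Proof. by move=> oU Ux UP; exact: filterS UP (open_nbhs_nbhs (conj oU Ux)). Qed.

Lemma partial_eq U f g a x : open U -> (forall y, U y -> f y = g y) -> U x ->
  partial a f x = partial a g x.
Proof. by move=> oU e Ux; apply: near_eq_derive; exact: near_open e. Qed.

Lemma Ck_eq k U f g : open U -> (forall x, U x -> f x = g x) -> Ck k U f -> Ck k U g.
Proof.
move=> oU; elim: k f g => [|k IH] f g e [d p].
  by split=> // x Ux; exact: near_eq_differentiable (near_open oU Ux e) (d x Ux).
split=> [x Ux|a]; first exact: near_eq_differentiable (near_open oU Ux e) (d x Ux).
by apply: IH (p a) => x Ux; apply: partial_eq Ux.
Qed.

Lemma partial_cst a (c : R) x : partial a (cst c) x = 0.
Proof. exact: derive_cst. Qed.

Lemma partialD a f g x : differentiable f x -> differentiable g x ->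
  partial a (f + g) x = partial a f x + partial a g x.
Proof. by move=> df dg; rewrite /partial deriveD //; exact: diff_derivable. Qed.

Lemma partialN a f x : differentiable f x -> partial a (- f) x = - partial a f x.
Proof. by move=> df; rewrite /partial deriveN //; exact: diff_derivable. Qed.

Lemma partialM a f g x : differentiable f x -> differentiable g x ->
  partial a (f * g) x = partial a f x * g x + f x * partial a g x.
Proof.
move=> df dg; rewrite /partial deriveM; [|exact: diff_derivable..].
by rewrite addrC; congr (_ + _); rewrite mulrC.
Qed.

Lemma Ck_cst k U c : Ck k U (cst c).
Proof.
elim: k c => [|k IH] c; split=> // a.
suff -> : partial a (cst c) = cst 0 :> ('rV[R]_n -> R) by exact: IH.
by apply/funext => x; rewrite partial_cst.
Qed.

Lemma CkD k U f g : open U -> Ck k U f -> Ck k U g -> Ck k U (f + g).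
Proof.
move=> oU; elim: k f g => [|k IH] f g [df pf] [dg pg].
  by split=> // x Ux; apply: differentiableD; [exact: df|exact: dg].
split=> [x Ux|a]; first by apply: differentiableD; [exact: df|exact: dg].
apply: (Ck_eq oU) (IH _ _ (pf a) (pg a)) => x Ux.
  by rewrite partialD //; [exact: df|exact: dg].
Qed.

Lemma CkN k U f : open U -> Ck k U f -> Ck k U (- f).
Proof.
move=> oU; elim: k f => [|k IH] f [df pf].
  by split=> // x Ux; exact/differentiableN/df.
split=> [x Ux|a]; first exact/differentiableN/df.
by apply: (Ck_eq oU) (IH _ (pf a)) => x Ux; rewrite partialN //; exact: df.
Qed.

Lemma CkM k U f g : open U -> Ck k U f -> Ck k U g -> Ck k U (f * g).
Proof.
move=> oU; elim: k f g => [|k IH] f g Cf Cg.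
  by split=> // x Ux; apply: differentiableM; [exact: Ck0 Cf Ux|exact: Ck0 Cg Ux].
split=> [x Ux|a].
  by apply: differentiableM; [exact: Ck0 Cf Ux|exact: Ck0 Cg Ux].
apply: (Ck_eq oU) (CkD oU (IH _ _ (proj2 Cf a) (CkW Cg)) (IH _ _ (CkW Cf) (proj2 Cg a))).
by move=> x Ux; rewrite partialM //; [exact: Ck0 Cf Ux|exact: Ck0 Cg Ux].
Qed.

Lemma Ck_sum k U m (f : 'I_m -> 'rV[R]_n -> R) : open U -> (forall i, Ck k U (f i)) ->
  Ck k U (fun x => \sum_i f i x).
Proof.
move=> oU Cf; elim: m f Cf => [|m IH] f Cf.
  by apply: (Ck_eq oU) (Ck_cst k U 0) => x _; rewrite big_ord0.
apply: (Ck_eq oU) (CkD oU (Cf ord0) (IH (fun i => f (lift ord0 i)) _)) => [x _|i].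
  by rewrite big_ord_recl.
exact: Cf.
Qed.

(** The derivative of 1/f is -f' (1/f)^2, where the induction hypothesis provides 1/f at order k. *)
Lemma CkV k U f : open U -> (forall x, U x -> f x != 0) -> Ck k U f ->
  Ck k U (fun x => (f x)^-1).
Proof.
move=> oU f0; elim: k => [|k IH] Cf.
  by split=> // x Ux; apply: differentiableV; [exact: Ck0 Cf Ux|exact: f0].
have d x : U x -> differentiable (fun x => (f x)^-1) x.
  by move=> Ux; apply: differentiableV; [exact: Ck0 Cf Ux|exact: f0].
split=> // a; have CV := IH (CkW Cf).
apply: (Ck_eq oU) (CkN oU (CkM oU (proj2 Cf a) (CkM oU CV CV))) => x Ux.
rewrite /partial deriveV ?f0 //; last exact/diff_derivable/(Ck0 Cf).
by rewrite !fctE scaleNr -exprVn expr2 mulrC.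
Qed.

End SmoothCalculus.

(** * Symmetry of second derivatives *)

Section Schwarz.
Variables (R : realType) (V : normedModType R).
Implicit Types (f : V -> R) (x y v w : V).

Lemma is_derive_line f v y (c : R) : differentiable f (c *: v + y) ->
  is_derive c 1 (fun s : R => f (s *: v + y)) ('D_v f (c *: v + y)).
Proof.
move=> df.
have dL : is_diff c (fun s : R => s *: v + y) (fun s : R => s *: v).
  have -> : (fun s : R => s *: v + y) = ( *:%R^~ v) + cst y by [].
  by apply: is_diff_eq; rewrite addr0.
have dfL : differentiable (f \o (fun s : R => s *: v + y)) c.
  by apply: differentiable_comp.
apply: DeriveDef; first exact: diff_derivable.
rewrite deriveE // diff_comp //= diff_val scale1r -deriveE //.
Qed.

Definition diff2 f x v w (t : R) : R :=
  f (x + t *: v + t *: w) - f (x + t *: v) - f (x + t *: w) + f x.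

(* The mean value theorem for s |-> f (x + s v + t w) - f (x + s v), followed by the
   differentiability of the directional derivative of f at x *)
Lemma diff2_approx (U : set V) f x v w : open U -> U x ->
  (forall y, U y -> differentiable f y) -> differentiable ('D_v f) x ->
  forall e : R, 0 < e -> \forall t \near 0^'+,
    `|diff2 f x v w t - t ^+ 2 * 'D_w ('D_v f) x| <= e * t ^+ 2.
Proof.
move=> oU Ux df dp e e0.
pose p := 'D_v f.
(* For 0 <= c <= t the vectors c v and c v + t w have norms adding up to less than t M; the summand
   1 makes M positive. *)
pose M : R := `|v| + `|v| + `|w| + 1.
have M0 : 0 < M by rewrite /M; have := normr_ge0 v; have := normr_ge0 w; lra.
have : \forall h \near 0, U (h + x) /\ `|p (h + x) - p x - 'd p x h| <= e / M * `|h|.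
  have nU : \forall h \near 0, U (h + x).
    have : \forall y \near x, U y by exact: open_nbhs_nbhs.
    by rewrite (near_shift 0 x) subr0.
  have /diff_locallyP[_ /eqaddoP/(_ (e / M))] := dp.
  move=> /(_ (divr_gt0 e0 M0)); apply: filterS2 nU => h Uh; split=> //.
  by rewrite -addrA -opprD.
case/nbhs_ballP => d /= d0 hd.
have hh h : `|h| < d -> U (h + x) /\ `|p (h + x) - p x - 'd p x h| <= e / M * `|h|.
  by move=> hlt; apply: hd; rewrite -ball_normE /= sub0r normrN.
near=> t.
have t0 : 0 < t by near: t; exact: nbhs_right_gt.
have td : t * M < d.
  rewrite -ltr_pdivlMr //; near: t; apply: nbhs_right_lt; exact: divr_gt0.
have small s : 0 <= s -> s <= t -> `|s *: v| < d /\ `|s *: v + t *: w| < d.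
  move=> s0 st.
  have k1 : `|s *: v| <= t * `|v|.
    by rewrite normrZ ger0_norm // ler_wpM2r.
  have k2 : `|t *: w| = t * `|w| by rewrite normrZ gtr0_norm.
  have k3 := ler_normD (s *: v) (t *: w).
  have k4 : t * M = t * `|v| + t * `|v| + t * `|w| + t by rewrite /M; ring.
  have k5 : 0 <= t * `|v| by rewrite mulr_ge0 // ltW.
  have k6 : 0 <= t * `|w| by rewrite mulr_ge0 // ltW.
  by split; lra.
pose phi (s : R) := f (s *: v + (t *: w + x)) - f (s *: v + x).
pose dphi (s : R) := p (s *: v + (t *: w + x)) - p (s *: v + x).
have Dphi s : 0 <= s -> s <= t -> is_derive s 1 phi (dphi s).
  move=> s0 st; have [k1 k2] := small s s0 st.
  apply: is_deriveB; apply: is_derive_line; apply: df.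
    by rewrite addrA; case: (hh _ k2).
  by case: (hh _ k1).
have [c ct phiE] : exists2 c, c \in `]0, t[%R & phi t - phi 0 = dphi c * (t - 0).
  apply: MVT => // [s|].
    by rewrite in_itv /= => /andP[/ltW s0 /ltW st]; exact: Dphi.
  apply: derivable_within_continuous => s; rewrite in_itv /= => /andP[s0 st].
  by have [] := Dphi s s0 st.
move: ct; rewrite in_itv /= => /andP[/ltW c0 /ltW c1].
have [k1 k2] := small c c0 c1.
have [_ e1] := hh _ k1; have [_ e2] := hh _ k2.
have -> : diff2 f x v w t = phi t - phi 0.
  rewrite /diff2 /phi !scale0r !add0r opprB addrA.
  have -> : x + t *: v + t *: w = t *: v + (t *: w + x) by rewrite -addrA addrC addrA.
  have -> : x + t *: v = t *: v + x by rewrite addrC.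
  have -> : x + t *: w = t *: w + x by rewrite addrC.
  by ring.
rewrite phiE subr0 deriveE // -/p.
have dE : 'd p x (c *: v + t *: w) = 'd p x (c *: v) + t * 'd p x w.
  by rewrite linearD [X in _ + X]linearZ.
move: e1 e2; rewrite /dphi addrA dE.
set p1 := p (c *: v + x); set p2 := p (c *: v + t *: w + x); set a := 'd p x (c *: v).
set b := 'd p x w => e1 e2.
have -> : (p2 - p1) * t - t ^+ 2 * b = (p2 - p x - (a + t * b) - (p1 - p x - a)) * t by ring.
rewrite normrM (gtr0_norm t0) expr2 mulrA ler_pM2r //.
apply: le_trans (ler_normB _ _) _; apply: le_trans (lerD e2 e1) _.
have n1 : `|c *: v| <= t * `|v| by rewrite normrZ ger0_norm // ler_wpM2r.
have n2 : `|c *: v + t *: w| <= t * `|v| + t * `|w|.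
  by apply: le_trans (ler_normD _ _) _; rewrite lerD // normrZ gtr0_norm.
rewrite -mulrDr mulrAC ler_pdivrMr // -mulrA ler_pM2l // /M.
have := normr_ge0 v; have := normr_ge0 w; nra.
Unshelve. all: by end_near. Qed.

(** The second difference is symmetric in v and w, so one quantity divided by t^2 approximates both
    derivatives; half of e is allotted to each. *)
Lemma derive_swap (U : set V) f x v w : open U -> U x ->
  (forall y, U y -> differentiable f y) ->
  differentiable ('D_v f) x -> differentiable ('D_w f) x ->
  'D_w ('D_v f) x = 'D_v ('D_w f) x.
Proof.
move=> oU Ux df dv dw; apply/eqP; rewrite -subr_eq0 -normr_le0.
apply/ler_addgt0Pl => e e0; rewrite addr0.
have e2 : 0 < e / 2 by rewrite divr_gt0.
have A1 := @diff2_approx U f x v w oU Ux df dv _ e2.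
have A2 := @diff2_approx U f x w v oU Ux df dw _ e2.
near (0 : R)^'+ => t.
have t0 : 0 < t by near: t; exact: nbhs_right_gt.
have a1 : `|diff2 f x v w t - t ^+ 2 * 'D_w ('D_v f) x| <= e / 2 * t ^+ 2.
  exact: (near A1 t).
have a2 : `|diff2 f x w v t - t ^+ 2 * 'D_v ('D_w f) x| <= e / 2 * t ^+ 2.
  exact: (near A2 t).
have s : diff2 f x w v t = diff2 f x v w t.
  by rewrite /diff2 [x + t *: w + t *: v]addrAC; ring.
rewrite s distrC in a2; rewrite -(ler_pM2r (exprn_gt0 2 t0)).
move: a1 a2; move: (diff2 f x v w t) ('D_w ('D_v f) x) ('D_v ('D_w f) x) => D p q a1 a2.
rewrite -{1}(gtr0_norm (exprn_gt0 2 t0)) -normrM.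
have -> : (p - q) * t ^+ 2 = - (D - t ^+ 2 * p) - (t ^+ 2 * q - D) by ring.
apply: le_trans (ler_normB _ _) _; rewrite normrN; apply: le_trans (lerD a1 a2) _.
by rewrite -mulrDl -splitr.
Unshelve. all: by end_near. Qed.

End Schwarz.

(** * Chain rule and composition of smooth maps *)

Section Chain.
Variables (R : realType) (m n : nat).
Implicit Types (F : 'rV[R]_m -> 'rV[R]_n) (f : 'rV[R]_n -> R).

Lemma differentiable_rV F u : (forall a, differentiable (fun v => F v 0 a) u) ->
  differentiable F u.
Proof.
move=> dF.
have -> : F = \sum_(a < n) (fun v => F v 0 a *: (delta_mx 0 a : 'rV[R]_n)).
  apply/funext => v; rewrite {1}(row_sum_delta (F v)).
  by rewrite fct_sumE.
apply: differentiable_sum => a.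
exact: (@differentiableZl _ _ _ (fun v => F v 0 a) (delta_mx 0 a) u (dF a)).
Qed.

Lemma jacobianE F u i a : differentiable F u ->
  jacobian F u i a = partial i (fun v => F v 0 a) u.
Proof.
move=> dF; have := deriveEjacobian (delta_mx 0 i) dF; rewrite -rowE => e.
have <- : row i (jacobian F u) 0 a = jacobian F u i a by rewrite mxE.
by rewrite -e derive_mx; [rewrite mxE|exact: diff_derivable].
Qed.

Lemma partial_comp F f u i : differentiable F u -> differentiable f (F u) ->
  partial i (f \o F) u = \sum_a partial i (fun v => F v 0 a) u * partial a f (F u).
Proof.
move=> dF df; rewrite /partial deriveE; last exact: differentiable_comp.
rewrite diff_comp //= -(deriveE (delta_mx 0 i) dF) derive_mx; last exact: diff_derivable.
rewrite [X in 'd f _ X]row_sum_delta linear_sum; apply: eq_bigr => a _.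
by rewrite linearZ mxE -deriveE.
Qed.

(** The chain rule writes a partial derivative of f o F as a sum of products, where the induction
    hypothesis applies to the partial derivatives of f. *)
Lemma Ck_comp k (V : set 'rV[R]_m) (U : set 'rV[R]_n) F f :
  open V -> (forall u, V u -> U (F u)) ->
  (forall a, Ck k V (fun v => F v 0 a)) -> Ck k U f -> Ck k V (f \o F).
Proof.
move=> oV VU; elim: k f => [|k IH] f CF Cf.
  split=> // u Vu; apply: differentiable_comp; last exact: (Ck0 Cf (VU _ Vu)).
  by apply: differentiable_rV => a; exact: (Ck0 (CF a) Vu).
have dF u : V u -> differentiable F u.
  by move=> Vu; apply: differentiable_rV => a; exact: (Ck0 (CF a) Vu).
split=> [u Vu|i].
  by apply: differentiable_comp; [exact: dF|exact: (Ck0 Cf (VU _ Vu))].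
apply: (Ck_eq (f := fun u => \sum_a partial i (fun v => F v 0 a) u * (partial a f \o F) u)).
- by [].
- move=> u Vu; rewrite partial_comp //; [exact: dF|exact: (Ck0 Cf (VU _ Vu))].
apply: Ck_sum => // a.
by apply: CkM => //; [exact: (proj2 (CF a))|apply: IH => [b|]; [exact: CkW|exact: (proj2 Cf)]].
Qed.

End Chain.

(** The chosen point guarantees 1 != 0 in the ring of smooth functions, as a [comNzRingType]
    requires. *)
Record pointed_open (R : realType) (n : nat) := PointedOpen {
  po_set :> set 'rV[R]_n;
  po_open : open po_set;
  po_point : 'rV[R]_n;
  po_pointP : po_set po_point }.

(* Smooth functions on [U], normalized to vanish outside [U] so that Leibniz
   equality is equality on [U]. *)
Record sfun (R : realType) (n : nat) (U : pointed_open R n) := SFun {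
  sfun_val :> 'rV[R]_n -> R;
  sfun_smooth : forall k, Ck k U sfun_val;
  sfun_out : forall x, ~ po_set U x -> sfun_val x = 0 }.

Section SmoothRing.
Variables (R : realType) (n : nat) (U : pointed_open R n).
Local Notation T := (sfun U).

HB.instance Definition _ := gen_eqMixin T.
HB.instance Definition _ := gen_choiceMixin T.

Lemma sfunP (f g : T) : (forall x, po_set U x -> f x = g x) -> f = g.
Proof.
move=> e; have {e}: sfun_val f = sfun_val g.
  apply/funext => x; have [Ux|Ux] := pselect (po_set U x); first exact: e.
  by rewrite !sfun_out.
case: f g => [f f1 f2] [g g1 g2] /= fg; subst g.
by congr SFun; exact: Prop_irrelevance.
Qed.

Definition cut (f : 'rV[R]_n -> R) x : R := if pselect (po_set U x) then f x else 0.

Lemma cutE f x : po_set U x -> cut f x = f x.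
Proof. by move=> Ux; rewrite /cut; case: pselect. Qed.

Lemma cut_smooth f : (forall k, Ck k U f) -> forall k, Ck k U (cut f).
Proof.
by move=> Cf k; apply: Ck_eq (Cf k); [exact: po_open|move=> x Ux; rewrite cutE].
Qed.

Lemma cut_out f x : ~ po_set U x -> cut f x = 0.
Proof. by rewrite /cut; case: pselect. Qed.

(* [sig] of an opaque proof, so that unification never unfolds [mk] *)
Lemma mk_subproof f : (forall k, Ck k U f) -> {h : T | forall x, po_set U x -> h x = f x}.
Proof. by move=> Cf; exists (SFun (cut_smooth Cf) (@cut_out f)) => x Ux; exact: cutE. Qed.

Definition mk f (Cf : forall k, Ck k U f) : T := sval (mk_subproof Cf).

Lemma mkE f (Cf : forall k, Ck k U f) x : po_set U x -> mk Cf x = f x.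
Proof. exact: (svalP (mk_subproof Cf)). Qed.

Let oU := @po_open _ _ U.

Definition scst c : T := mk (fun k => Ck_cst k U c).
Definition sadd (f g : T) : T := mk (fun k => CkD oU (sfun_smooth f k) (sfun_smooth g k)).
Definition sopp (f : T) : T := mk (fun k => CkN oU (sfun_smooth f k)).
Definition smul (f g : T) : T := mk (fun k => CkM oU (sfun_smooth f k) (sfun_smooth g k)).

Ltac sfun_tac := move=> *; apply: sfunP => x Ux;
  rewrite !(mkE, fctE) //; try ring.

Lemma saddA : associative sadd. Proof. by sfun_tac. Qed.
Lemma saddC : commutative sadd. Proof. by sfun_tac. Qed.
Lemma sadd0 : left_id (scst 0) sadd. Proof. by sfun_tac. Qed.
Lemma saddN : left_inverse (scst 0) sopp sadd. Proof. by sfun_tac. Qed.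
Lemma smulA : associative smul. Proof. by sfun_tac. Qed.
Lemma smulC : commutative smul. Proof. by sfun_tac. Qed.
Lemma smul1 : left_id (scst 1) smul. Proof. by sfun_tac. Qed.
Lemma smulD : left_distributive smul sadd. Proof. by sfun_tac. Qed.
Lemma s1_neq0 : scst 1 != scst 0.
Proof.
apply/eqP => /(congr1 (fun f : T => f (po_point U))).
by rewrite !mkE; [move/eqP; rewrite oner_eq0|exact: po_pointP..].
Qed.

HB.instance Definition _ := GRing.isZmodule.Build T saddA saddC sadd0 saddN.
HB.instance Definition _ :=
  GRing.Zmodule_isComNzRing.Build T smulA smulC smul1 smulD s1_neq0.

End SmoothRing.

Section SmoothDerivations.
Variables (R : realType) (n : nat) (U : pointed_open R n).
Local Notation T := (sfun U).

(** The membership proof is an argument because evaluation is a ring morphism only at points of U: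
    outside, even 1 takes the value 0. *)
Definition seval x (Ux : po_set U x) (f : T) : R := f x.

Section Eval.
Variables (x : 'rV[R]_n) (Ux : po_set U x).

Lemma sevalD f g : seval Ux (f + g) = seval Ux f + seval Ux g.
Proof. exact: (mkE _ Ux). Qed.
Lemma sevalM f g : seval Ux (f * g) = seval Ux f * seval Ux g.
Proof. exact: (mkE _ Ux). Qed.
Lemma seval1 : seval Ux 1 = 1. Proof. exact: (mkE _ Ux). Qed.
Lemma seval0 : seval Ux 0 = 0. Proof. exact: (mkE _ Ux). Qed.

HB.instance Definition _ :=
  GRing.isNmodMorphism.Build T R (seval Ux) (conj seval0 sevalD).
HB.instance Definition _ :=
  GRing.isMonoidMorphism.Build T R (seval Ux) (conj seval1 sevalM).
End Eval.

Lemma sfun_eqP (f g : T) : (forall x (Ux : po_set U x), seval Ux f = seval Ux g) -> f = g.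
Proof. by move=> e; apply: sfunP => x Ux; exact: (e x Ux). Qed.

Lemma sfun_diff (f : T) x : po_set U x -> differentiable f x.
Proof. by move=> Ux; exact: Ck0 (sfun_smooth f 0) Ux. Qed.

Lemma sder_subproof a (f : T) : {h : T | forall x, po_set U x -> h x = partial a f x}.
Proof. by exists (mk (fun k => proj2 (sfun_smooth f k.+1) a)) => x Ux; exact: mkE. Qed.

Definition sder_fun a (f : T) : T := sval (sder_subproof a f).

Lemma sder_funE a (f : T) x : po_set U x -> sder_fun a f x = partial a f x.
Proof. exact: (svalP (sder_subproof a f)). Qed.

Lemma sder_near a (f : T) (h : 'rV[R]_n -> R) x : po_set U x ->
  (forall y, po_set U y -> f y = h y) -> sder_fun a f x = partial a h x.
Proof. by move=> Ux e; rewrite sder_funE //; exact: partial_eq (@po_open _ _ U) e Ux. Qed.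

Lemma sderD a (f h : T) : sder_fun a (f + h) = sder_fun a f + sder_fun a h.
Proof.
apply: sfunP => x Ux; rewrite (@sder_near a (f + h) ((f : _ -> R) + (h : _ -> R)) x) //; last first.
  by move=> y Uy; exact: mkE.
rewrite partialD; [|exact: sfun_diff..].
transitivity (sder_fun a f x + sder_fun a h x); first by rewrite !sder_funE.
exact: esym (sevalD Ux (sder_fun a f) (sder_fun a h)).
Qed.

Lemma sderM a (f h : T) : sder_fun a (f * h) = sder_fun a f * h + f * sder_fun a h.
Proof.
apply: sfunP => x Ux; rewrite (@sder_near a (f * h) ((f : _ -> R) * (h : _ -> R)) x) //; last first.
  by move=> y Uy; exact: mkE.
rewrite partialM; [|exact: sfun_diff..].
transitivity (sder_fun a f x * h x + f x * sder_fun a h x); first by rewrite !sder_funE.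
apply: esym; apply: etrans (sevalD Ux (sder_fun a f * h) (f * sder_fun a h)) _.
by rewrite !sevalM.
Qed.

Lemma sderC a b (f : T) : sder_fun a (sder_fun b f) = sder_fun b (sder_fun a f).
Proof.
apply: sfunP => x Ux.
have E c d : sder_fun c (sder_fun d f) x = partial c (partial d f) x.
  by apply: sder_near Ux _ => y Uy; exact: sder_funE.
apply: etrans (E a b) _; apply: etrans _ (esym (E b a)).
apply: (derive_swap (@po_open _ _ U) Ux).
- by move=> y Uy; exact: sfun_diff.
- by exact: (Ck0 (k := 0) (proj2 (sfun_smooth f 1) b) Ux).
- by exact: (Ck0 (k := 0) (proj2 (sfun_smooth f 1) a) Ux).
Qed.

Definition sder : derivations n T := Derivations sderD sderM sderC.

Lemma sder_val a (f : T) (h : 'rV[R]_n -> R) x : po_set U x ->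
  (forall y, po_set U y -> f y = h y) -> sder a f x = partial a h x.
Proof. exact: sder_near. Qed.

Lemma sumE m (f : 'I_m -> T) x : po_set U x -> (\sum_i f i) x = \sum_i f i x.
Proof. by move=> Ux; rewrite -/(seval Ux _) rmorph_sum. Qed.

Lemma smulE (f h : T) x : po_set U x -> (f * h) x = f x * h x.
Proof. by move=> Ux; rewrite -/(seval Ux _) rmorphM. Qed.

Lemma saddE (f h : T) x : po_set U x -> (f + h) x = f x + h x.
Proof. by move=> Ux; rewrite -/(seval Ux _) rmorphD. Qed.

Lemma soppE (f : T) x : po_set U x -> (- f) x = - f x.
Proof. by move=> Ux; rewrite -/(seval Ux _) rmorphN. Qed.

Lemma scstE c x : po_set U x -> scst U c x = c.
Proof. exact: mkE. Qed.

Lemma shalf : scst U 2^-1 + scst U 2^-1 = 1.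
Proof.
apply: sfun_eqP => x Ux; rewrite rmorphD rmorph1 /= /seval !scstE //.
by lra.
Qed.

Section InverseMetric.
Variable g : 'rV[R]_n -> 'M[R]_n.
Hypothesis g_smooth : forall a b k, Ck k U (fun x => g x a b).
Hypothesis gC : forall x, po_set U x -> (g x)^T = g x.
Hypothesis gU : forall x, po_set U x -> g x \in unitmx.

Definition slow a b : T := mk (g_smooth a b).

Let G : 'M[T]_n := \matrix_(a, b) slow a b.

Let GE x (Ux : po_set U x) : map_mx (seval Ux) G = g x.
Proof. by apply/matrixP => a b; rewrite !mxE; exact: mkE. Qed.

(** Cramer's rule: determinant and adjugate are formed in the ring of smooth functions, hence smooth
    by construction, and [CkV] inverts the determinant. *)
Lemma supp_smooth a b k : Ck k U (fun x => invmx (g x) a b).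
Proof.
pose D := \det G; pose C := (\adj G) a b.
have oU := @po_open _ _ U.
have DE x (Ux : po_set U x) : D x = \det (g x).
  by rewrite -GE det_map_mx.
have CE x (Ux : po_set U x) : C x = (\adj (g x)) a b.
  by rewrite -GE -map_mx_adj mxE.
have D0 x : po_set U x -> D x != 0.
  by move=> Ux; rewrite DE //; have := gU Ux; rewrite unitmxE unitfE.
apply: (Ck_eq oU) (CkM oU (CkV oU D0 (sfun_smooth D k)) (sfun_smooth C k)) => x Ux.
by rewrite /invmx gU // mxE fctE DE // CE.
Qed.

Definition supp a b : T := mk (supp_smooth a b).

Lemma slowC a b : slow a b = slow b a.
Proof. by apply: sfunP => x Ux; rewrite !mkE // -{1}gC // mxE. Qed.

Lemma suppC a b : supp a b = supp b a.
Proof. by apply: sfunP => x Ux; rewrite !mkE // -{1}gC // -trmx_inv mxE. Qed.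

Lemma suppK a c : \sum_b supp a b * slow b c = (a == c)%:R.
Proof.
apply: sfun_eqP => x Ux; rewrite rmorph_sum rmorph_nat.
have := congr1 (fun M : 'M[R]_n => M a c) (mulVmx (gU Ux)); rewrite !mxE => <-.
by apply: eq_bigr => b _; rewrite rmorphM /= /seval !mkE.
Qed.

Definition smetric : metric n T := Metric slowC suppC suppK.

End InverseMetric.
End SmoothDerivations.

(** * Pullback of smooth functions along the parametrization *)

Section Pullback.
Variables (R : realType) (m n : nat) (V : pointed_open R m) (U : pointed_open R n).
Variable F : 'rV[R]_m -> 'rV[R]_n.
Hypothesis F_smooth : forall a k, Ck k V (fun u => F u 0 a).
Hypothesis FU : forall u, po_set V u -> po_set U (F u).

Definition spull (f : sfun U) : sfun V :=
  mk (fun k => Ck_comp (@po_open _ _ V) FU (F_smooth^~ k) (sfun_smooth f k)).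

Lemma spullE f u : po_set V u -> spull f u = f (F u).
Proof. exact: mkE. Qed.

Lemma spull0 : spull 0 = 0.
Proof. by apply: sfunP => u Vu; rewrite spullE // -/(seval (FU Vu) _) -/(seval Vu _) !rmorph0. Qed.
Lemma spullD f g : spull (f + g) = spull f + spull g.
Proof. by apply: sfunP => u Vu; rewrite saddE // !spullE // saddE //; exact: FU. Qed.
Lemma spull1 : spull 1 = 1.
Proof. by apply: sfunP => u Vu; rewrite spullE // -/(seval (FU Vu) _) -/(seval Vu _) !rmorph1. Qed.
Lemma spullM f g : spull (f * g) = spull f * spull g.
Proof. by apply: sfunP => u Vu; rewrite smulE // !spullE // smulE //; exact: FU. Qed.

HB.instance Definition _ :=
  GRing.isNmodMorphism.Build (sfun U) (sfun V) spull (conj spull0 spullD).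
HB.instance Definition _ :=
  GRing.isMonoidMorphism.Build (sfun U) (sfun V) spull (conj spull1 spullM).

Definition scoord a : sfun V := mk (F_smooth a).

Definition sjac i a : sfun V := sder V i (scoord a).

Lemma sjacC i j a : sder V i (sjac j a) = sder V j (sjac i a).
Proof. exact: derC. Qed.

Lemma spull_diff u : po_set V u -> differentiable F u.
Proof. by move=> Vu; apply: differentiable_rV => a; exact: Ck0 (F_smooth a 0) Vu. Qed.

Lemma sjacE i a u : po_set V u -> sjac i a u = jacobian F u i a.
Proof.
move=> Vu; rewrite jacobianE; last exact: spull_diff.
by apply: sder_val => // v Vv; exact: mkE.
Qed.

Lemma spull_chain i f : sder V i (spull f) = \sum_a sjac i a * spull (sder U a f).
Proof.
apply: sfunP => u Vu; rewrite (@sder_val _ _ V i (spull f) (f \o F) u) //; last first.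
  by move=> v Vv; exact: spullE.
rewrite partial_comp; [|exact: spull_diff|exact/sfun_diff/FU].
rewrite sumE //; apply: eq_bigr => a _; rewrite smulE // spullE // sjacE //.
rewrite jacobianE; last exact: spull_diff.
by congr (_ * _); rewrite (@sder_val _ _ U a f f (F u)) //; exact: FU.
Qed.

End Pullback.

(** * Coordinate expressions *)

Section Transport.
Variables (R : realType) (n : nat) (U : pointed_open R n).
Variable g : 'rV[R]_n -> 'M[R]_n.
Hypothesis g_smooth : forall a b k, Ck k U (fun x => g x a b).
Hypothesis gC : forall x, po_set U x -> (g x)^T = g x.
Hypothesis gU : forall x, po_set U x -> g x \in unitmx.

Local Notation D := (sder U).
Local Notation G := (smetric g_smooth gC gU).
Local Notation hf := (scst U 2^-1).
Local Notation "f ~~ h" := (forall x, po_set U x -> f x = sfun_val h x) (at level 70).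

(** Agreement on all of the open set U is what lets the comparison pass under derivatives and be
    iterated in the lemmas that follow. *)
Lemma partial_sder a f (h : sfun U) : f ~~ h -> partial a f ~~ D a h.
Proof. by move=> e x Ux; rewrite (@sder_val _ _ _ a h f x) // => y Uy; rewrite e. Qed.

Lemma low_val a b : (fun x => g x a b) ~~ G a b.
Proof. by move=> x Ux; rewrite mkE. Qed.

Lemma ginv_val a b : ginv g a b ~~ upp G a b.
Proof. by move=> x Ux; rewrite mkE. Qed.

Lemma christoffel_val c a b : christoffel g c a b ~~ chr D G hf c a b.
Proof.
move=> x Ux; rewrite /christoffel /chr smulE // scstE // sumE //; congr (_ * _).
apply: eq_bigr => e _; rewrite !(smulE, saddE, soppE) // -ginv_val //.
by rewrite !(partial_sder _ (low_val _ _)).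
Qed.

Lemma riemann_val a b c e : riemann g a b c e ~~ riem D G hf a b c e.
Proof.
move=> x Ux; rewrite /riemann /riem !(saddE, soppE, sumE) //.
rewrite !(partial_sder _ (christoffel_val _ _ _)) //; congr (_ + _).
apply: eq_bigr => f _; rewrite (saddE _ _ Ux) (soppE _ Ux) !(christoffel_val _ _ _ Ux).
by rewrite !(smulE (chr D G hf _ _ _) _ Ux).
Qed.

Lemma ricci_val a b : ricci g a b ~~ ric D G hf a b.
Proof.
by move=> x Ux; rewrite /ricci /ric sumE //; apply: eq_bigr => c _; rewrite riemann_val.
Qed.

Lemma ctr_val T (T' : 'I_n -> 'I_n -> sfun U) : (forall a b, T a b ~~ T' a b) ->
  (fun x => \sum_a \sum_b ginv g a b x * T a b x) ~~ ctr G T'.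
Proof.
move=> e x Ux; rewrite /ctr sumE //; apply: eq_bigr => a _; rewrite sumE //.
by apply: eq_bigr => b _; rewrite smulE // ginv_val // e.
Qed.

Lemma scalar_val : scalar_curv g ~~ scal D G hf.
Proof. exact: ctr_val ricci_val. Qed.

Lemma nab1_val S (S' : 'I_n -> sfun U) c a : (forall a, S a ~~ S' a) ->
  (fun x => partial c (S a) x - \sum_e christoffel g e c a x * S e x) ~~ nab1 D G hf S' c a.
Proof.
move=> e x Ux; rewrite /nab1 !(saddE, soppE, sumE) // (partial_sder _ (e a)) //.
by congr (_ - _); apply: eq_bigr => f _; rewrite smulE // christoffel_val // e.
Qed.

Lemma laplacian_val f (h : sfun U) : f ~~ h -> laplacian g f ~~ lap D G hf h.
Proof.
by move=> e; apply: ctr_val => a b; apply: nab1_val => c; exact: partial_sder.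
Qed.

Lemma nabla2_val (T : tensor2 R n) (T' : 'I_n -> 'I_n -> sfun U) c a b :
  (forall a b, T a b ~~ T' a b) -> nabla2 g T c a b ~~ nab2 D G hf T' c a b.
Proof.
move=> e x Ux; rewrite /nabla2 /nab2 big_split !(saddE, soppE, sumE) //.
rewrite (partial_sder _ (e a b)) // opprD addrA.
by congr (_ - _ - _); apply: eq_bigr => f _; rewrite smulE // christoffel_val // e.
Qed.

Lemma nabla3_val (T : tensor3 R n) (T' : 'I_n -> 'I_n -> 'I_n -> sfun U) d c a b :
  (forall c a b, T c a b ~~ T' c a b) -> nabla3 g T d c a b ~~ nab3 D G hf T' d c a b.
Proof.
move=> e x Ux; rewrite /nabla3 /nab3 !big_split !(saddE, soppE, sumE) //.
rewrite (partial_sder _ (e c a b)) // !opprD !addrA.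
by congr (_ - _ - _ - _); apply: eq_bigr => f _; rewrite smulE // christoffel_val // e.
Qed.

Lemma inner1_val u v (u' v' : 'I_n -> sfun U) :
  (forall a, u a ~~ u' a) -> (forall a, v a ~~ v' a) ->
  inner1 g u v ~~ dot G u' v'.
Proof.
move=> e f x Ux; rewrite -(ctr_val (T := fun a b x => u a x * v b x)) //.
  by apply: eq_bigr => a _; apply: eq_bigr => b _; rewrite mulrA.
by move=> a b y Uy; rewrite smulE // e // f.
Qed.

Lemma inner2_val (S T : tensor2 R n) (S' T' : 'I_n -> 'I_n -> sfun U) :
  (forall a b, S a b ~~ S' a b) -> (forall a b, T a b ~~ T' a b) ->
  inner2 g S T ~~ dot2 G S' T'.
Proof.
move=> e f x Ux; rewrite -(ctr_val (T := fun a c => inner1 g (S a) (T c))) //.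
  apply: eq_bigr => a _; rewrite exchange_big; apply: eq_bigr => c _ /=.
  rewrite /inner1 mulr_sumr; apply: eq_bigr => b _.
  by rewrite mulr_sumr; apply: eq_bigr => d _; rewrite !mulrA.
by move=> a c; apply: inner1_val; [exact: e|exact: f].
Qed.

Lemma inner3_val (S T : tensor3 R n) (S' T' : 'I_n -> 'I_n -> 'I_n -> sfun U) :
  (forall c a b, S c a b ~~ S' c a b) -> (forall c a b, T c a b ~~ T' c a b) ->
  inner3 g S T ~~ ctr G (fun a b => dot2 G (S' a) (T' b)).
Proof.
move=> e f x Ux; rewrite -(ctr_val (T := fun a d => inner2 g (S a) (T d))) //.
  apply: eq_bigr => a _.
  have -> : \sum_d ginv g a d x * inner2 g (S a) (T d) x
    = \sum_d \sum_b \sum_c \sum_e0 \sum_h ginv g a d x *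
        (ginv g b e0 x * ginv g c h x * S a b c x * T d e0 h x).
    apply: eq_bigr => d _; rewrite /inner2 mulr_sumr; apply: eq_bigr => b _.
    rewrite mulr_sumr; apply: eq_bigr => c _; rewrite mulr_sumr; apply: eq_bigr => e0 _.
    by rewrite mulr_sumr.
  rewrite [RHS]exchange_big; apply: eq_bigr => b _; rewrite [RHS]exchange_big.
  apply: eq_bigr => c _; apply: eq_bigr => d _; apply: eq_bigr => e0 _.
  by apply: eq_bigr => h _; rewrite !mulrA.
by move=> a d; apply: inner2_val; [exact: e|exact: f].
Qed.

Lemma divdiv2_val (T : tensor2 R n) (T' : 'I_n -> 'I_n -> sfun U) :
  (forall a b, T a b ~~ T' a b) ->
  divdiv2 g T ~~ ctr G (fun a c => ctr G (fun b d => nab3 D G hf (nab2 D G hf T') a b c d)).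
Proof.
move=> e x Ux.
pose N a b c d := nabla3 g (nabla2 g T) a b c d.
rewrite -(ctr_val (T := fun a c x => \sum_b \sum_d ginv g b d x * N a b c d x)) //.
  apply: eq_bigr => a _; rewrite exchange_big; apply: eq_bigr => c _ /=.
  rewrite mulr_sumr; apply: eq_bigr => b _.
  by rewrite mulr_sumr; apply: eq_bigr => d _; rewrite !mulrA.
move=> a c; apply: ctr_val => b d; apply: nabla3_val => c' a' b'.
exact: nabla2_val.
Qed.

Lemma laplacian2_val (T : tensor2 R n) (T' : 'I_n -> 'I_n -> sfun U) a b :
  (forall a b, T a b ~~ T' a b) ->
  laplacian2 g T a b ~~ ctr G (fun c d => nab3 D G hf (nab2 D G hf T') c d a b).
Proof.
by move=> e; apply: ctr_val => c d; apply: nabla3_val => c' a' b'; exact: nabla2_val.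
Qed.

Lemma div2_val (T : tensor2 R n) (T' : 'I_n -> 'I_n -> sfun U) a :
  (forall a b, T a b ~~ T' a b) ->
  div2 g T a ~~ ctr G (fun b c => nab2 D G hf T' c a b).
Proof. by move=> e; apply: ctr_val => b c; exact: nabla2_val. Qed.

Lemma grad_val f h (f' h' : sfun U) : f ~~ f' -> h ~~ h' ->
  (fun x => (grad f x *m invmx (g x) *m (grad h x)^T) 0 0) ~~ dot G (D^~ f') (D^~ h').
Proof.
move=> e e' x Ux.
rewrite -(@inner1_val ((@partial R n)^~ f) ((@partial R n)^~ h)) //; first last.
- by move=> a; exact: partial_sder.
- by move=> a; exact: partial_sder.
rewrite /inner1 -mulmxA mxE; apply: eq_bigr => a _.
rewrite !mxE mulr_sumr; apply: eq_bigr => b _.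
by rewrite !mxE /ginv; ring.
Qed.

End Transport.

Lemma posdef_unitmx (R : realType) n (A : 'M[R]_n) :
  (forall v : 'rV_n, v != 0 -> 0 < (v *m A *m v^T) 0 0) -> A \in unitmx.
Proof.
move=> pos; rewrite unitmxE unitfE; apply/negP => /det0P[v v0 vA].
by have := pos v v0; rewrite vA mul0mx mxE ltxx.
Qed.

(** * Both formulas in one chart: q = 0 for surfaces, q = 1 for dimension four *)

Section Coordinates.
Variables (R : realType) (q : nat).
Local Notation m := q.+2.
Local Notation n := q.+3.
Variables (U : pointed_open R n) (V : pointed_open R m).
Variables (g : 'rV[R]_n -> 'M[R]_n) (F nu : 'rV[R]_m -> 'rV[R]_n).
Variables (s B : 'rV[R]_n -> R).
Hypothesis g_smooth : forall a b k, Ck k U (fun x => g x a b).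
Hypothesis gC : forall x, po_set U x -> (g x)^T = g x.
Hypothesis g_pos : forall x, po_set U x -> forall v : 'rV_n, v != 0 ->
  0 < (v *m g x *m v^T) 0 0.
Hypothesis F_smooth : forall a k, Ck k V (fun u => F u 0 a).
Hypothesis FU : forall u, po_set V u -> po_set U (F u).
Hypothesis F_imm : forall u, po_set V u -> row_free (jacobian F u).
Hypothesis s_smooth : forall k, Ck k U s.
Hypothesis B_smooth : forall k, Ck k U B.
Hypothesis Isq : forall x, po_set U x -> Isquare g s x = 1 + s x ^+ n * B x.
Hypothesis sF : forall u, po_set V u -> s (F u) = 0.
Hypothesis nuP : forall u, po_set V u ->
  [/\ nu u *m (jacobian F u)^T = 0,
      (nu u *m invmx (g (F u)) *m (nu u)^T) 0 0 = 1 &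
      0 < (nu u *m invmx (g (F u)) *m (grad s (F u))^T) 0 0].

Local Notation gbar := (induced_metric g F).
Local Notation dA := (sder U).
Local Notation dB := (sder V).
Local Notation half := (scst U 2^-1).
Local Notation r := (spull F_smooth FU : {rmorphism sfun U -> sfun V}).
Local Notation J := (sjac F_smooth).
Local Notation "f ~~ h" := (forall u, po_set V u -> f u = sfun_val h u) (at level 70).

Let gU x (Ux : po_set U x) : g x \in unitmx := posdef_unitmx (g_pos Ux).
Local Notation gA := (smetric g_smooth gC gU).

Let S : sfun U := mk s_smooth.
Let Bd : sfun U := mk B_smooth.
Let Jsc : sfun U := scst U (2 * (n%:R - 1))^-1 * scal dA gA half.
Let rho : sfun U := scst U (- n%:R^-1) * (lap dA gA half S + Jsc * S).

Lemma scst_nat k (W : pointed_open R k) j : scst W j%:R = j%:R.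
Proof. by apply: sfun_eqP => x Wx; rewrite rmorph_nat; exact: scstE. Qed.

Lemma scstM k (W : pointed_open R k) a b : scst W (a * b) = scst W a * scst W b.
Proof. by apply: sfunP => x Wx; rewrite smulE // !scstE. Qed.

Lemma rhoE : n%:R * rho = - (lap dA gA half S + Jsc * S).
Proof.
rewrite mulrA -scst_nat -scstM mulrN mulfV ?pnatr_eq0 //.
have -> : scst U (- 1) = - 1.
  by apply: sfun_eqP => x Ux; rewrite rmorphN rmorph1; exact: scstE.
by rewrite mulN1r.
Qed.

Lemma Jsc_val x : po_set U x -> schoutenJ g x = Jsc x.
Proof.
by move=> Ux; rewrite /schoutenJ smulE // scstE // (scalar_val g_smooth gC gU) // mulrC.
Qed.

Lemma S_val x : po_set U x -> s x = S x.
Proof. by move=> Ux; rewrite mkE. Qed.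

Lemma IsqE : dot gA (dA^~ S) (dA^~ S) + (S * rho) *+ 2 = 1 + S ^+ q.+3 * Bd.
Proof.
apply: sfunP => x Ux; transitivity (Isquare g s x).
  rewrite mulr2n !saddE // -(grad_val g_smooth gC gU S_val S_val) //.
  rewrite !smulE // scstE // saddE // smulE // -(laplacian_val g_smooth gC gU S_val) //.
  rewrite -Jsc_val // -S_val // /Isquare.
  have : n%:R != 0 :> R by rewrite pnatr_eq0.
  by move: (n%:R : R) => N N0; field.
rewrite Isq // -[RHS]/(seval Ux (1 + S ^+ n * Bd)).
by rewrite rmorphD rmorphM rmorphXn rmorph1 /= /seval -S_val // mkE.
Qed.

(** The calculus takes the restriction of ds as conormal; [conormal_val] identifies it with the
    given [nu]. *)
Let na a : sfun V := r (dA a S).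
Let nA a : sfun V := \sum_b r (upp gA a b) * na b.

Lemma naE a : na a = \sum_b r (gA a b) * nA b.
Proof.
rewrite /nA /na -{1}(lower_raise gA (dA^~ S) a) rmorph_sum; apply: eq_bigr => b _.
rewrite rmorphM rmorph_sum; congr (_ * _).
by apply: eq_bigr => c _; rewrite rmorphM.
Qed.

Lemma rS0 : r S = 0.
Proof.
apply: sfun_eqP => u Vu; rewrite rmorph0 /seval /= spullE // mkE ?sF //; exact: FU.
Qed.

Lemma naJ i : ev1 na (J i) = 0.
Proof.
by apply: etrans (esym (spull_chain F_smooth FU i S)) _; rewrite -/(r S) rS0 der0.
Qed.

Lemma nanA : ev1 na nA = 1.
Proof.
have := congr1 r IsqE; rewrite !rmorphD !(rmorphM r) rmorph1 rS0 !mul0r !addr0 => <-.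
rewrite /ev1 /nA /dot /ctr rmorph_sum; apply: eq_bigr => a _.
rewrite mulr_suml rmorph_sum; apply: eq_bigr => b _.
rewrite (rmorphM r) (rmorphM r (dA a S)) -/(na a) -/(na b).
by rewrite -[LHS]mulrA [na b * _]mulrC.
Qed.

(** The induced metric written inside the ring, from which the smoothness of [gbar] is read off. *)
Definition tangent_metric i j : sfun V := ev2 (fun a b => r (gA a b)) (J i) (J j).

Lemma tangent_metricE i j u : po_set V u -> tangent_metric i j u = gbar u i j.
Proof.
move=> Vu; rewrite /tangent_metric /ev2 /ev1 sumE // /induced_metric -mulmxA mxE.
apply: eq_bigr => a _; rewrite smulE // sjacE // sumE //; congr (_ * _).
rewrite mxE; apply: eq_bigr => b _; rewrite smulE // sjacE // spullE // mkE; last exact: FU.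
by rewrite mulrC [_^T _ _]mxE.
Qed.

Lemma gbar_smooth i j k : Ck k V (fun u => gbar u i j).
Proof.
apply: (Ck_eq (@po_open _ _ V)) (sfun_smooth (tangent_metric i j) k) => u Vu.
exact: tangent_metricE.
Qed.

Lemma gbarC u : po_set V u -> (gbar u)^T = gbar u.
Proof. by move=> Vu; rewrite /induced_metric !trmx_mul trmxK gC ?mulmxA //; exact: FU. Qed.

Lemma gbarU u : po_set V u -> gbar u \in unitmx.
Proof.
move=> Vu; apply: posdef_unitmx => v v0.
have := g_pos (FU Vu) (v := v *m jacobian F u); rewrite mulmx_free_eq0 ?F_imm // => /(_ v0).
by rewrite /induced_metric trmx_mul !mulmxA.
Qed.

Local Notation gB := (smetric gbar_smooth gbarC gbarU).

Lemma gBE i j : gB i j = ev2 (fun a b => r (gA a b)) (J i) (J j).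
Proof. by apply: sfunP => u Vu; rewrite mkE // -tangent_metricE. Qed.

(* The inverse metric splits into a tangential part, which kills covectors vanishing on the
   tangent space, and the square of the normal: such covectors are multiples of [na]. *)
Lemma conormal_val u a : po_set V u -> nu u 0 a = na a u.
Proof.
move=> Vu; have [nuJ nunu nus] := nuP Vu; have Ux := FU Vu.
set Gi := invmx (g (F u)) in nunu nus.
pose N : 'rV[R]_n := \row_a na a u.
have sN : grad s (F u) = N.
  apply/rowP => b; rewrite !mxE spullE // (@sder_val _ _ U b S s) // => y Uy.
  exact/esym/S_val.
have NA b : (N *m Gi) 0 b = nA b u.
  rewrite mxE /nA sumE //; apply: eq_bigr => c _.
  rewrite smulE // spullE // mkE // -[in RHS]gC // -trmx_inv ![in RHS]mxE.
  by rewrite mxE mulrC.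
have GiE : Gi = (jacobian F u)^T *m invmx (gbar u) *m jacobian F u + (N *m Gi)^T *m (N *m Gi).
  apply/matrixP => b c; have := congr1 (fun f : sfun V => f u) (upp_split gBE naE naJ nanA b c).
  rewrite spullE // mkE // -/Gi => ->; rewrite saddE // smulE // -!NA.
  rewrite [RHS]mxE; congr (_ + _); last by rewrite [RHS]mxE big_ord1 [_^T _ _]mxE.
  rewrite -mulmxA [RHS]mxE sumE //; apply: eq_bigr => i _.
  rewrite sumE // [(_ *m _) _ _]mxE mulr_sumr.
  apply: eq_bigr => j _; rewrite !smulE // !sjacE // mkE // [_^T _ _]mxE.
  by ring.
pose l := (nu u *m (N *m Gi)^T) 0 0.
have nuE : nu u = l *: N.
  have : nu u *m Gi = l *: (N *m Gi).
    rewrite {1}GiE mulmxDr !mulmxA nuJ !mul0mx add0r -mulmxA [_ *m (_ *m Gi)^T]mx11_scalar.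
    by rewrite mul_scalar_mx.
  move=> /(congr1 (mulmx^~ (g (F u)))); rewrite -!scalemxAl -!mulmxA mulVmx ?gU //.
  by rewrite !mulmx1.
have N1 : (N *m Gi *m N^T) 0 0 = 1.
  have := congr1 (fun f : sfun V => f u) nanA; rewrite -[RHS]/(seval Vu 1) rmorph1 => <-.
  rewrite /ev1 sumE // mxE; apply: eq_bigr => b _; rewrite smulE // [_^T _ _]mxE.
  by rewrite [N _ _]mxE NA.
(* Both covectors have length one, which leaves a sign; the orientation condition decides it. *)
have l2 : l ^+ 2 = 1.
  rewrite -nunu nuE linearZ /= -scalemxAr -!scalemxAl !mxE -/(_ *m _).
  have := N1; rewrite mxE => ->; ring.
have l0 : 0 < l.
  by move: nus; rewrite sN nuE -!scalemxAl mxE N1 mulr1.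
have l1 : l = 1.
  by apply/eqP; rewrite -(@eqrXn2 _ 2) ?ler01 ?ltW // l2 expr1n.
by rewrite nuE l1 scale1r mxE.
Qed.

Local Notation II := (sff dA dB r J gA half na).
Local Notation II0 := (sff0 dA r J gA half S rho).
Local Notation h := (nab2 dB gB (r half) II0).

Lemma nabla_conormal_val i b : nabla_conormal g F nu i b ~~ Dlow dA dB r J gA half i na b.
Proof.
move=> u Vu; have Ux := FU Vu; rewrite /nabla_conormal /Dlow saddE // soppE // sumE //.
congr (_ - _); first by apply/esym/sder_val => // v Vv; rewrite conormal_val.
rewrite exchange_big; apply: eq_bigr => c _ /=.
rewrite smulE // /cn sumE // mulr_suml -conormal_val //; apply: eq_bigr => a _.
rewrite smulE // sjacE // spullE // (christoffel_val g_smooth gC gU) //.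
by rewrite (mulrC (jacobian _ _ _ _)).
Qed.

Lemma second_ff_val i j : second_ff g F nu i j ~~ II i j.
Proof.
move=> u Vu; rewrite /second_ff /sff /ev1 sumE //; apply: eq_bigr => b _.
by rewrite smulE // sjacE // nabla_conormal_val // mulrC.
Qed.

Lemma mean_curv_val : mean_curv g F nu ~~ - r rho.
Proof.
move=> u Vu; rewrite /mean_curv /trace2.
rewrite (ctr_val gbar_smooth gbarC gbarU second_ff_val) //.
rewrite (tr_sff (spull_chain F_smooth FU) (shalf U) gBE naE naJ nanA rS0 (fun=> erefl) rhoE IsqE).
by rewrite !soppE // smulE // mulrN -scst_nat scstE // mulrA mulVf ?mul1r //.
Qed.

Lemma tracefree_ff_val i j : tracefree_ff g F nu i j ~~ II0 i j.
Proof.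
move=> u Vu; rewrite /tracefree_ff second_ff_val // mean_curv_val //.
rewrite (sff0E (spull_chain F_smooth FU) half gBE rho (fun=> erefl)).
rewrite saddE // smulE // soppE // mulNr opprK; congr (_ + _ * _).
exact/esym/(mkE _ Vu).
Qed.

Lemma tr_II0 : \tr (endo gB II0) = 0.
Proof.
exact: (tr_x (spull_chain F_smooth FU) (shalf U) gBE naE naJ nanA rS0 (fun=> erefl) rhoE IsqE).
Qed.

Lemma rhalf : r half = scst V 2^-1.
Proof. by apply: sfunP => u Vu; rewrite /= spullE // !scstE //; exact: FU. Qed.

Lemma Bd_val u : po_set V u -> B (F u) = r Bd u.
Proof. by move=> Vu; rewrite /= spullE // mkE //; exact: FU. Qed.

Local Notation IIring := (tracefree_ff g F nu).

Lemma flat4_val u : q = 1%N -> po_set V u ->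
  (forall x, po_set U x -> forall a b c e, riemann g a b c e x = 0) ->
  B (F u) = 6^-1 * (inner3 gbar (nabla2 gbar IIring) (nabla2 gbar IIring) u
                    + 2 * inner2 gbar IIring (laplacian2 gbar IIring) u
                    + 3 / 2 * inner1 gbar (div2 gbar IIring) (div2 gbar IIring) u
                    - 2 * schoutenJ gbar u * inner2 gbar IIring IIring u
                    + inner2 gbar IIring IIring u ^+ 2).
Proof.
move=> q1 Vu flat.
have riem0 a b c e : riem dA gA half a b c e = 0.
  apply: sfun_eqP => x Ux; rewrite rmorph0 /seval /=.
  by rewrite -(riemann_val g_smooth gC gU) // flat.
have Jsc0 : Jsc = 0 by rewrite /Jsc scal0 ?mulr0.
have m3 : m = 3%N by rewrite q1.
have m3A : m%:R = 3%:R :> sfun U := congr1 (fun k => k%:R) m3.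
have t4 : \tr (endo gB II0 *m endo gB II0 *m endo gB II0 *m endo gB II0) *+ 2
    = \tr (endo gB II0 *m endo gB II0) ^+ 2.
  exact: trace_fourth3 m3 tr_II0.
have key := obstruction_flat4 (spull_chain F_smooth FU) (sjacC F_smooth) (shalf U) gBE naE naJ
  nanA rS0 (fun=> erefl) rhoE IsqE riem0 Jsc0 q1 m3A t4.
rewrite rhalf in key.
have IIv := tracefree_ff_val.
have hv c a b := nabla2_val gbar_smooth gbarC gbarU c a b IIv.
have dv a := div2_val gbar_smooth gbarC gbarU a IIv.
have lv a b := laplacian2_val gbar_smooth gbarC gbarU a b IIv.
(* The hypersurface has dimension 3, so its J is Sc / (2 (3 - 1)). *)
have JE : schoutenJ gbar u = 4^-1 * scal dB gB (scst V 2^-1) u.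
  have m3R : m%:R = 3 :> R := congr1 (fun k => k%:R) m3.
  rewrite /schoutenJ (scalar_val gbar_smooth gbarC gbarU Vu) m3R.
  by move: (sfun_val _ _) => z; field.
rewrite (inner3_val gbar_smooth gbarC gbarU hv hv Vu).
rewrite (inner2_val gbar_smooth gbarC gbarU IIv lv Vu).
rewrite (inner1_val gbar_smooth gbarC gbarU dv dv Vu).
rewrite (inner2_val gbar_smooth gbarC gbarU IIv IIv Vu) {}JE.
(* Evaluation at u and division by 12; generic y's keep the tensor expressions opaque to [lra]. *)
have val (x y1 y2 y3 y4 y5 : sfun V) :
    12%:R * x = y1 *+ 2 + y2 *+ 4 + y3 *+ 3 - y4 * y5 + y5 ^+ 2 *+ 2 ->
    x u = 6^-1 * (y1 u + 2 * y2 u + 3 / 2 * y3 u - 2 * (4^-1 * y4 u) * y5 u + y5 u ^+ 2).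
  move=> /(congr1 (seval Vu)).
  rewrite !(rmorphD, rmorphN, rmorphM, rmorphMn, rmorphXn, rmorph_nat, rmorph1) /= /seval.
  lra.
exact: etrans (Bd_val Vu) (val _ _ _ _ _ _ key).
Qed.

Lemma surface_val u : q = 0%N -> po_set V u ->
  B (F u) = - 3^-1 * (divdiv2 gbar IIring u
                      + mean_curv g F nu u * inner2 gbar IIring IIring u
                      + inner2 gbar (schouten_top g F) IIring u).
Proof.
move=> q0 Vu.
have m2 : m = 2%N by rewrite q0.
have m2A : m%:R = 2%:R :> sfun U := congr1 (fun k => k%:R) m2.
(* In ambient dimension 3 the factor 2 (n - 1) in the definition of J is 4. *)
have scalE : scal dA gA half = 4%:R * Jsc.
  rewrite /Jsc mulrA -scst_nat -scstM.
  have -> : 4 * (2 * (n%:R - 1))^-1 = 1 :> R by rewrite q0; field.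
  by rewrite -[1]/(1%:R) scst_nat mul1r.
have t3 : \tr (endo gB II0 *m endo gB II0 *m endo gB II0) = 0.
  exact: trace_cube2 m2 tr_II0.
have tr0 : ctr gB II0 = 0 by rewrite ctrE tr_II0.
have R40 (R4 : 'I_m -> 'I_m -> 'I_m -> 'I_m -> sfun V) :
    (forall k i l j, R4 i k l j = - R4 k i l j) ->
    (forall k i l j, R4 k i j l = - R4 k i l j) ->
    dot2 gB II0 (fun i j => ctr gB (fun k l => R4 k i l j)) = 0.
  exact: contract_curvature2 m2 (shalf V) tr0.
have key := obstruction3 (spull_chain F_smooth FU) (sjacC F_smooth) (shalf U) gBE naE naJ
  nanA rS0 (fun=> erefl) rhoE IsqE q0 m2A scalE t3 R40.
pose rc i j : sfun V := ev2 (fun a b => r (ric dA gA half a b)) (J i) (J j).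
rewrite rhalf -/rc in key.
have IIv := tracefree_ff_val.
(* In ambient dimension 3 the divisor n - 2 is 1, so P = Ric - J g; the multiple of g disappears
   against the trace-free II0. *)
have Pv i j : schouten_top g F i j ~~ rc i j + - r Jsc * gB i j.
  move=> w Vw; have Ux := FU Vw; have n1 : n%:R - 2 = 1 :> R by rewrite q0; ring.
  rewrite gBE -ev2Z -ev2D /schouten_top /ev2 /ev1 sumE //; apply: eq_bigr => a _.
  rewrite smulE // sumE // mulr_sumr; apply: eq_bigr => b _.
  rewrite smulE // !sjacE // !(saddE, smulE, soppE) // !spullE //.
  rewrite mulrA /schouten n1 divr1 (ricci_val g_smooth gC gU) // (Jsc_val Ux) mulNr.
  by congr (_ * (_ - _ * _)); exact: (low_val g_smooth gC gU).
have rcE : dot2 gB II0 rc = dot2 gB (fun i j => rc i j + - r Jsc * gB i j) II0.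
  by rewrite dot2Dl dot2Zl // dot2_lowl tr0 mulr0 addr0 dot2C.
rewrite {}rcE in key.
rewrite (divdiv2_val gbar_smooth gbarC gbarU IIv Vu).
rewrite (inner2_val gbar_smooth gbarC gbarU IIv IIv Vu).
rewrite (inner2_val gbar_smooth gbarC gbarU Pv IIv Vu) (mean_curv_val Vu).
have val (x y1 y2 y3 y4 : sfun V) : - (3%:R * x) = y1 - y2 * y3 + y4 ->
    x u = - 3^-1 * (y1 u + (- y2) u * y3 u + y4 u).
  move=> /(congr1 (seval Vu)); rewrite (soppE _ Vu).
  rewrite !(rmorphD, rmorphN, rmorphM, rmorphMn, rmorph_nat, rmorph1) /= /seval.
  lra.
exact: etrans (Bd_val Vu) (val _ _ _ _ _ key).
Qed.

End Coordinates.

(** * From the manifold to a chart and a local parametrization *)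

Section EmbeddedHypersurface.
Variables (R : realType) (q : nat) (M : oriented_manifold R q.+3).
Variables (c : set (metric_components M)) (S : set M).
Variables (sigma beta : metric_components M -> M -> R) (g : metric_components M).
Variables (V : set 'rV[R]_q.+2) (X : 'rV[R]_q.+2 -> M) (k : chart M).
Variables (nu : 'rV[R]_q.+2 -> 'rV[R]_q.+3) (u : 'rV[R]_q.+2).
Hypotheses (cc : conformal_class c) (ob : obstruction_density c S sigma beta).
Hypotheses (cg : c g) (par : local_param S V X).
Hypothesis nuP : unit_conormal g (sigma g) V X k nu.
Hypotheses (Vu : V u) (ku : chart_dom k (X u)).

Local Notation gk := (in_chart (g k) k).
Local Notation F := (chart_map k \o X).
Local Notation s := (in_chart (sigma g) k).
Local Notation II0 := (tracefree_ff gk F nu).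
Local Notation gbar := (induced_metric gk F).

Lemma in_chartE T (f : M -> T) p : chart_dom k p -> in_chart f k (chart_map k p) = f p.
Proof. by move=> kp; rewrite /in_chart /= chart_mapK. Qed.

Definition chart_range : pointed_open R q.+3 :=
  PointedOpen (@chart_image_open _ _ M k) (ex_intro2 _ _ _ ku erefl).

Lemma param_dom_open : open (V `&` X @^-1` chart_dom k).
Proof.
have [oV _ Xc _ _] := par.
rewrite openE => v [Vv kv]; apply: filterI; first exact: open_nbhs_nbhs.
exact: Xc Vv _ (open_nbhs_nbhs (conj (@chart_dom_open _ _ M k) kv)).
Qed.

(** Only the parameters whose image lies in the chart k are kept; the point u of the statement
    serves as base point. *)
Definition param_dom : pointed_open R q.+2 := PointedOpen param_dom_open (conj Vu ku).

Let rg : riemannian_metric g.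
Proof. by have [g0 _ cE] := cc; have [] := (cE g).1 cg. Qed.

Let gk_smooth a b j : Ck j chart_range (fun x => gk x a b).
Proof. by have [sm _ _ _] := rg; exact: (smooth_onP _ _).1 (sm k a b) j. Qed.

Let gkC x : po_set chart_range x -> (gk x)^T = gk x.
Proof. by have [_ sym _ _] := rg; move=> [p kp <-]; rewrite in_chartE // sym. Qed.

Let gk_pos x : po_set chart_range x -> forall v : 'rV_q.+3, v != 0 ->
  0 < (v *m gk x *m v^T) 0 0.
Proof. by have [_ _ pos _] := rg; move=> [p kp <-]; rewrite in_chartE //; exact: pos. Qed.

Let F_smooth a j : Ck j param_dom (fun v => F v 0 a).
Proof. by have [_ _ _ sm _] := par; exact: (smooth_onP _ _).1 (sm k a) j. Qed.

Let F_range v : po_set param_dom v -> po_set chart_range (F v).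
Proof. by move=> [_ kv]; exists (X v). Qed.

Let F_imm v : po_set param_dom v -> row_free (jacobian F v).
Proof. by have [_ _ _ _ imm] := par; move=> [Vv kv]; exact: imm. Qed.

Let s_smooth j : Ck j chart_range s.
Proof. by have [[[sm _] _] _] := ob; exact: (smooth_onP _ _).1 (sm g cg k) j. Qed.

Let param_mem v : V v -> S (X v).
Proof.
by have [_ [W [_ VW _]] _ _ _] := par => Vv; have [] : (S `&` W) (X v) by rewrite -VW; exists v.
Qed.

Let sF v : po_set param_dom v -> s (F v) = 0.
Proof.
have [[_ df] _] := ob; move=> [Vv kv]; rewrite in_chartE //.
by apply: ((df g cg).1 (X v)).1; exact: param_mem.
Qed.

Let nuk v : po_set param_dom v ->
  [/\ nu v *m (jacobian F v)^T = 0,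
      (nu v *m invmx (gk (F v)) *m (nu v)^T) 0 0 = 1 &
      0 < (nu v *m invmx (gk (F v)) *m (grad s (F v))^T) 0 0].
Proof. by move=> [Vv kv]; rewrite in_chartE //; exact: nuP. Qed.

Lemma obstruction_surface : q = 0%N ->
  beta g (X u) = - 3^-1 * (divdiv2 gbar II0 u
                 + mean_curv gk F nu u * inner2 gbar II0 II0 u
                 + inner2 gbar (schouten_top gk F) II0 u).
Proof.
move=> q0; have [_ [B [[B_smooth _] BE betaE]]] := ob.
have Bs j : Ck j chart_range (in_chart (B g) k).
  exact: (smooth_onP _ _).1 (B_smooth g cg k) j.
have Isq x : po_set chart_range x -> Isquare gk s x = 1 + s x ^+ q.+3 * in_chart (B g) k x.
  by move=> [p kp <-]; rewrite BE // !in_chartE.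
rewrite betaE //; last exact: param_mem.
rewrite -(in_chartE (B g) ku).
exact: (surface_val gk_smooth gkC gk_pos F_smooth F_range F_imm s_smooth Bs Isq sF nuk q0
  (conj Vu ku)).
Qed.

Lemma obstruction_flat_hypersurface : q = 1%N -> flat_metric g ->
  beta g (X u) = 6^-1 * (inner3 gbar (nabla2 gbar II0) (nabla2 gbar II0) u
               + 2 * inner2 gbar II0 (laplacian2 gbar II0) u
               + 3 / 2 * inner1 gbar (div2 gbar II0) (div2 gbar II0) u
               - 2 * schoutenJ gbar u * inner2 gbar II0 II0 u
               + inner2 gbar II0 II0 u ^+ 2).
Proof.
move=> q1 flat; have [_ [B [[B_smooth _] BE betaE]]] := ob.
have Bs j : Ck j chart_range (in_chart (B g) k).
  exact: (smooth_onP _ _).1 (B_smooth g cg k) j.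
have Isq x : po_set chart_range x -> Isquare gk s x = 1 + s x ^+ q.+3 * in_chart (B g) k x.
  by move=> [p kp <-]; rewrite BE // !in_chartE.
rewrite betaE //; last exact: param_mem.
rewrite -(in_chartE (B g) ku).
exact: (flat4_val gk_smooth gkC gk_pos F_smooth F_range F_imm s_smooth Bs Isq sF nuk q1
  (conj Vu ku) (flat k)).
Qed.

End EmbeddedHypersurface.

Theorem proposition4p15 (R : realType) :
  (forall (M : oriented_manifold R 3) (c : set (metric_components M))
     (S : set M) (sigma beta : metric_components M -> M -> R),
     conformal_class c ->
     embedded_hypersurface S ->
     obstruction_density c S sigma beta ->
     forall g : metric_components M, c g ->
     forall (V : set 'rV[R]_2) (X : 'rV[R]_2 -> M) (k : chart M)
       (nu : 'rV[R]_2 -> 'rV[R]_3),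
     local_param S V X ->
     unit_conormal g (sigma g) V X k nu ->
     let gk := in_chart (g k) k in
     let F := chart_map k \o X in
     let gbar := induced_metric gk F in
     let H := mean_curv gk F nu in
     let II0 := tracefree_ff gk F nu in
     let Ptop := schouten_top gk F in
     forall u : 'rV[R]_2, V u -> chart_dom k (X u) ->
     beta g (X u) =
       - 3^-1 * (divdiv2 gbar II0 u
                 + H u * inner2 gbar II0 II0 u
                 + inner2 gbar Ptop II0 u))
  /\
  (forall (M : oriented_manifold R 4) (c : set (metric_components M))
     (S : set M) (sigma beta : metric_components M -> M -> R),
     conformal_class c ->
     embedded_hypersurface S ->
     obstruction_density c S sigma beta ->
     forall g : metric_components M, c g -> flat_metric g ->
     forall (V : set 'rV[R]_3) (X : 'rV[R]_3 -> M) (k : chart M)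
       (nu : 'rV[R]_3 -> 'rV[R]_4),
     local_param S V X ->
     unit_conormal g (sigma g) V X k nu ->
     let gk := in_chart (g k) k in
     let F := chart_map k \o X in
     let gbar := induced_metric gk F in
     let II0 := tracefree_ff gk F nu in
     let Jbar := schoutenJ gbar in
     forall u : 'rV[R]_3, V u -> chart_dom k (X u) ->
     beta g (X u) =
       6^-1 * (inner3 gbar (nabla2 gbar II0) (nabla2 gbar II0) u
               + 2 * inner2 gbar II0 (laplacian2 gbar II0) u
               + 3 / 2 * inner1 gbar (div2 gbar II0) (div2 gbar II0) u
               - 2 * Jbar u * inner2 gbar II0 II0 u
               + inner2 gbar II0 II0 u ^+ 2)).
Proof.
split=> M c S sigma beta cc _ ob g cg.
- move=> V X k nu par nuP gk F gbar H II0 Ptop u Vu ku.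
  exact: (obstruction_surface cc ob cg par nuP Vu ku).
- move=> flat V X k nu par nuP gk F gbar II0 Jbar u Vu ku.
  exact: (obstruction_flat_hypersurface cc ob cg par nuP Vu ku).
Qed.
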